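(* Let $(K,v)$ be a maximal field of characteristic $p>0$ for which the condition $(vK:pvK)\,[Kv:(Kv)^p]<\infty$ fails (which is equivalent to $K$ having infinite $p$-degree). Let $\kappa$ be the maximum of $(vK:pvK)$ and $[Kv:(Kv)^p]$, considered as cardinals. Then: a) The valued field $(K^{1/p},v)$ is again maximal, although $vK^{1/p}/vK$ is an infinite torsion group or $K^{1/p}v|Kv$ is an infinite algebraic extension. b) For every $n\in\mathbb N$ and every infinite cardinal $\lambda\leq\kappa$, there are subextensions $(L_n|K,v)$ and $(L_\lambda|K,v)$ of $(K^{1/p}|K,v)$ such that $(K^{1/p}|L_\lambda,v)$ is an immediate algebraic extension of degree $\lambda$ and $(K^{1/p}|L_n,v)$ is an immediate algebraic extension of degree $p^n$. c) There is a purely inseparable extension $(L|K,v)$ with $\bullet$ $vL=\frac1p vK$ and $Lv=Kv$ if $(vK:pvK)=\infty$, $\bullet$ $vL=vK$ and $Lv=(Kv)^{1/p}$ if $[Kv:(Kv)^p]=\infty$, such that every maximal immediate extension of $(L,v)$ has transcendence degree at least $\kappa$. In both cases, $L$ can also be taken to simultaneously satisfy $vL=\frac1p vK$ and $Lv=(Kv)^{1/p}$. If the cofinality of $vK$ is countable, then in b), $K^{1/p}$ can be replaced by the completion of $L_\lambda$ or $L_n$, respectively, and in c), ''maximal immediate extension'' can be replaced by ''completion''.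
   Context: For a valued field $(K,v)$ (Krull valuation, written additively), $vK$ denotes the value group and $Kv$ the residue field. In a valued field extension $(L|K,v)$, $K$ carries the restriction of $v$ from $L$. The extension is immediate if the canonical embeddings $vK\hookrightarrow vL$ and $Kv\hookrightarrow Lv$ are onto. A valued field is maximal if it admits no proper immediate extension; a maximal immediate extension of $(L,v)$ is an immediate extension of $(L,v)$ which is a maximal field, and its transcendence degree is taken over $L$. Purely inseparable extensions of $K$ (in particular $K^{1/p}=\{a^{1/p}\mid a\in K\}$) carry the unique extension of $v$, again denoted $v$; one has $vK^{1/p}=\frac1p vK$ and $K^{1/p}v=(Kv)^{1/p}$. $(Kv)^p$ is the field of $p$-th powers of elements of $Kv$. $K$ has infinite $p$-degree if $[K:K^p]$ is infinite. The completion of a valued field is its completion with respect to the valuation topology.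
   Formalization: The valuation v is assumed nontrivial in b), c) and the last paragraph; for a trivially valued K of infinite p-degree (which is maximal) those parts are false, since immediate extensions of trivially valued fields are trivial. *)

(* Defs.v *)
From HB Require Import structures.
From mathcomp Require Import all_boot all_order all_algebra.
From mathcomp Require Import boolp classical_sets functions cardinality filter.
From mathcomp Require Import mpoly.

Set Implicit Arguments.
Unset Strict Implicit.
Unset Printing Implicit Defensive.

Import Order.TTheory GRing.Theory.
Local Open Scope classical_set_scope.
Local Open Scope ring_scope.
Local Open Scope quotient_scope.
Local Open Scope card_scope.

(* Totality is an axiom here because joining [Num.POrderedZmodule] with
   [Order.Total] after [Num.RealDomain] is declared breaks the hierarchy. *)
HB.mixin Record isOrderedAbelianGroup G of Num.POrderedZmodule G := {
  oag_total : forall x y : G, (x <= y) || (y <= x);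
  oag_leD2l : forall z x y : G, x <= y -> z + x <= z + y
}.

#[short(type="oagType")]
HB.structure Definition OrderedAbelianGroup :=
  {G of Num.POrderedZmodule G & isOrderedAbelianGroup G}.

(* The extended group [G] with a top element: [None] is the value of [0]. *)
Section ExtendedGroup.
Variable G : oagType.

Definition vadd (a b : option G) : option G :=
  if a is Some x then if b is Some y then Some (x + y) else None else None.

Definition vle (a b : option G) : bool :=
  match a, b with
  | _, None => true
  | None, Some _ => false
  | Some x, Some y => x <= y
  end.

Definition vlt (a b : option G) : bool := ~~ vle b a.

Lemma vle_refl a : vle a a.
Proof. by case: a => //= x; exact: lexx. Qed.

Lemma vle_total a b : vle a b || vle b a.
Proof. by case: a b => [x|] [y|] //=; exact: oag_total. Qed.

Lemma vle_trans b a c : vle a b -> vle b c -> vle a c.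
Proof. by case: a b c => [x|] [y|] [z|] //=; exact: le_trans. Qed.

Lemma vlt_le_trans b a c : vlt a b -> vle b c -> vlt a c.
Proof. by move=> ab bc; apply: contra ab => /(vle_trans bc). Qed.

Lemma vltW a b : vlt a b -> vle a b.
Proof. by move=> ab; case/orP: (vle_total a b) => // ba; rewrite /vlt ba in ab. Qed.

Lemma oag_leD2r (z x y : G) : x <= y -> x + z <= y + z.
Proof. by rewrite ![_ + z]addrC; exact: oag_leD2l. Qed.

Lemma oag_leD (x y z t : G) : x <= y -> z <= t -> x + z <= y + t.
Proof. by move=> xy zt; apply: le_trans (oag_leD2r z xy) (oag_leD2l y _ _ zt). Qed.

Lemma vleD a b c d : vle a b -> vle c d -> vle (vadd a c) (vadd b d).
Proof. by case: a b c d => [x|] [y|] [z|] [t|] //=; exact: oag_leD. Qed.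

Lemma oag_dbl_eq0 (x : G) : x + x = 0 -> x = 0.
Proof.
move=> xx0; apply/eqP; rewrite eq_le; apply/andP.
case/orP: (oag_total x 0) => x0; split=> //.
  by have := oag_leD2r x x0; rewrite xx0 add0r.
by have := oag_leD2r x x0; rewrite xx0 add0r.
Qed.

End ExtendedGroup.

(* A Krull valuation, onto its value group.  As the order is total, [val_add]
   says [min (v x) (v y) <= v (x + y)]. *)
Record valuedField := ValuedField {
  vf_field :> fieldType;
  vgroup : oagType;
  val_of : vf_field -> option vgroup;
  val_eqNone : forall x, (val_of x == None) = (x == 0);
  val_mul : forall x y, val_of (x * y) = vadd (val_of x) (val_of y);
  val_add : forall x y,
    vle (val_of x) (val_of (x + y)) || vle (val_of y) (val_of (x + y));
  val_onto : forall g : vgroup, exists x, val_of x = Some g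
}.

Definition nontrivial_valuation (K : valuedField) : Prop :=
  exists g : vgroup K, g != 0.

Section ResidueField.
Variable K : valuedField.

Lemma val0 : val_of (0 : K) = None.
Proof. by apply/eqP; rewrite val_eqNone. Qed.

Lemma val_neq0 (x : K) : x != 0 -> {g | val_of x = Some g}.
Proof. by rewrite -val_eqNone; case: (val_of x) => // g _; exists g. Qed.

Lemma val1 : val_of (1 : K) = Some 0.
Proof.
have [g vg] := val_neq0 (oner_neq0 K).
have := val_mul (1 : K) 1; rewrite mulr1 vg => -[] /(congr1 (+%R^~ (- g))).
by rewrite addrK subrr => <-.
Qed.

Lemma valN (x : K) : val_of (- x) = val_of x.
Proof.
suff vN1 : val_of (-1 : K) = Some 0.
  by rewrite -mulN1r val_mul vN1; case: (val_of x) => //= g; rewrite add0r.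
have [g vg] : {g | val_of (-1 : K) = Some g}.
  by apply: val_neq0; rewrite oppr_eq0 oner_eq0.
have := val_mul (-1 : K) (-1); rewrite mulrNN mulr1 val1 vg /= => -[] /esym.
by move/oag_dbl_eq0 => ->.
Qed.

Lemma val_inv (x : K) g : val_of x = Some g -> val_of x^-1 = Some (- g).
Proof.
move=> vx; have x0 : x != 0 by rewrite -val_eqNone vx.
have [h vh] : {h | val_of x^-1 = Some h} by apply: val_neq0; rewrite invr_eq0.
have := val_mul x x^-1; rewrite divff // val1 vx vh => -[] /esym/eqP.
by rewrite addrC addr_eq0 => /eqP ->.
Qed.

Lemma val_add_ge a (x y : K) :
  vle a (val_of x) -> vle a (val_of y) -> vle a (val_of (x + y)).
Proof. by move=> ax ay; case/orP: (val_add x y); apply: vle_trans. Qed.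

Lemma val_add_gt a (x y : K) :
  vlt a (val_of x) -> vlt a (val_of y) -> vlt a (val_of (x + y)).
Proof. by move=> ax ay; case/orP: (val_add x y); apply: vlt_le_trans. Qed.

Definition in_valring : {pred K} := fun x => vle (Some 0) (val_of x).

Lemma in_valring_subring : subring_closed in_valring.
Proof.
split=> [|x y xO yO|x y xO yO]; rewrite unfold_in.
- by rewrite val1 vle_refl.
- by apply: val_add_ge => //; rewrite valN.
- by rewrite val_mul; have := vleD xO yO; rewrite /= addr0.
Qed.

HB.instance Definition _ :=
  GRing.isSubringClosed.Build K in_valring in_valring_subring.

Record valring := Valring { valring_val :> K; _ : valring_val \in in_valring }.

HB.instance Definition _ := [isSub for valring_val].
HB.instance Definition _ := [Choice of valring by <:].
HB.instance Definition _ := [SubChoice_isSubComNzRing of valring by <:].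

Definition in_maxideal : {pred valring} :=
  fun x => vlt (Some 0) (val_of (valring_val x)).

Lemma in_maxideal_ideal : idealr_closed in_maxideal.
Proof.
split=> [||a x y xM yM]; rewrite ?unfold_in /=.
- by rewrite /vlt val0.
- by rewrite /in_maxideal val1 /vlt vle_refl.
- apply: val_add_gt => //; rewrite /= val_mul.
  case: a => a /=; rewrite unfold_in /in_valring => aO.
  apply: (vlt_le_trans xM); have := vleD aO (vle_refl (val_of (valring_val x))).
  by case: (val_of (valring_val x)) => //= g; rewrite add0r.
Qed.

HB.instance Definition _ := isIdealr.Build valring in_maxideal in_maxideal_ideal.

Definition residue := {ideal_quot in_maxideal}.

HB.instance Definition _ := GRing.ComNzRing.on residue.

Definition res (x : valring) : residue := \pi_residue x.

Lemma res_repr (a : residue) : res (repr a) = a.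
Proof. exact: reprK. Qed.

Lemma res_eq0 x : (res x == 0) = (x \in in_maxideal).
Proof.
rewrite -[x in RHS]subr0 Quotient.idealrBE.
by rewrite /res -[0 in LHS](rmorph0 (\pi_residue)).
Qed.

Lemma residue_inv_ex (a : residue) : {b | a != 0 -> b * a = 1}.
Proof.
have [->|a0] := eqVneq a 0; first by exists 0.
set x := repr a; have ax : a = res x by rewrite res_repr.
have vx : val_of (valring_val x) = Some 0.
  move: a0; rewrite ax res_eq0 unfold_in /in_maxideal negbK.
  case: x {ax} => x /=; rewrite unfold_in /in_valring => xO xM.
  case: (val_of x) xO xM => //= g g0 g0'.
  by congr Some; apply/eqP; rewrite eq_le g0 g0'.
have x0 : valring_val x != 0 by rewrite -val_eqNone vx.
have xiO : (valring_val x)^-1 \in in_valring.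
  by rewrite unfold_in /in_valring (val_inv vx) oppr0 vle_refl.
exists (res (Valring xiO)) => _; rewrite ax -rmorphM -[RHS](rmorph1 (\pi_residue)).
by congr (\pi _); apply: val_inj => /=; rewrite mulVf.
Qed.

Definition residue_inv (a : residue) : residue :=
  if a == 0 then 0 else sval (residue_inv_ex a).

Lemma residue_mulVf a : a != 0 -> residue_inv a * a = 1.
Proof.
by move=> a0; rewrite /residue_inv ifN //; exact: (svalP (residue_inv_ex a)).
Qed.

Lemma residue_inv0 : residue_inv 0 = 0.
Proof. by rewrite /residue_inv ifT. Qed.

HB.instance Definition _ :=
  GRing.ComNzRing_isField.Build residue residue_mulVf residue_inv0.

HB.instance Definition _ := GRing.RMorphism.copy res (\pi_residue).

End ResidueField.

(* A field embedding [K -> L] together with the embedding of value groups under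
   which the valuation of [L] restricts to that of [K]; the latter is determined
   by the former. *)
Record valuedExt (K L : valuedField) := ValuedExt {
  ext_map :> {rmorphism K -> L};
  ext_val : {additive vgroup K -> vgroup L};
  ext_val_mono : {mono ext_val : x y / x <= y};
  ext_valE : forall x, val_of (ext_map x) = omap ext_val (val_of x)
}.

Section ResidueExtension.
Variables (K L : valuedField) (f : valuedExt K L).

Lemma ext_map_valring (x : valring K) : f (valring_val x) \in @in_valring L.
Proof.
case: x => x /=; rewrite !unfold_in /in_valring ext_valE.
by case: (val_of x) => //= g; rewrite -(ext_val_mono f) raddf0.
Qed.

Definition ext_ring (x : valring K) : valring L := Valring (ext_map_valring x).

Lemma ext_ring_zmod : zmod_morphism ext_ring.
Proof. by move=> x y; apply: val_inj; rewrite /= rmorphB. Qed.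

Lemma ext_ring_monoid : monoid_morphism ext_ring.
Proof.
by split=> [|x y]; apply: val_inj; rewrite /= ?rmorph1 ?rmorphM.
Qed.

HB.instance Definition _ :=
  GRing.isZmodMorphism.Build (valring K) (valring L) ext_ring ext_ring_zmod.
HB.instance Definition _ :=
  GRing.isMonoidMorphism.Build (valring K) (valring L) ext_ring ext_ring_monoid.

Definition ext_res (a : residue K) : residue L := res (ext_ring (repr a)).

Lemma ext_resE (x : valring K) : ext_res (res x) = res (ext_ring x).
Proof.
apply/eqP; rewrite -subr_eq0 /ext_res -!rmorphB res_eq0 unfold_in /in_maxideal.
set z := (_ - _ : valring K).
have : z \in @in_maxideal K by rewrite -res_eq0 raddfB /= res_repr subrr.
rewrite unfold_in /in_maxideal /= ext_valE; case: (val_of _) => //= g.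
by rewrite /vlt /= -(ext_val_mono f) raddf0.
Qed.

Lemma ext_res_zmod : zmod_morphism ext_res.
Proof.
move=> a b; by rewrite -[a]res_repr -[b]res_repr -rmorphB !ext_resE !rmorphB.
Qed.

Lemma ext_res_monoid : monoid_morphism ext_res.
Proof.
split=> [|a b]; first by rewrite -(rmorph1 (@res K)) ext_resE !rmorph1.
by rewrite -[a]res_repr -[b]res_repr -rmorphM !ext_resE !rmorphM.
Qed.

HB.instance Definition _ :=
  GRing.isZmodMorphism.Build (residue K) (residue L) ext_res ext_res_zmod.
HB.instance Definition _ :=
  GRing.isMonoidMorphism.Build (residue K) (residue L) ext_res ext_res_monoid.

End ResidueExtension.

Definition onto T U (f : T -> U) : Prop := forall y, exists x, f x = y.

Definition immediate K L (f : valuedExt K L) : Prop :=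
  onto (ext_val f) /\ onto (ext_res f).

Definition maximal (K : valuedField) : Prop :=
  forall L (f : valuedExt K L), immediate f -> onto f.

Definition max_immediate_ext K L (f : valuedExt K L) : Prop :=
  immediate f /\ maximal L.

(* The strict inequality makes the topology of a trivial valuation discrete. *)
Definition val_ball (K : valuedField) (g : vgroup K) (x : K) : set K :=
  [set y | vlt (Some g) (val_of (y - x))].

Definition val_cvg (K : valuedField) (F : set_system K) (x : K) : Prop :=
  forall g, F (val_ball g x).

Definition val_cauchy (K : valuedField) (F : set_system K) : Prop :=
  forall g, exists2 A, F A & forall x y, A x -> A y -> val_ball g x y.

Definition val_complete (K : valuedField) : Prop :=
  forall F : set_system K, ProperFilter F -> val_cauchy F ->
    exists x, val_cvg F x.

Definition is_completion K L (f : valuedExt K L) : Prop :=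
  (forall (y : L) g, exists x : K, val_ball g y (f x)) /\ val_complete L.

(* The elements of [G / H], for [H] a subgroup. *)
Definition cosets (G : zmodType) (H : set G) : set (set G) :=
  range (fun x => [set y | H (y - x)]).

Definition pmultiples (G : zmodType) (p : nat) : set G := range (fun x => x *+ p).
Arguments pmultiples : clear implicits.

Definition ppowers (F : fieldType) (p : nat) : set F := range (fun x => x ^+ p).
Arguments ppowers : clear implicits.

(* [B] is a basis of [L] as a vector space over its subfield [F]. *)
Definition is_basis (L : fieldType) (F B : set L) : Prop :=
  (forall n (b c : 'I_n -> L), injective b -> (forall i, B (b i)) ->
     (forall i, F (c i)) -> \sum_i c i * b i = 0 -> forall i, c i = 0) /\
  (forall y, exists n (b c : 'I_n -> L), [/\ forall i, B (b i),
     forall i, F (c i) & y = \sum_i c i * b i]).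

(* [[L : F]] is the cardinal of [A]. *)
Definition has_degree (L : fieldType) (F : set L) T (A : set T) : Prop :=
  exists2 B, is_basis F B & B #= A.

Definition finite_degree (L : fieldType) (F : set L) : Prop :=
  exists n, has_degree F `I_n.

Definition is_card_max T U V (kappa : set T) (A : set U) (B : set V) : Prop :=
  [/\ A #<= kappa, B #<= kappa & (kappa #= A) \/ (kappa #= B)].

Definition has_countable_cofinality (G : oagType) : Prop :=
  exists C : set G, countable C /\ forall g, exists2 c, C c & g <= c.

Definition algebraic_ext (K L : fieldType) (f : {rmorphism K -> L}) : Prop :=
  forall y, algebraicOver f y.

Definition purely_inseparable_ext (p : nat) (K L : fieldType)
    (f : {rmorphism K -> L}) : Prop :=
  forall y, exists n x, y ^+ (p ^ n) = f x.

(* [L] is [K^(1/p)]: it consists of the [p]-th roots of all elements of [K]. *)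
Definition is_pth_roots (p : nat) (K L : fieldType) (f : K -> L) : Prop :=
  (forall x, exists y, y ^+ p = f x) /\ (forall y, exists x, y ^+ p = f x).

(* [H] is [(1/p) G]; as [H] is torsion-free, [p]-th parts are unique. *)
Definition is_pth_parts (p : nat) (G H : oagType) (f : G -> H) : Prop :=
  (forall x, exists y, y *+ p = f x) /\ (forall y, exists x, y *+ p = f x).

Definition torsion_quotient (G : zmodType) (H : set G) : Prop :=
  forall x, exists2 n, (0 < n)%N & H (x *+ n).

Definition alg_independent (K L : fieldType) (f : {rmorphism K -> L})
    (B : set L) : Prop :=
  forall n (b : 'I_n -> L) (P : {mpoly K[n]}), injective b ->
    (forall i, B (b i)) -> (map_mpoly f P).@[b] = 0 -> P = 0.

Definition transcendence_basis (K L : fieldType) (f : {rmorphism K -> L})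
    (B : set L) : Prop :=
  alg_independent f B /\
  forall C, B `<=` C -> alg_independent f C -> C = B.

Definition trdeg_ge (K L : fieldType) (f : {rmorphism K -> L}) T
    (kappa : set T) : Prop :=
  exists2 B, transcendence_basis f B & kappa #<= B.

(* Main.v *)
(* Let W be a family of elements of K lifting a basis of vK/pvK and a p-basis of
   Kv. A combination over K^p of monomials in W of exponents less than p has the
   least value of its terms, hence the p-th roots xi_b of the elements b of W have
   the same property over K in K^(1/p). As maximal fields are spherically complete,
   W is infinite if and only if [K : K^p] is.

   a) The Frobenius endomorphism identifies K^(1/p) with K.

   b) For every a in kappa choose c_a in K of positive value, with pairwise distinct
   leading terms. Let t_a be the limit of sum_n c_a^n d_n xi_n, where the xi_n are
   distinct and the values of the d_n xi_n increase fast enough. Inverting Vandermonde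
   matrices gives combinations of finitely many t_a whose leading terms are d_n xi_n
   for prescribed n, so the t_a are p-independent over K(xi_b | b in W), to which
   K^(1/p) is immediate. Extend the t_a to a p-basis of K^(1/p) over that field, and
   let L be generated by the rest of it.

   c) In the perfect hull of K, perturb a family of p-th roots xi_(n,k) to
   r_(n,k+1) = xi_(n,k+1) + d_(n,k) r_(n,k)^(1/p), with the perturbation too small to
   change the leading term, and let L be generated by the r_b. In an extension of L
   with enough limits, let z_a be the limit of sum_n c_a^n d_n r_(n,n). The p^m-th
   power of r_(n,n) lies in K + K r_(n,n-m), so by the Vandermonde argument there are
   combinations of the z_a^(p^m) which, up to elements of K, have distinct leading
   terms for all m. A polynomial over K in the z_a can be rewritten with exponents
   less than p in these combinations, so it is nonzero. *)
From HB Require Import structures.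
From mathcomp Require Import all_boot all_order all_algebra.
From mathcomp Require Import boolp classical_sets functions cardinality filter.
From mathcomp Require Import qpoly qfpoly mpoly zify.
Require Import Defs.

Set Implicit Arguments.
Unset Strict Implicit.
Unset Printing Implicit Defensive.

Import Order.TTheory GRing.Theory.
Local Open Scope classical_set_scope.
Local Open Scope ring_scope.
Local Open Scope quotient_scope.
Local Open Scope card_scope.

(** * Values *)

(** One countable sequence of basis elements carries all kappa limits; only the nodes c_a differ. A
    relation involves finitely many limits, and beyond the basis elements in its coefficients
    infinitely many fresh ones remain to tell these limits apart. As c_a - c_b has value at most
    that of c_a, the inverse Vandermonde weights stay bounded by what the powers of c_a gain, and
    the tails of the series remain negligible. The perturbation in c) answers an obstacle: with
    plain p-th roots, the p-th powers of the series would live in K and limits could be found in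
    K^(1/p), algebraic over K. Climbing the perfect hull keeps the p^m-th power of r_(n,n) outside K
    for all n >= m, while the terms with n < m fall into K and are subtracted as constants. Value
    group and residue field of L see only leading terms, which are those of p-th roots, so the
    height of the tower does not enlarge them. Spherical completeness comes from Kaplansky's
    construction: a nest of balls with empty intersection defines a valuation on K(X) or on some
    K[X]/(q), immediate over K. *)

Section ExtendedOrder.
Variable G : oagType.
Implicit Types a b c d : option G.

Lemma vleNgt a b : vle a b = ~~ vlt b a.
Proof. by rewrite /vlt negbK. Qed.

Lemma vlt_irr a : vlt a a = false.
Proof. by rewrite /vlt vle_refl. Qed.

Lemma vle_anti a b : vle a b -> vle b a -> a = b.
Proof.
by case: a b => [x|] [y|] //= xy yx; congr Some; apply/eqP; rewrite eq_le xy.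
Qed.

Lemma vle_lt_trans b a c : vle a b -> vlt b c -> vlt a c.
Proof. by move=> ab; apply: contra => /vle_trans; apply. Qed.

Lemma vle_None a : vle a None.
Proof. by case: a. Qed.

Lemma vlt_None a : vlt None a = false.
Proof. by rewrite /vlt vle_None. Qed.

Lemma vltNone a : vlt a None = (a != None).
Proof. by case: a. Qed.

Lemma vle_eqVlt a b : vle a b -> a = b \/ vlt a b.
Proof.
move=> ab; have [ba|] := boolP (vle b a); first by left; apply: vle_anti.
by right.
Qed.

Lemma vaddC a b : vadd a b = vadd b a.
Proof. by case: a b => [x|] [y|] //=; rewrite addrC. Qed.

Lemma vaddA a b c : vadd a (vadd b c) = vadd (vadd a b) c.
Proof. by case: a b c => [x|] [y|] [z|] //=; rewrite addrA. Qed.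

Lemma vadd0 a : vadd a (Some 0) = a.
Proof. by case: a => //= x; rewrite addr0. Qed.

Lemma vle_add2r c a b : c != None -> vle (vadd a c) (vadd b c) = vle a b.
Proof.
case: c => // z _; apply/idP/idP => [/vleD/(_ (vle_refl (Some (- z))))|].
  by rewrite -!vaddA /= subrr !vadd0.
by move=> /vleD; apply; apply: vle_refl.
Qed.

Lemma vlt_add2r c a b : c != None -> vlt (vadd a c) (vadd b c) = vlt a b.
Proof. by move=> cN; rewrite /vlt vle_add2r. Qed.

Lemma vltD a b c d : c != None -> vlt a b -> vle c d -> vlt (vadd a c) (vadd b d).
Proof.
move=> cN ab cd; apply: (@vlt_le_trans _ (vadd b c)); first by rewrite vlt_add2r.
by rewrite vleD ?vle_refl.
Qed.

Lemma oag_ltW_total (x y : G) : ~~ (x <= y) -> y <= x.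
Proof. by move=> /negbTE xy; have := oag_total x y; rewrite xy. Qed.

Lemma oag_leMn (x y : G) n : x <= y -> x *+ n <= y *+ n.
Proof.
by move=> xy; elim: n => [|n IH]; rewrite ?mulr0n ?lexx // !mulrS oag_leD.
Qed.

Lemma oag_leMnE (x y : G) n : (0 < n)%N -> (x *+ n <= y *+ n) = (x <= y).
Proof.
case: n => // n _; apply/idP/idP; last exact: oag_leMn.
apply: contraTT => /[dup] nxy /oag_ltW_total yx; rewrite !mulrS.
have := @vltD (Some y) (Some x) (Some (y *+ n)) (Some (x *+ n)) isT.
by rewrite /vlt /= => -> //; apply: oag_leMn.
Qed.

Lemma oag_mulIn n : (0 < n)%N -> injective (fun x : G => x *+ n).
Proof.
move=> n0 x y /= xy; apply/eqP; rewrite eq_le.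
by rewrite -(oag_leMnE x y n0) -(oag_leMnE y x n0) xy lexx.
Qed.

End ExtendedOrder.

Section ValuationTheory.
Variable K : valuedField.
Implicit Types x y z : K.

Lemma val_None x : val_of x = None -> x = 0.
Proof. by move=> vx; apply/eqP; rewrite -val_eqNone vx. Qed.

Lemma val_NoneP x : x != 0 -> val_of x != None.
Proof. by rewrite val_eqNone. Qed.

Lemma valBC x y : val_of (x - y) = val_of (y - x).
Proof. by rewrite -valN opprB. Qed.

Lemma vlt_neq0 a x : vlt (val_of x) a -> x != 0.
Proof. by apply: contraTneq => ->; rewrite val0 vlt_None. Qed.

Lemma val_div x y : y != 0 -> vadd (val_of (x / y)) (val_of y) = val_of x.
Proof. by move=> y0; rewrite -val_mul divfK. Qed.

Lemma val_sum_ge I (s : seq I) (P : pred I) (F : I -> K) a :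
  (forall i, P i -> vle a (val_of (F i))) ->
  vle a (val_of (\sum_(i <- s | P i) F i)).
Proof.
move=> aF; elim/big_ind: _ => //; first by rewrite val0 vle_None.
by move=> *; apply: val_add_ge.
Qed.

Lemma val_sum_gt I (s : seq I) (P : pred I) (F : I -> K) a : a != None ->
  (forall i, P i -> vlt a (val_of (F i))) ->
  vlt a (val_of (\sum_(i <- s | P i) F i)).
Proof.
move=> aN aF; elim/big_ind: _ => //; first by rewrite val0 vltNone.
by move=> *; apply: val_add_gt.
Qed.

Lemma val_addl x y : vlt (val_of x) (val_of y) -> val_of (x + y) = val_of x.
Proof.
move=> xy; apply: vle_anti.
  rewrite vleNgt; apply/negP => h; rewrite -(valN y) in xy.
  by have := val_add_gt h xy; rewrite addrK vlt_irr.
by apply: val_add_ge; rewrite ?vle_refl ?vltW.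
Qed.

Lemma val_exp_le x y n :
  vle (val_of x) (val_of y) -> vle (val_of (x ^+ n)) (val_of (y ^+ n)).
Proof.
by move=> xy; elim: n => [|n IH]; rewrite ?vle_refl // !exprS !val_mul vleD.
Qed.

Lemma val_exp_lt x y n : (0 < n)%N ->
  vlt (val_of x) (val_of y) -> vlt (val_of (x ^+ n)) (val_of (y ^+ n)).
Proof.
case: n => // n _ xy; rewrite !exprS !val_mul vltD ?val_exp_le ?vltW //.
by rewrite val_NoneP // expf_neq0 // (vlt_neq0 xy).
Qed.

Lemma val_exp_leE x y n : (0 < n)%N ->
  vle (val_of (x ^+ n)) (val_of (y ^+ n)) = vle (val_of x) (val_of y).
Proof.
move=> n0; apply/idP/idP; last exact: val_exp_le.
by apply: contraTT => yx; apply: val_exp_lt.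
Qed.

Lemma val_exp_ltE x y n : (0 < n)%N ->
  vlt (val_of (x ^+ n)) (val_of (y ^+ n)) = vlt (val_of x) (val_of y).
Proof. by move=> n0; rewrite /vlt val_exp_leE. Qed.

Lemma val_expn x g n : val_of x = Some g -> val_of (x ^+ n) = Some (g *+ n).
Proof.
move=> vx; elim: n => [|n IH]; first by rewrite expr0 val1.
by rewrite exprS val_mul vx IH mulrS.
Qed.

Lemma val_min_ex (I : eqType) (s : seq I) (F : I -> K) i0 : i0 \in s ->
  exists2 i, i \in s & forall j, j \in s -> vle (val_of (F i)) (val_of (F j)).
Proof.
case: s => // i1 s _; elim: s i1 => [|i2 s IH] i1.
  by exists i1; rewrite ?mem_head // => j; rewrite inE => /eqP ->; apply: vle_refl.
have [i is_ Fi] := IH i2; case/orP: (vle_total (val_of (F i1)) (val_of (F i))) => le.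
  exists i1; rewrite ?mem_head // => j; rewrite inE => /predU1P[->|/Fi].
    exact: vle_refl.
  exact: vle_trans.
exists i; first by rewrite inE is_ orbT.
by move=> j; rewrite inE => /predU1P[->|/Fi].
Qed.

(* [x] and [y] have the same leading term: they agree up to a factor in
   [1 + m]; in particular both are nonzero. *)
Definition sim x y := vlt (val_of x) (val_of (x - y)).

Lemma sim_neq0 x y : sim x y -> x != 0.
Proof. exact: vlt_neq0. Qed.

Lemma sim_val x y : sim x y -> val_of y = val_of x.
Proof.
move=> xy; have := @val_addl x (- (x - y)); rewrite valN => /(_ xy) <-.
by rewrite opprB addrCA subrr addr0.
Qed.

Lemma sim_sym x y : sim x y -> sim y x.
Proof. by move=> xy; rewrite /sim (sim_val xy) valBC. Qed.

Lemma sim_neq0r x y : sim x y -> y != 0.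
Proof. by move=> /sim_sym/sim_neq0. Qed.

Lemma sim_refl x : x != 0 -> sim x x.
Proof. by move=> x0; rewrite /sim subrr val0 vltNone val_NoneP. Qed.

Lemma sim_trans y x z : sim x y -> sim y z -> sim x z.
Proof.
move=> xy yz; rewrite /sim -[x - z](subrKA y); apply: val_add_gt => //.
by rewrite -(sim_val xy).
Qed.

Lemma sim_mul x y x' y' : sim x x' -> sim y y' -> sim (x * y) (x' * y').
Proof.
move=> xx' yy'; rewrite /sim.
rewrite [_ - _](_ : _ = (x - x') * y + x' * (y - y')); last first.
  by rewrite mulrBl mulrBr addrA subrK.
apply: val_add_gt; rewrite !val_mul.
  by rewrite vlt_add2r ?val_NoneP ?(sim_neq0 yy').
by rewrite (sim_val xx') vaddC [X in vlt _ X]vaddC vlt_add2r ?val_NoneP ?(sim_neq0 xx').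
Qed.

Lemma sim_exp x y n : sim x y -> sim (x ^+ n) (y ^+ n).
Proof.
move=> xy; elim: n => [|n IH]; first by rewrite !expr0 sim_refl ?oner_eq0.
by rewrite !exprS sim_mul.
Qed.

Lemma sim_inv x y : sim x y -> sim x^-1 y^-1.
Proof.
move=> xy; have x0 := sim_neq0 xy; have y0 := sim_neq0r xy.
have := sim_mul (sim_mul (sim_sym xy) (sim_refl (invr_neq0 x0)))
          (sim_refl (invr_neq0 y0)).
by rewrite mulrAC divff // mul1r divff // mul1r.
Qed.

Lemma sim_div x y x' y' : sim x x' -> sim y y' -> sim (x / y) (x' / y').
Proof. by move=> xx' yy'; rewrite sim_mul ?sim_inv. Qed.

Lemma sim_addr x y z : sim x y -> vlt (val_of x) (val_of z) -> sim x (y + z).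
Proof.
by move=> xy xz; rewrite /sim opprD addrA val_add_gt ?valN.
Qed.

Lemma sim_addl x z : vlt (val_of x) (val_of z) -> sim x (x + z).
Proof. by move=> xz; rewrite sim_addr ?sim_refl ?(vlt_neq0 xz). Qed.

End ValuationTheory.

Section ResidueTheory.
Variable K : valuedField.
Implicit Types x y : K.

(* The residue of [x], with junk value [0] when [x] has negative value. *)
Definition rs x : residue K := res (insubd (0 : valring K) x).

Lemma in_valringE x : (x \in @in_valring K) = vle (Some 0) (val_of x).
Proof. by []. Qed.

Lemma rs_insubd x : vle (Some 0) (val_of x) -> valring_val (insubd (0 : valring K) x) = x.
Proof. by move=> xO; rewrite -/(\val _) insubdK. Qed.

Lemma rsE (x : valring K) : rs (valring_val x) = res x.
Proof.
congr res; apply: val_inj => /=; rewrite rs_insubd //; case: x => x /=.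
by rewrite in_valringE.
Qed.

Lemma rsD x y : vle (Some 0) (val_of x) -> vle (Some 0) (val_of y) ->
  rs (x + y) = rs x + rs y.
Proof.
move=> xO yO; rewrite -rmorphD; congr res; apply: val_inj => /=.
by rewrite !rs_insubd ?val_add_ge.
Qed.

Lemma vge0M x y : vle (Some 0) (val_of x) -> vle (Some 0) (val_of y) ->
  vle (Some 0) (val_of (x * y)).
Proof. by move=> xO yO; rewrite val_mul -[Some 0](vadd0 (Some 0)) vleD. Qed.

Lemma rsM x y : vle (Some 0) (val_of x) -> vle (Some 0) (val_of y) ->
  rs (x * y) = rs x * rs y.
Proof.
move=> xO yO; rewrite -rmorphM; congr res; apply: val_inj => /=.
by rewrite !rs_insubd ?vge0M.
Qed.

Lemma rs0 : rs 0 = 0.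
Proof. by rewrite -[0 in LHS]/(valring_val (0 : valring K)) rsE rmorph0. Qed.

Lemma rs1 : rs 1 = 1.
Proof. by rewrite -[1 in LHS]/(valring_val (1 : valring K)) rsE rmorph1. Qed.

Lemma vge0X x n : vle (Some 0) (val_of x) -> vle (Some 0) (val_of (x ^+ n)).
Proof. by move=> xO; have := @val_exp_le K 1 x n; rewrite expr1n val1; apply. Qed.

Lemma rsX x n : vle (Some 0) (val_of x) -> rs (x ^+ n) = rs x ^+ n.
Proof.
move=> xO; elim: n => [|n IH]; first by rewrite !expr0 rs1.
by rewrite !exprS rsM ?IH // vge0X.
Qed.

Lemma rs_eq0 x : vle (Some 0) (val_of x) -> (rs x == 0) = vlt (Some 0) (val_of x).
Proof. by move=> xO; rewrite /rs res_eq0 unfold_in /in_maxideal rs_insubd. Qed.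

Lemma rsN x : rs (- x) = - rs x.
Proof.
rewrite -rmorphN; congr res; apply: val_inj => /=.
have [xO|nxO] := boolP (vle (Some 0) (val_of x)); first by rewrite !rs_insubd ?valN.
by rewrite !(val_insubd (0 : valring K)) !in_valringE valN (negbTE nxO) oppr0.
Qed.

Lemma rs_eq x y : vle (Some 0) (val_of x) -> vle (Some 0) (val_of y) ->
  (rs x == rs y) = vlt (Some 0) (val_of (x - y)).
Proof.
move=> xO yO; rewrite -subr_eq0 -rsN -rsD ?valN // rs_eq0 //.
by rewrite val_add_ge ?valN.
Qed.

Lemma rs_sum I (s : seq I) (P : pred I) (F : I -> K) :
  (forall i, P i -> vle (Some 0) (val_of (F i))) ->
  rs (\sum_(i <- s | P i) F i) = \sum_(i <- s | P i) rs (F i).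
Proof.
move=> F0; suff: rs (\sum_(i <- s | P i) F i) = \sum_(i <- s | P i) rs (F i) /\
  vle (Some 0) (val_of (\sum_(i <- s | P i) F i)) by case.
elim/big_ind2: _ => [|x a y b [<- ?] [<- ?]|i Pi]; first by rewrite rs0 val0.
  by rewrite rsD // val_add_ge.
by rewrite F0.
Qed.

Lemma rs_onto (a : residue K) : exists2 x : K, vle (Some 0) (val_of x) & rs x = a.
Proof.
exists (valring_val (repr a)); last by rewrite rsE res_repr.
by case: (repr a) => x /=.
Qed.

Lemma rs_pchar p : p \in [pchar K] -> p \in [pchar residue K].
Proof.
move=> pK; rewrite inE (pcharf_prime pK) /=.
rewrite -(rmorph_nat (@res K)) (_ : _%:R = 0) ?rmorph0 //.
by apply: val_inj; rewrite rmorph_nat rmorph0 pcharf0.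
Qed.

End ResidueTheory.

Section Extension.
Variables (K L : valuedField) (f : valuedExt K L).

Lemma ext_val_le a b : vle (omap (ext_val f) a) (omap (ext_val f) b) = vle a b.
Proof. by case: a b => [x|] [y|] //=; rewrite ext_val_mono. Qed.

Lemma ext_val_lt a b : vlt (omap (ext_val f) a) (omap (ext_val f) b) = vlt a b.
Proof. by rewrite /vlt ext_val_le. Qed.

Lemma ext_val_inj : injective (ext_val f).
Proof. by move=> x y xy; apply/eqP; rewrite eq_le -!(ext_val_mono f) xy lexx. Qed.

Lemma ext_ge0 x : vle (Some 0) (val_of (f x)) = vle (Some 0) (val_of x).
Proof. by rewrite ext_valE -[in RHS]ext_val_le /= raddf0. Qed.

Lemma ext_lt x y : vlt (val_of (f x)) (val_of (f y)) = vlt (val_of x) (val_of y).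
Proof. by rewrite !ext_valE ext_val_lt. Qed.

Lemma ext_le x y : vle (val_of (f x)) (val_of (f y)) = vle (val_of x) (val_of y).
Proof. by rewrite !ext_valE ext_val_le. Qed.

Lemma ext_sim x y : sim (f x) (f y) = sim x y.
Proof. by rewrite /sim -rmorphB ext_lt. Qed.

Lemma ext_res_rs x : vle (Some 0) (val_of x) -> ext_res f (rs x) = rs (f x).
Proof.
move=> xO; rewrite -{1}(rs_insubd xO) rsE ext_resE -rsE /=.
by rewrite rs_insubd.
Qed.

Lemma res_onto_of_sim :
  (forall y, val_of y = Some 0 -> exists x, sim y (f x)) -> onto (ext_res f).
Proof.
move=> H b; have [y yO <-] := rs_onto b.
have [vy|ylt] := vle_eqVlt yO; last first.
  by exists 0; rewrite rmorph0; apply/esym/eqP; rewrite rs_eq0.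
have [x yx] := H y (esym vy).
have xO : vle (Some 0) (val_of x) by rewrite -ext_ge0 (sim_val yx).
exists (rs x); rewrite ext_res_rs //; apply/esym/eqP.
by rewrite rs_eq ?ext_ge0 // {1}vy.
Qed.

(** Value and residue are both read off the leading term, so one condition gives both surjections;
    immediacy is mostly checked in this form. *)
Lemma immediate_of_sim :
  (forall y, y != 0 -> exists x, sim y (f x)) -> immediate f.
Proof.
move=> H; split; last first.
  by apply: res_onto_of_sim => y vy; apply: H; rewrite -val_eqNone vy.
move=> g; have [y vy] := val_onto g.
have [|x /sim_val] := H y; first by rewrite -val_eqNone vy.
rewrite vy ext_valE; case: (val_of x) => //= h [<-]; by exists h.
Qed.

End Extension.

(** * Maximal fields are spherically complete *)

(* Balls of any radius, possibly a cut of the value group. *)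
Definition vball (K : valuedField) (B : set K) : Prop :=
  forall x y z, B x -> B y -> vle (val_of (y - x)) (val_of (z - x)) -> B z.

Definition sph_complete (K : valuedField) : Prop :=
  forall D : set (set K), (forall B, D B -> vball B /\ B !=set0) ->
    (forall B B', D B -> D B' -> B `<=` B' \/ B' `<=` B) ->
    exists x, forall B, D B -> B x.

Import Pdiv.CommonRing.

Section Nest.
Variables (K : valuedField) (D : set (set K)).
Hypothesis Dball : forall B, D B -> vball B.
Hypothesis Dne : forall B, D B -> B !=set0.
Hypothesis Dchain : forall B B', D B -> D B' -> B `<=` B' \/ B' `<=` B.
Hypothesis Dempty : forall c, exists2 B, D B & ~ B c.
Implicit Types (P Q : K -> Prop) (f h q : {poly K}).

(** The filter generated by the nest: [ev P] says that [P] holds eventually. *)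
Let ev P := exists2 B, D B & forall x, B x -> P x.

Lemma ev_and P Q : ev P -> ev Q -> ev (fun x => P x /\ Q x).
Proof.
move=> [B DB BP] [C DC CQ]; case: (Dchain DB DC) => BC.
  by exists B => // x Bx; split; [apply: BP|apply/CQ/BC].
by exists C => // x Cx; split; [apply/BP/BC|apply: CQ].
Qed.

Lemma ev_mono P Q : (forall x, P x -> Q x) -> ev P -> ev Q.
Proof. by move=> PQ [B DB BP]; exists B => // x /BP/PQ. Qed.

Lemma ev_ex P : ev P -> exists x, P x.
Proof. by move=> [B DB BP]; have [x /BP] := Dne DB; exists x. Qed.

Lemma ev_all P : (forall x, P x) -> ev P.
Proof. by move=> allP; have [B DB _] := Dempty 0; exists B. Qed.

(** Kaplansky's condition that the nest fixes the value of [f], strengthened to fix its leading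
    term. *)
Let stable f :=
  exists2 B, D B & forall x y, B x -> B y -> sim f.[x] f.[y].

Lemma stable_ev f : stable f -> exists g, ev (fun x => val_of f.[x] = Some g).
Proof.
move=> [B DB fB]; have [x Bx] := Dne DB.
have [|g fx] := @val_neq0 _ f.[x]; first by apply: sim_neq0 (fB _ _ Bx Bx).
by exists g; exists B => // y By; rewrite (sim_val (fB _ _ Bx By)).
Qed.

Lemma stable_of_sim f c : ev (fun x => sim f.[c] f.[x]) -> stable f.
Proof.
move=> [B DB fB]; exists B => // x y /fB/sim_sym cx /fB cy.
exact: sim_trans cx cy.
Qed.

Lemma stableC c : c != 0 -> stable c%:P.
Proof.
move=> c0; apply: (@stable_of_sim _ 0); apply: ev_all => x.
by rewrite !hornerC sim_refl.
Qed.

Lemma stableM f (g : {poly K}) : stable f -> stable g -> stable (f * g).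
Proof.
move=> [B DB fB] [C DC gC]; case: (Dchain DB DC) => BC.
  by exists B => // x y Bx By; rewrite !hornerM sim_mul ?fB // gC //; apply: BC.
by exists C => // x y Bx By; rewrite !hornerM sim_mul ?gC // fB //; apply: BC.
Qed.

(** If [x - c] and [y - c] had different leading terms, [c] would be at least as close to [x] as [y]
    is, hence in the ball. *)
Lemma stableXsubC c : stable ('X - c%:P).
Proof.
have [B DB Bc] := Dempty c; exists B => // x y Bx By.
rewrite !hornerXsubC /sim (_ : x - c - (y - c) = x - y); last first.
  by rewrite opprB addrA subrK.
rewrite /vlt; apply/negP => le; apply: Bc; apply: (Dball DB Bx By).
by rewrite valBC [X in vle _ X]valBC.
Qed.

(* [f - f(c)] is stable for every [c], being the product of [X - c] and a
   polynomial of lower degree. *)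
Lemma stable_or_increasing f : f != 0 ->
  (forall h, h != 0 -> (size h < size f)%N -> stable h) ->
  stable f \/ forall c, ev (fun x => vlt (val_of f.[c]) (val_of f.[x])).
Proof.
move=> f0 lower; have [sf|sf] := leqP (size f) 1.
  left; have f_const := size1_polyC sf; rewrite f_const; apply: stableC.
  by apply: contraNneq f0 => f00; rewrite f_const f00.
have sFc c : stable (f - f.[c]%:P).
  have /factor_theorem[g fg] : root (f - f.[c]%:P) c.
    by rewrite /root hornerD hornerN hornerC subrr.
  rewrite fg; apply: stableM (stableXsubC c).
  have sF : size (f - f.[c]%:P) = size f.
    rewrite size_polyDl // size_polyN (leq_ltn_trans (size_polyC_leq1 _)) //.
  have g0 : g != 0.
    by apply: contraTneq sf => g0; rewrite -sF fg g0 mul0r size_poly0.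
  apply: lower => //; rewrite -sF fg size_Mmonic ?monicXsubC //.
  by rewrite size_XsubC addn2.
have [[c fc]|/forallNP fNs] := EM (exists c,
    ev (fun x => vlt (val_of f.[c]) (val_of (f.[c] - f.[x])))).
  by left; apply: (stable_of_sim fc).
right=> c; have [B DB FB] := sFc c; exists B => // x Bx.
(* As [f(x)] is not eventually the leading term of [f], some [y] in [B] has v(f(x) - f(y)) <=
   v(f(x)). The leading term of f - f(c) being constant on [B], v(f(x) - f(c)) < v(f(x) - f(y)), so
   v(f(c)) = v(f(c) - f(x)) < v(f(x)). *)
have [y By le] : exists2 y, B y & vle (val_of (f.[x] - f.[y])) (val_of f.[x]).
  apply: contrapT => H; apply: (fNs x); exists B => // y By.
  by apply: contrapT => nlt; apply: H; exists y; rewrite // vleNgt; apply/negP.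
have := FB _ _ Bx By; rewrite /sim !hornerE.
rewrite (_ : _ - _ - _ = f.[x] - f.[y]); last by rewrite opprB addrA subrK.
move=> /vlt_le_trans/(_ le) lt; move: (lt); rewrite valBC => /val_addl.
by rewrite subrK => ->; rewrite valBC.
Qed.

(** The eventual value of [f], meant as its value in an extension of [K]; [None] is both the value
    of the zero polynomial and the default. *)
Let wv f : option (vgroup K) := xget None [set a | ev (fun x => val_of f.[x] = a)].

Lemma wvE f a : ev (fun x => val_of f.[x] = a) -> wv f = a.
Proof.
move=> fa; rewrite /wv; case: xgetP => [b _ fb|/(_ a)//].
by have [x [<- <-]] := ev_ex (ev_and fa fb).
Qed.

Lemma wvP f : f = 0 \/ stable f -> ev (fun x => val_of f.[x] = wv f).
Proof.
move=> [->|/stable_ev[g fg]]; last by rewrite (wvE fg).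
rewrite (@wvE _ None); apply: ev_all => x; by rewrite horner0 val0.
Qed.

Lemma wv0 f : f = 0 \/ stable f -> (wv f == None) = (f == 0).
Proof.
move=> [->|/stable_ev[g fg]].
  by rewrite eqxx (@wvE _ None) //; apply: ev_all => x; rewrite horner0 val0.
rewrite (wvE fg); apply/esym/negP => /eqP f0.
by have [x] := ev_ex fg; rewrite f0 horner0 val0.
Qed.

Lemma wvM f (g : {poly K}) : f = 0 \/ stable f -> g = 0 \/ stable g ->
  wv (f * g) = vadd (wv f) (wv g).
Proof.
move=> /wvP sf /wvP sg; apply: wvE; apply: ev_mono (ev_and sf sg) => x [fx gx].
by rewrite hornerM val_mul fx gx.
Qed.

Lemma wvD f (g : {poly K}) : f = 0 \/ stable f -> g = 0 \/ stable g ->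
  f + g = 0 \/ stable (f + g) ->
  vle (wv f) (wv (f + g)) || vle (wv g) (wv (f + g)).
Proof.
move=> /wvP sf /wvP sg /wvP sfg.
have [x [<- [<- <-]]] := ev_ex (ev_and sf (ev_and sg sfg)).
by rewrite hornerD val_add.
Qed.

Lemma wvC c : wv c%:P = val_of c.
Proof. by apply: wvE; apply: ev_all => x; rewrite hornerC. Qed.

(** This makes the extensions below immediate: eventually [f] has the leading term of the constant
    [f.[c]], with [c] in a ball where [f] is stable. The premise on the difference ensures that it
    has an eventual value. *)
Lemma wv_sim f : stable f -> exists c,
  f - f.[c]%:P = 0 \/ stable (f - f.[c]%:P) -> vlt (wv f) (wv (f - f.[c]%:P)).
Proof.
move=> fs; have [B DB fB] := fs; have [c Bc] := Dne DB; exists c => /wvP sF.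
have evB : ev (fun x => sim f.[x] f.[c]) by exists B => // x Bx; apply: fB.
have [x [fx [simx Fx]]] := ev_ex (ev_and (wvP (or_intror fs)) (ev_and evB sF)).
by rewrite -fx -Fx; move: simx; rewrite /sim !hornerE.
Qed.

Local Notation "x %:F" := (@FracField.tofrac _ x).

(** The eventual value would extend to a valuation of [K(X)], immediate over [K] because a quotient
    of stable polynomials has the leading term of a quotient of constants. Maximality would then put
    [X] in [K]. *)
Lemma nest_not_all_stable : maximal K -> ~ forall f, f != 0 -> stable f.
Proof.
move=> hK allst; have {}allst f : f = 0 \/ stable f.
  by have [->|/allst] := eqVneq f 0; [left|right].
have wvM' f g : wv (f * g) = vadd (wv f) (wv g) by apply: wvM.
have wv0' f : (wv f == None) = (f == 0) by apply: wv0.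
pose F := {fraction {poly K}}.
have frac_repr (y : F) : y * (\d_(repr y))%:F = (\n_(repr y))%:F.
  rewrite -{1}[y]reprK; unlock FracField.tofrac.
  rewrite -[LHS]FracField.pi_mul; apply/eqP.
  rewrite FracField.equivf_def /FracField.mulf.
  by rewrite !numden_Ratio ?mulf_neq0 ?oner_neq0 ?denom_ratioP // !mulr1 mulrC.
pose vopp a : option (vgroup K) := omap -%R a.
have voppK a b : b != None -> vadd (vadd a (vopp b)) b = a.
  case: a b => [x|] [y|] //= _; by rewrite subrK.
have vaddK (a b c : option (vgroup K)) : c != None -> vadd a c = vadd b c -> a = b.
  by case: a b c => [x|] [y|] [z|] //= _ [] /addIr ->.
(* Numerator and denominator come from a chosen representative; [fwE] frees the value from that
   choice. *)
pose fw (y : F) := vadd (wv \n_(repr y)) (vopp (wv \d_(repr y))).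
have fwE (y : F) a b : b != 0 -> y * b%:F = a%:F -> vadd (fw y) (wv b) = wv a.
  move=> b0 yb; have d0 := denom_ratioP (repr y).
  have ndab : \n_(repr y) * b = a * \d_(repr y).
    apply/eqP; rewrite -tofrac_eq !rmorphM /= -yb -frac_repr; by rewrite mulrAC.
  apply: (vaddK _ _ (wv \d_(repr y))); first by rewrite wv0'.
  rewrite -wvM' -ndab wvM' -vaddA [vadd (wv b) _]vaddC vaddA voppK //.
  by rewrite wv0'.
have fw_eq0 (y : F) : (fw y == None) = (y == 0).
  have d0 := denom_ratioP (repr y).
  have -> : (y == 0) = (\n_(repr y) == 0).
    by rewrite -(tofrac_eq0 \n__) -frac_repr mulf_eq0 tofrac_eq0 (negbTE d0) orbF.
  move: d0; rewrite -!wv0' -(fwE y _ _ (denom_ratioP _) (frac_repr y)).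
  by case: (wv _) (fw y) => [g|] [h|].
have frac_rep (y : F) : exists a b, b != 0 /\ y * b%:F = a%:F.
  by exists \n_(repr y), \d_(repr y); rewrite denom_ratioP frac_repr.
have tofrac_neq0 (b : {poly K}) : b != 0 -> b%:F != 0 by rewrite tofrac_eq0.
have fwF (a : {poly K}) : fw a%:F = wv a.
  by rewrite -(fwE a%:F a 1) ?oner_neq0 ?rmorph1 ?mulr1 // wvC val1 vadd0.
have fwM x y : fw (x * y) = vadd (fw x) (fw y).
  have [a [b [b0 xb]]] := frac_rep x; have [c [d [d0 yd]]] := frac_rep y.
  apply: (vaddK _ _ (wv (b * d))); first by rewrite wv0' mulf_neq0.
  rewrite (fwE _ (a * c)) ?mulf_neq0 // ?rmorphM /= -?xb -?yd; last first.
    by rewrite mulrACA.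
  rewrite !wvM' -(fwE _ _ _ b0 xb) -(fwE _ _ _ d0 yd).
  by case: (fw x) (fw y) (wv b) (wv d) => [g1|] [g2|] [g3|] [g4|] //=; rewrite addrACA.
have fwD x y : vle (fw x) (fw (x + y)) || vle (fw y) (fw (x + y)).
  have [a [b [b0 xb]]] := frac_rep x; have [c [d [d0 yd]]] := frac_rep y.
  rewrite -(@vle_add2r _ (wv (b * d))) ?wv0' ?mulf_neq0 //.
  rewrite -[X in _ || X](@vle_add2r _ (wv (b * d))) ?wv0' ?mulf_neq0 //.
  rewrite (fwE x (a * d)) ?mulf_neq0 //; last by rewrite !rmorphM /= mulrA xb.
  have yE : y * (b * d)%:F = (c * b)%:F by rewrite !rmorphM /= mulrCA yd mulrC.
  rewrite (fwE y (c * b)) ?mulf_neq0 // (fwE (x + y) (a * d + c * b)) ?mulf_neq0 //.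
    exact: wvD.
  by rewrite mulrDl rmorphD yE !rmorphM /= mulrA xb.
pose i : {rmorphism K -> F} := (@FracField.tofrac _ \o @polyC K)%FUN.
have fwi x : fw (i x) = val_of x by rewrite fwF wvC.
have fw_onto g : exists x, fw x = Some g.
  by have [x vx] := val_onto g; exists (i x); rewrite fwi.
pose L := @ValuedField F _ fw fw_eq0 fwM fwD fw_onto.
have fwi' x : @val_of L (i x) = omap (idfun : vgroup K -> vgroup L) (val_of x).
  by rewrite [LHS]fwi; case: (val_of x).
pose f := @ValuedExt K L i idfun (fun _ _ => erefl) fwi'.
suff /hK/(_ 'X%:F)[c /eqP] : immediate f.
  rewrite tofrac_eq => /eqP/(congr1 (fun f : {poly K} => size f)) sX.
  by have := size_polyC_leq1 c; rewrite sX size_polyX.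
apply: immediate_of_sim => y y0; have [a [b [b0 yb]]] := frac_rep y.
have simF (h : {poly K}) : h != 0 -> exists c, @sim L h%:F (f c).
  have [->|sh _] := allst h; first by rewrite eqxx.
  have [c hc] := wv_sim sh; exists h.[c].
  by rewrite /sim /= -rmorphB !fwF; apply: hc.
have [|a' aa'] := simF a.
  by rewrite -tofrac_eq0 -yb mulf_neq0 ?tofrac_neq0.
have [b' bb'] := simF b b0; exists (a' / b').
rewrite fmorph_div -[y](mulfK (tofrac_neq0 b b0)) yb; exact: sim_div.
Qed.

(** A monic unstable [q] of least degree is irreducible, and the representatives modulo [q], being
    of lower degree, are stable or zero. Their eventual values make [K[X]/(q)] an immediate
    extension of [K] of degree at least 2. *)
Lemma nest_not_unstable : maximal K -> ~ exists f, f != 0 /\ ~ stable f.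
Proof.
move=> hK [f0 [f00 f0ns]].
have [q [q0 qns lower]] : exists q, [/\ q != 0, ~ stable q &
    forall h, h != 0 -> (size h < size q)%N -> stable h].
  have: exists n, `[< exists f, [/\ f != 0, ~ stable f & size f = n] >].
    by exists (size f0); apply/asboolP; exists f0.
  move=> /ex_minnP[n /asboolP[q [q0 qns <-]] qmin]; exists q; split=> // h h0 hq.
  apply: contrapT => hns; move: hq; rewrite ltnNge => /negP; apply; apply: qmin.
  by apply/asboolP; exists h.
wlog qm : q q0 qns lower / q \is monic.
  have lq0 : (lead_coef q)^-1 != 0 by rewrite invr_eq0 lead_coef_eq0.
  move=> /(_ ((lead_coef q)^-1 *: q)); apply.
  - by rewrite scaler_eq0 negb_or lq0.
  - move=> qs; apply: qns.
    have -> : q = (lead_coef q)%:P * ((lead_coef q)^-1 *: q).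
      by rewrite mul_polyC scalerA divff ?scale1r ?lead_coef_eq0.
    by apply: stableM => //; apply: stableC; rewrite lead_coef_eq0.
  - by move=> h h0; rewrite size_scale //; apply: lower.
  - by rewrite monicE lead_coefZ mulVf // lead_coef_eq0.
have [//|qinc] := stable_or_increasing q0 lower.
have sq : (1 < size q)%N.
  rewrite ltnNge; apply/negP => sq; apply: qns.
  rewrite (size1_polyC sq); apply: stableC.
  by apply: contraNneq q0 => q00; rewrite (size1_polyC sq) q00.
have qirr : irreducible_poly q.
  split=> // a a1 aq; rewrite -dvdp_size_eqp //.
  have [b qab] : exists b, q = b * a by exists (q %/ a); rewrite divpK.
  have := q0; rewrite qab mulf_eq0 negb_or => /andP[b0 a0].
  have sa : (0 < size a)%N by rewrite size_poly_gt0.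
  have sb : (0 < size b)%N by rewrite size_poly_gt0.
  rewrite -qab eqn_leq dvdp_leq //= leqNgt; apply/negP => lt; apply: qns.
  rewrite qab; apply: stableM; last exact: lower.
  apply: lower => //; rewrite qab size_mul //.
  by move: a1 sa; case: (size a) => [|[|n]] // _ _; rewrite !addnS /= ltnS leq_addr.
have mi : monic_irreducible_poly q by [].
pose Lf := {poly %/ q with mi}.
have mkE : mk_monic q = q by exact: mk_monicE.
have sL (y : Lf) : (size (y : {poly K}) < size q)%N.
  by apply: leq_trans (size_mk_monic (y : {poly %/ q})) _; rewrite mkE.
have stL (y : Lf) : (y : {poly K}) = 0 \/ stable y.
  by have [->|y0] := eqVneq (y : {poly K}) 0; [left|right; apply: lower].
pose w (y : Lf) := wv (y : {poly K}).
have y_eq0 (y : Lf) : (y == 0) = ((y : {poly K}) == 0) by [].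
have w0 y : (w y == None) = (y == 0) by rewrite y_eq0; apply: wv0.
have wD x y : vle (w x) (w (x + y)) || vle (w y) (w (x + y)).
  exact: (wvD (stL x) (stL y) (stL (x + y))).
have mulE (x y : Lf) : (x * y : {poly K}) = rmodp ((x : {poly K}) * y) q.
  exact: etrans (@poly_of_qpolyM _ q x y) (congr1 _ mkE).
have wM x y : w (x * y) = vadd (w x) (w y).
  rewrite -(wvM (stL x) (stL y)); have [->|x0] := eqVneq x 0; first by rewrite !mul0r.
  have [->|y0] := eqVneq y 0; first by rewrite !mulr0.
  have := mulf_neq0 x0 y0; rewrite y_eq0 /w mulE => r0.
  set h := (x : {poly K}) * (y : {poly K}) in r0 *.
  have hstable : stable h.
    by apply: stableM; apply: lower => //; rewrite -y_eq0.
  have hE : h = (rdivp h q) * q + rmodp h q by apply: Pdiv.RingMonic.rdivp_eq qm _.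
  set c := rdivp h q in hE; set r := rmodp h q in r0 hE *.
  have rstable : stable r by apply: lower; rewrite // ltn_rmodp.
  (* If the remainder [r] had another value than [h], the product [c * q = h - r] would have a
     constant eventual value; [c] being stable, so would [q], whose values keep increasing. *)
  apply: contrapT => /eqP wrh.
  have c0 : c != 0 by apply: contraNneq wrh => c0; rewrite hE c0 mul0r add0r.
  have cstable : stable c.
    apply: lower => //.
    (* Two factors of size below that of [q] leave a quotient [c] of size below that of [q], so [c]
       is stable by minimality. *)
    have arith a b d e n m : (b <= (d + e).-1 -> d < n -> e < n -> m < n ->
      (a + n).-1 <= maxn b m -> a < n)%N by lia.
    apply: (arith _ (size h) _ _ _ (size r) (size_polyMleq _ _) (sL x) (sL y)).
      by rewrite ltn_rmodp.
    rewrite -size_Mmonic // (_ : c * q = h - r); last by rewrite hE addrK.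
    by apply: leq_trans (size_polyD _ _) _; rewrite size_polyN.
  have cq_const : exists g, ev (fun x => val_of (c * q).[x] = g).
    have evhr := ev_and (wvP (or_intror hstable)) (wvP (or_intror rstable)).
    have [|lt] := boolP (vlt (wv h) (wv r)) => [lt|].
      exists (wv h); apply: ev_mono evhr => z [hz rz].
      have -> : c * q = h - r by rewrite hE addrK.
      by rewrite hornerD hornerN val_addl // valN hz rz.
    exists (wv r); apply: ev_mono evhr => z [hz rz].
    have -> : c * q = - r + h by rewrite hE addrC addrK.
    rewrite hornerD hornerN val_addl ?valN // hz rz.
    move: lt; rewrite -vleNgt => /vle_eqVlt[] // rh; by rewrite rh eqxx in wrh.
  have [g cq] := cq_const; have [g' cg] := stable_ev cstable.
  have [z zP] := ev_ex (ev_and cq cg).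
  have [B DB BP] := ev_and cq (ev_and cg (qinc z)).
  have [z1 /BP[z1q [z1c z1lt]]] := Dne DB.
  have [B' DB' BP'] := qinc z1.
  have [z2 [[z2q z2c] z2lt]] := ev_ex (ev_and (ev_and cq cg) (qinc z1)).
  suff : val_of q.[z1] = val_of q.[z2] by move=> E; rewrite E vlt_irr in z2lt.
  move: z1q z2q; rewrite !hornerM !val_mul z1c z2c => <-.
  by case: (val_of q.[z1]) (val_of q.[z2]) => [u|] [v|] //= [] /addrI ->.
pose i : {rmorphism K -> Lf} := qpolyC q.
have wi x : w (i x) = val_of x by rewrite /w wvC.
have w_onto g : exists x, w x = Some g.
  by have [x vx] := val_onto g; exists (i x); rewrite wi.
pose L := @ValuedField Lf _ w w0 wM wD w_onto.
have wi' x : @val_of L (i x) = omap (idfun : vgroup K -> vgroup L) (val_of x).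
  by rewrite [LHS]wi; case: (val_of x).
pose f := @ValuedExt K L i idfun (fun _ _ => erefl) wi'.
(* Linear polynomials are stable; in degree at least 2 the class of [X] is not a constant. *)
have sq2 : (2 < size q)%N.
  rewrite ltnNge; apply/negP => sq2; apply: qns.
  have {sq2}sq2 : size q = 2 by apply/eqP; rewrite eqn_leq sq2.
  suff -> : q = 'X - (- q`_0)%:P by apply: stableXsubC.
  apply/polyP => -[|[|k]]; rewrite coefB coefX coefC /= ?subr0 ?sub0r ?opprK //.
    by move: qm; rewrite monicE lead_coefE sq2 => /eqP.
  by rewrite nth_default // sq2.
suff /hK/(_ (in_qpoly q 'X))[c] : immediate f.
  move=> /(congr1 (fun y : Lf => size (y : {poly K})))/=.
  have := qpolyXE sq2 qm; rewrite /qpolyX => /(congr1 (fun y : {poly K} => size y)) /= ->.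
  by rewrite size_polyX => s1; have := size_polyC_leq1 c; rewrite s1.
apply: immediate_of_sim => y y0.
have [|c yc] := @wv_sim (y : {poly K}); first by have [y00|] := stL y; first by rewrite y_eq0 y00 eqxx in y0.
exists (y : {poly K}).[c]; exact: yc (stL (y - i _)).
Qed.
End Nest.

Lemma maximal_sph_complete (K : valuedField) : maximal K -> sph_complete K.
Proof.
move=> hK D Dgood Dchain; apply: contrapT => /forallNP Dempty.
have De c : exists2 B, D B & ~ B c.
  apply: contrapT => H; apply: (Dempty c) => B DB; apply: contrapT => nBc.
  by apply: H; exists B.
have Db B (DB : D B) := (Dgood B DB).1; have Dn B (DB : D B) := (Dgood B DB).2.
apply: (@nest_not_all_stable K D) => // f f0.
apply: contrapT => fns; apply: (@nest_not_unstable K D) => //.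
by exists f.
Qed.

(** * Infinite cardinals *)

Lemma card_le_inj T U (A : set T) (B : set U) (f : T -> U) :
  (forall x, A x -> B (f x)) -> (forall x y, A x -> A y -> f x = f y -> x = y) ->
  A #<= B.
Proof.
move=> fAB finj; have finj' : {in A &, injective f}.
  by move=> x y /set_mem Ax /set_mem Ay; apply: finj.
have /card_eqPle[_ /card_le_trans] := inj_card_eq finj'; apply.
by apply: subset_card_le => _ [x Ax <-]; apply: fAB.
Qed.

Lemma card_le_ex T U (A : set T) (B : set U) (u0 : U) : A #<= B ->
  exists f : T -> U, (forall x, A x -> B (f x)) /\
    (forall x y, A x -> A y -> f x = f y -> x = y).
Proof.
move=> /card_leP[g].
pose f x := if pselect (A x) is left Ax then \val (g (SigSub (mem_set Ax))) else u0.
exists f; split=> [x Ax|x y Ax Ay].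
  rewrite /f; case: pselect => // Ax'; exact: set_valP.
rewrite /f; case: pselect => // Ax'; case: pselect => // Ay' /val_inj E.
have := @inj _ _ _ g _ _ (in_setT _) (in_setT _) E; by case.
Qed.

Lemma chain_seq (T : eqType) (X0 : set T) (F : set (set T)) (l : seq T) :
  total_on F subset -> (forall x, x \in l -> (X0 `|` \bigcup_(X in F) X) x) ->
  (forall x, x \in l -> X0 x) \/ exists2 X, F X & forall x, x \in l -> (X0 `|` X) x.
Proof.
move=> tF; elim: l => [|a l IH] H; first by left.
have {}IH := IH (fun x xl => H x (mem_behead (s := a :: l) xl)).
have [aX0|[Y FY Ya]] := H a (mem_head _ _).
  case: IH => [lX0|[X FX lX]].
    by left=> x; rewrite inE => /predU1P[->|/lX0].
  by right; exists X => // x; rewrite inE => /predU1P[->|/lX//]; left.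
right; case: IH => [lX0|[X FX lX]].
  by exists Y => // x; rewrite inE => /predU1P[->|/lX0]; [right|left].
have [XY|YX] := tF _ _ FX FY; [exists Y|exists X] => // x; rewrite inE.
  by move=> /predU1P[->|/lX[]]; [right|left|move=> /XY; right].
by move=> /predU1P[->|/lX//]; right; apply: YX.
Qed.

(** Properties of finite character have maximal sets. Zorn's lemma is applied to the sets whose
    union with [X0] satisfies [P], so that the empty chain has a bound too. *)
Lemma tukey (T : eqType) (Q : seq T -> Prop) (X0 : set T)
    (P := fun X : set T => forall l, (forall x, x \in l -> X x) -> Q l) :
  P X0 -> exists X, [/\ X0 `<=` X, P X & forall Y, X `<=` Y -> P Y -> Y = X].
Proof.
move=> PX0; have [|Z [PZ Zmax]] := @Zorn_bigcup T [set X | P (X0 `|` X)].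
  move=> F FP tF l lF; case: (chain_seq tF lF) => [/PX0//|[X FX]].
  exact: (FP X FX).
exists (X0 `|` Z); split; [by move=> x; left|exact: PZ|move=> Y X0ZY PY].
apply/seteqP; split=> // x Yx; right; apply: contrapT => nZx; apply: (Zmax Y).
  split=> [y Zy|/(_ x Yx)//]; by apply: X0ZY; right.
suff -> : [set X | P (X0 `|` X)] Y = P Y by [].
rewrite /=; congr P.
by apply/seteqP; split=> [y [X0y|//]|y Yy]; [apply: X0ZY; left|right].
Qed.

(** A maximal partial injection, taken as a relation, is defined on all of [A] or reaches all of
    [B]. *)
Lemma card_le_total T U (A : set T) (B : set U) : A #<= B \/ B #<= A.
Proof.
pose P (R : set (T * U)) := [/\ forall x y, R (x, y) -> A x /\ B y,
  forall x y y', R (x, y) -> R (x, y') -> y = y' &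
  forall x x' y, R (x, y) -> R (x', y) -> x = x'].
have [|R [[RAB Rfun Rinj] Rmax]] := @Zorn_bigcup _ P.
  move=> F FP tF.
  have two a b : (\bigcup_(X in F) X) a -> (\bigcup_(X in F) X) b ->
      exists X, [/\ F X, X a & X b].
    move=> [X FX Xa] [Y FY Yb]; have [XY|YX] := tF _ _ FX FY.
      by exists Y; split => //; apply: XY.
    by exists X; split => //; apply: YX.
  split=> [x y [X /FP[XAB _ _] /XAB]//|x y y' R1 R2|x x' y R1 R2].
    by have [X [/FP[_ Xf _] /Xf]] := two _ _ R1 R2; apply.
  by have [X [/FP[_ _ Xi] /Xi]] := two _ _ R1 R2; apply.
have [domR|/existsNP[a /not_implyP[Aa /forallNP na]]] :=
  EM (forall x, A x -> exists y, R (x, y)).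
  left; have [[x Ax]|/forallNP A0] := EM (exists x, A x); last first.
    have -> : A = set0 by apply/seteqP; split=> x // /A0.
    exact: card_ge0.
  have /choice[f fP] : forall x, exists y, A x -> R (x, y).
    move=> z; have [/domR[y Ry]|nAz] := EM (A z); first by exists y.
    by have [y _] := domR x Ax; exists y => /nAz.
  apply: (@card_le_inj _ _ _ _ f) => [z /fP/RAB[]//|z t /fP Rz /fP Rt ft].
  by apply: (Rinj _ _ (f z)) => //; rewrite ft.
have [ranR|/existsNP[b /not_implyP[Bb /forallNP nb]]] :=
  EM (forall y, B y -> exists x, R (x, y)).
  right; have /choice[f fP] : forall y, exists x, B y -> R (x, y).
    move=> z; have [/ranR[y Ry]|nAz] := EM (B z); first by exists y.
    by exists a => /nAz.
  apply: (@card_le_inj _ _ _ _ f) => [z /fP/RAB[]//|z t /fP Rz /fP Rt ft].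
  by apply: (Rfun (f z)) => //; rewrite ft.
exfalso; apply: (Rmax (R `|` [set (a, b)])).
  split=> [x Rx|/(_ (a, b))]; first by left.
  by move=> /(_ (or_intror erefl)) /na.
split=> [x y [/RAB//|[-> ->]//]|x y y'|x x' y].
    move=> [R1|E1] [R2|E2]; first exact: Rfun R1 R2.
  - by case: (na y); rewrite -(congr1 fst E2 : x = a).
  - by case: (na y'); rewrite -(congr1 fst E1 : x = a).
  - by rewrite (congr1 snd E1 : y = b) (congr1 snd E2 : y' = b).
move=> [R1|E1] [R2|E2]; first exact: Rinj R1 R2.
- by case: (nb x); rewrite -(congr1 snd E2 : y = b).
- by case: (nb x'); rewrite -(congr1 snd E1 : y = b).
- by rewrite (congr1 fst E1 : x = a) (congr1 fst E2 : x' = a).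
Qed.

Lemma infinite_inj_nat T (A : set T) : infinite_set A ->
  exists g : nat -> T, (forall n, A (g n)) /\ injective g.
Proof.
move=> /[dup] Ainf /infiniteP; have [a Aa] := infinite_setN0 Ainf.
move=> /(card_le_ex a)[g [gA ginj]]; exists g; split=> [n|m n]; first exact: gA.
exact: ginj.
Qed.

(* A maximal pairing function on a subset [S] of [A] has [S] of full cardinality:
   otherwise [S] embeds into its complement by some [h], and the pairing
   extends to the union of [S] and [h S]. *)
Lemma card_sq T (A : set T) : infinite_set A -> A `*` A #<= A.
Proof.
move=> /infinite_inj_nat[g [gA ginj]].
have [code code_inj] : exists code : nat * nat -> nat, injective code.
  by exists pickle; apply: pcan_inj pickleK.
(* [fld R] is the subset that carries the pairing, recovered from the diagonal; [P R] says that [R]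
   is an injective pairing of this subset into itself. *)
pose fld (R : set (T * T * T)) := [set a | exists c, R (a, a, c)].
pose P (R : set (T * T * T)) := [/\ forall a b c, R (a, b, c) ->
    [/\ fld R a, fld R b, fld R c & A a],
  forall a b, fld R a -> fld R b -> exists c, R (a, b, c),
  forall x c c', R (x, c) -> R (x, c') -> c = c' &
  forall x x' c, R (x, c) -> R (x', c) -> x = x'].
(* Starting from a pairing on the range of [g] makes the maximal carrier infinite; [g 0], [g 1] and
   [g 2] will serve as tags. *)
pose R0 := [set x | exists i j, x = (g i, g j, g (code (i, j)))].
have PR0 : P R0.
  have fldR0 n : fld R0 (g n) by exists (g (code (n, n))), n, n.
  split=> [a b c [i [j [-> -> ->]]]|a b [c [i [j [-> _ _]]]] [d [k [l [-> _ _]]]]||] //.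
  - by exists (g (code (i, k))), i, k.
  - move=> x c c' [i [j [-> ->]]] [k [l [/ginj -> /ginj -> ->]]] //.
  move=> x x' c [i [j [-> ->]]] [k [l [-> /ginj/code_inj[-> ->]]]] //.
have [|Z [PZ Zmax]] := @Zorn_bigcup _ [set R | P (R0 `|` R)].
  move=> F FP tF; rewrite /=; set U := _ `|` _.
  have two a b : U a -> U b -> exists X, [/\ P X, X `<=` U, X a & X b].
    move=> Ua Ub; have [|H|[X FX H]] := @chain_seq {classic (T * T * T)} R0 F [:: a; b] tF.
    - by move=> x; rewrite !inE => /orP[]/eqP ->.
    - exists R0; split=> //; [by move=> x; left|apply: H|apply: H]; by rewrite !inE eqxx ?orbT.
    exists (R0 `|` X); split; [exact: FP| |apply: H|apply: H]; rewrite ?inE ?eqxx ?orbT //.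
    by move=> x [|Xx]; [left|right; exists X].
  have fldS X : X `<=` U -> fld X `<=` fld U by move=> XU a [c /XU]; exists c.
  split=> [a b c Uabc|a b [c Ua] [d Ub]|x c c' U1 U2|x x' c U1 U2].
  - have [X [[XP _ _ _] /fldS XU /XP[Xa Xb Xc Aa] _]] := two _ _ Uabc Uabc.
    by split=> //; apply: XU.
  - have [X [[_ XP _ _] XU Xa Xb]] := two _ _ Ua Ub.
    have [||c' Xc] := XP a b; [by exists c|by exists d|].
    by exists c'; apply: XU.
  - by have [X [[_ _ XP _] _ /XP]] := two _ _ U1 U2; apply.
  - by have [X [[_ _ _ XP] _ /XP]] := two _ _ U1 U2; apply.
move: PZ Zmax; rewrite /=; set R := R0 `|` Z => PR Zmax.
have Rmax R' : R `<=` R' -> P R' -> R' = R.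
  move=> RR' PR'; apply/seteqP; split=> // x R'x; right; apply: contrapT => nZx.
  apply: (Zmax R'); first by split=> [y Zy|/(_ x R'x)//]; apply: RR'; right.
  by rewrite /= (_ : _ `|` R' = R') //; apply/seteqP; split=> [y [R0y|//]|y ?];
    [apply: RR'; left|right].
have [RA Rtot Rfun Rinj] := PR; pose S := fld R.
have Sg n : S (g n) by exists (g (code (n, n))); left; exists n, n.
have SA : S `<=` A by move=> a [c /RA[]].
have /choice[f fP] : forall x : T * T, exists c, S x.1 -> S x.2 -> R (x, c).
  move=> [a b] /=; have [[Sa Sb]|nS] := EM (S a /\ S b).
    by have [c Rc] := Rtot _ _ Sa Sb; exists c.
  by exists a => Sa Sb; case: nS.
have fS a b : S a -> S b -> S (f (a, b)).
  by move=> Sa Sb; have /(_ Sa Sb)/RA[] := fP (a, b).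
have finj a b a' b' : S a -> S b -> S a' -> S b' ->
    f (a, b) = f (a', b') -> a = a' /\ b = b'.
  move=> Sa Sb Sa' Sb' E; have /(_ Sa Sb) R1 := fP (a, b).
  have /(_ Sa' Sb') := fP (a', b'); rewrite -E => R2.
  by have [] := Rinj _ _ _ R1 R2.
have g01 : g 0%N <> g 1%N by move=> /ginj.
have Sg0 := Sg 0%N; have Sg1 := Sg 1%N.
have [leAS|leSA] := card_le_total (A `\` S) S.
  (* If the complement of [S] embeds into [S], two tagged copies put all of [A] into [S], where
     pairs are already coded. *)
  have [h [hS hinj]] := card_le_ex (g 0%N) leAS.
  have /choice[k kP] : forall a, exists c, A a ->
     (S a /\ c = f (g 0%N, a)) \/ (~ S a /\ c = f (g 1%N, h a)).
    move=> a; have [Sa|nSa] := EM (S a); first by exists (f (g 0%N, a)); left.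
    by exists (f (g 1%N, h a)); right.
  have kS a : A a -> S (k a).
    by move=> /[dup] Aa /kP[[Sa ->]|[nSa ->]]; apply: fS => //; apply: hS.
  have kinj a b : A a -> A b -> k a = k b -> a = b.
    move=> Aa Ab; have [[Sa ->]|[nSa ->]] := kP _ Aa; have [[Sb ->]|[nSb ->]] := kP _ Ab.
    - by move=> /finj[].
    - by move=> /finj[] //; apply: hS.
    - by move=> /finj[] //; [apply: hS|move=> /esym/g01].
    - by move=> /finj[] //; [apply: hS|apply: hS|move=> _; apply: hinj].
  apply: (@card_le_inj _ _ _ _ (fun x => f (k x.1, k x.2))).
    by move=> [a b] [/= Aa Ab]; apply/SA/fS; apply: kS.
  move=> [a b] [c d] [/= Aa Ab] [/= Ac Ad] /finj[]; try exact: kS.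
  by move=> /kinj -> // /kinj ->.
have [h [hA hinj]] := card_le_ex (g 0%N) leSA.
pose S' := h @` S.
have SS' a : S a -> S' a -> False by move=> Sa [b /hA[_ nSb] ba]; apply: nSb; rewrite ba.
have /choice[pi piP] : forall a, exists c, S a /\ c = a \/ S' a /\ S c /\ h c = a \/ ~ S a /\ ~ S' a.
  move=> a; have [Sa|nSa] := EM (S a); first by exists a; left.
  have [[b Sb ba]|nS'a] := EM (S' a); first by exists b; right; left; split=> //; exists b.
  by exists a; right; right.
have piS a : S a -> pi a = a.
  by move=> Sa; case: (piP a) => [[]//|[[/(SS' _ Sa)]//|[]//]].
have piS' a : S' a -> S (pi a) /\ h (pi a) = a.
  by move=> S'a; case: (piP a) => [[/SS'/(_ S'a)]//|[[]//|[_ []//]]].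
pose U := S `|` S'.
have piU a : U a -> S (pi a) by case=> [/[dup] Sa /piS -> //|/piS'[]].
(* Pairs with a component in [S'] are of three kinds, according to which components lie there. They
   are pulled back to [S] by [pi], coded together with the tag of their kind, and the code is moved
   into [S'] by [h]. *)
have /choice[tag tagP] : forall x : T * T, exists n : nat,
    [/\ S x.1, S' x.2 & n = 0%N] \/ [/\ S' x.1, S x.2 & n = 1%N]
    \/ [/\ S' x.1, S' x.2 & n = 2%N] \/ (S x.1 /\ S x.2) \/ ~ (U x.1 /\ U x.2).
  move=> [a b] /=; have [[]|?] := EM (U a /\ U b); last by exists 0%N; do 3!right; right.
  by move=> [?|?] [?|?]; [exists 0%N; right; right; right; left|exists 0%N; left|
    exists 1%N; right; left|exists 2%N; right; right; left].
pose R' := R `|` [set x | [/\ U x.1.1, U x.1.2, ~ (S x.1.1 /\ S x.1.2) &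
  x.2 = h (f (g (tag x.1), f (pi x.1.1, pi x.1.2)))]].
have pairS a b : U a -> U b -> S (f (g (tag (a, b)), f (pi a, pi b))).
  by move=> Ua Ub; apply: (fS) => //; apply: (fS); apply: piU.
have UR' a : U a -> fld R' a.
  move=> Ua; have [[c Rc]|nSa] := EM (S a); first by exists c; left.
  by eexists; right; split=> //=; case.
have R'U a : fld R' a -> U a by move=> [c [/RA[Sa _ _ _]|[]//]]; left.
suff /(Rmax R') R'R : P R'.
  have : S (h (g 0%N)).
    rewrite /S -R'R; first by apply: UR'; right; exists (g 0%N).
    by move=> x; left.
  by have [_] := hA _ (Sg 0%N).
split.
- move=> a b c [/RA[Sa Sb Sc Aa]|[/= Ua Ub _ ->]].
    by split=> //; apply: UR'; left.
  split; [exact: UR'|exact: UR'|apply: UR'; right|].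
    by eexists; [exact: pairS Ua Ub|].
  by case: Ua => [/SA//|[d /hA[Ad _] <-]].
- move=> a b /R'U Ua /R'U Ub; have [[Sa Sb]|nS] := EM (S a /\ S b).
    by have [c Rc] := Rtot _ _ Sa Sb; exists c; left.
  by exists (h (f (g (tag (a, b)), f (pi a, pi b)))); right; split.
- move=> [a b] c c' [R1|[/= Ua Ub nS ->]] [R2|[/= _ _ nS' ->]] //.
  + exact: Rfun R1 R2.
  + by case: nS'; have [] := RA _ _ _ R1.
  + by case: nS; have [] := RA _ _ _ R2.
move=> [a b] [a' b'] c [R1|[/= Ua Ub nS ->]] [R2|[/= Ua' Ub' nS' E]].
+ exact: Rinj R1 R2.
+ have [_ _ Sc _] := RA _ _ _ R1; exfalso; apply: (SS' c) => //; rewrite E.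
  by eexists; [exact: pairS Ua' Ub'|].
+ have [_ _ Sc _] := RA _ _ _ R2; exfalso; apply: (SS' _ Sc).
  by eexists; [exact: pairS Ua Ub|].
move: E => /hinj E; have {E} := E (pairS _ _ Ua Ub) (pairS _ _ Ua' Ub').
have fS1 x y : U x -> U y -> S (f (pi x, pi y)) by move=> Ux Uy; apply: fS; apply: piU.
move=> /finj[] //; [exact: fS1|exact: fS1|move=> /ginj tt /finj[]; try exact: piU].
have S'inj x y : S' x -> S' y -> pi x = pi y -> x = y.
  by move=> /piS'[_ hx] /piS'[_ hy] E; rewrite -hx -hy E.
move=> paa pbb; have tagQ x y : U x -> U y -> ~ (S x /\ S y) ->
    [\/ [/\ S x, S' y & tag (x, y) = 0%N], [/\ S' x, S y & tag (x, y) = 1%N]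
      | [/\ S' x, S' y & tag (x, y) = 2%N]].
  move=> Ux Uy nSxy; have [?|[?|[?|[]]]] := tagP (x, y) => //.
  - exact: Or31.
  - exact: Or32.
  - exact: Or33.
  - by case.
have := tagQ _ _ Ua' Ub' nS'; have := tagQ _ _ Ua Ub nS; rewrite -tt.
case=> [[? ? t]|[? ? t]|[? ? t]] [[? ? t']|[? ? t']|[? ? t']];
  move: t'; rewrite t => // _.
- by move: paa; rewrite !piS // => ->; rewrite (S'inj b b').
- by move: pbb; rewrite !piS // => ->; rewrite (S'inj a a').
- by rewrite (S'inj a a') // (S'inj b b').
Qed.

Lemma card_nat_mul T (A : set T) : infinite_set A -> A `*` [set: nat] #= A.
Proof.
move=> Ainf; have [g [gA ginj]] := infinite_inj_nat Ainf.
apply/card_eqPle; split.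
  apply: (card_le_trans _ (card_sq Ainf)).
  apply: (@card_le_inj _ _ _ _ (fun x => (x.1, g x.2))).
    by move=> [a n] [/= Aa _]; split => //; apply: gA.
  by move=> [a n] [b m] _ _ [-> /ginj ->].
apply: (@card_le_inj _ _ _ _ (fun x => (x, 0%N))) => // x y _ _ [].
by [].
Qed.

(** Iterated pairing is injective only among lists of the same length, so the length is kept as a
    second component and then absorbed by [card_nat_mul]. *)
Lemma card_seq_le T (A : set T) : infinite_set A ->
  [set s : seq {classic T} | forall x, x \in s -> A x] #<= A.
Proof.
move=> Ainf; have [a Aa] := infinite_setN0 Ainf.
have [f [fA finj]] := card_le_ex a (card_sq Ainf).
have /card_eqPle[le _] := card_nat_mul Ainf; apply: card_le_trans le.
pose code := foldr (fun x c => f (x, c)) a.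
have codeA (s : seq {classic T}) : (forall x, x \in s -> A x) -> A (code s).
  elim: s => //= x s IH sA; apply: fA; split; first by apply: sA; rewrite mem_head.
  by apply: IH => y ys; apply: sA; rewrite inE ys orbT.
apply: (@card_le_inj _ _ _ _ (fun s => (code s, size s))).
  by move=> s sA; split => //; apply: codeA.
elim=> [|x s IH] [|y t] //= sA tA [E st].
have sA' z : z \in (s : seq {classic T}) -> A z by move=> zs; apply: sA; rewrite inE zs orbT.
have tA' z : z \in (t : seq {classic T}) -> A z by move=> zt; apply: tA; rewrite inE zt orbT.
have xs : (A `*` A) (x, code s).
  by split=> /=; [apply: sA; rewrite mem_head|apply: codeA].
have yt : (A `*` A) (y, code t).
  by split=> /=; [apply: tA; rewrite mem_head|apply: codeA].
have [-> E'] := finj _ _ xs yt E; congr (_ :: _); apply: IH => //.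
by rewrite E' st.
Qed.

Lemma card_uniq_seq (T : eqType) (s : seq T) : uniq s -> [set` s] #= `I_(size s).
Proof.
case: s => [|x0 s] us; last (move: (x0 :: s) us => l us).
  rewrite (_ : [set` _] = set0) ?II0 ?card_eq00 //.
  by apply/seteqP; split.
apply/card_eqPle; split.
  apply: (@card_le_inj _ _ _ _ (index^~ l)) => [x|x y xl yl /=].
    by rewrite /= index_mem.
  by move=> /(congr1 (nth x0 l)); rewrite !nth_index.
apply: (@card_le_inj _ _ _ _ (nth x0 l)) => [i /= il|i j /= il jl /eqP].
  exact: mem_nth.
by rewrite nth_uniq // => /eqP.
Qed.

(** * Subfields and reduced monomials *)

Record is_subring (R : comNzRingType) (S : set R) : Prop := IsSubring {
  sr_1 : S 1;
  sr_B : forall x y, S x -> S y -> S (x - y);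
  sr_M : forall x y, S x -> S y -> S (x * y)
}.

Section Subring.
Variables (R : comNzRingType) (S : set R) (hS : is_subring S).

Lemma sr_0 : S 0.
Proof. by rewrite -(subrr 1); apply: (sr_B hS); apply: (sr_1 hS). Qed.

Lemma sr_N x : S x -> S (- x).
Proof. by rewrite -sub0r; apply: (sr_B hS); apply: sr_0. Qed.

Lemma sr_D x y : S x -> S y -> S (x + y).
Proof. by move=> Sx /sr_N Sy; rewrite -(opprK y); apply: (sr_B hS). Qed.

Lemma sr_X x n : S x -> S (x ^+ n).
Proof.
move=> Sx; elim: n => [|n IH]; first exact: (sr_1 hS).
by rewrite exprS; apply: (sr_M hS).
Qed.

Lemma sr_sum I (s : seq I) (P : pred I) (F : I -> R) :
  (forall i, P i -> S (F i)) -> S (\sum_(i <- s | P i) F i).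
Proof.
by move=> SF; elim/big_ind: _ => //; [exact: sr_0|exact: sr_D].
Qed.

Lemma sr_prod I (s : seq I) (F : I -> R) :
  (forall i, S (F i)) -> S (\prod_(i <- s) F i).
Proof. by move=> SF; elim/big_ind: _ => //; [exact: (sr_1 hS)|exact: (sr_M hS)]. Qed.

End Subring.

Record is_subfield (R : fieldType) (S : set R) : Prop := IsSubfield {
  sf_ring :> is_subring S;
  sf_V : forall x, S x -> S x^-1
}.

Lemma range_is_subfield (K R : fieldType) (f : {rmorphism K -> R}) :
  is_subfield (range f).
Proof.
split; first split; first by exists 1; rewrite ?rmorph1.
- by move=> _ _ [x _ <-] [y _ <-]; exists (x - y); rewrite ?rmorphB.
- by move=> _ _ [x _ <-] [y _ <-]; exists (x * y); rewrite ?rmorphM.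
- by move=> _ [x _ <-]; exists x^-1; rewrite ?fmorphV.
Qed.

Section SubFieldType.
Variables (R : fieldType) (S : set R) (hS : is_subfield S).

(** The proof is an argument so that the closure property can be attached to the predicate as an
    instance. *)
Definition sf_pred of is_subfield S : {pred R} := fun x => `[< S x >].

Lemma sf_predE x : (x \in sf_pred hS) = `[< S x >].
Proof. by []. Qed.

Lemma sf_divring : divring_closed (sf_pred hS).
Proof.
split=> [|x y|x y]; rewrite !sf_predE.
- exact/asboolP/(sr_1 hS).
- by move=> /asboolP Sx /asboolP Sy; apply/asboolP/(sr_B hS).
- by move=> /asboolP Sx /asboolP /(sf_V hS) Sy; apply/asboolP/(sr_M hS).
Qed.

HB.instance Definition _ := GRing.isDivringClosed.Build R (sf_pred hS) sf_divring.

Record sftype := Sftype { sf_val :> R; _ : sf_val \in sf_pred hS }.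

HB.instance Definition _ := [isSub for sf_val].
HB.instance Definition _ := [Choice of sftype by <:].
HB.instance Definition _ := [SubChoice_isSubIntegralDomain of sftype by <:].
HB.instance Definition _ := [SubIntegralDomain_isSubField of sftype by <:].

Lemma sf_valP (x : sftype) : S (sf_val x).
Proof. by case: x => x /= /asboolP. Qed.

Lemma sf_ex x : S x -> exists y : sftype, sf_val y = x.
Proof. by move=> /asboolP Sx; exists (@Sftype x Sx). Qed.

Definition sf_morph : {rmorphism sftype -> R} := \val.

End SubFieldType.

Section PthPowers.
Variables (R : fieldType) (p : nat) (pR : p \in [pchar R]).

Let p_prime : prime p := pcharf_prime pR.
Let p_gt0 : (0 < p)%N := prime_gt0 p_prime.

Lemma exprp_inj : injective (fun x : R => x ^+ p).
Proof. by move=> x y; rewrite -!(pFrobenius_autE pR) => /fmorph_inj. Qed.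

Lemma pclosed_subfield (S : set R) :
  is_subring S -> (forall y, S (y ^+ p)) -> is_subfield S.
Proof.
move=> hS hp; split=> // x Sx; have [->|x0] := eqVneq x 0; first by rewrite invr0; exact: sr_0.
have -> : x^-1 = x ^+ p.-1 * (x^-1) ^+ p.
  rewrite -{2}(prednK p_gt0) exprSr mulrA -exprMn divff // expr1n mul1r //.
by apply: (sr_M hS) => //; apply: sr_X.
Qed.

(* The minimal polynomial of [a] over [S] divides ['X^p - a^p = ('X - a)^p]; if
   its degree [k] is less than [p], its coefficient [- k a] puts [a] in [S]. *)
Lemma pth_root_free (S : set R) (a : R) (s : nat -> R) :
  is_subfield S -> S (a ^+ p) -> ~ S a -> (forall e, S (s e)) ->
  \sum_(0 <= e < p) s e * a ^+ e = 0 -> forall e, (e < p)%N -> s e = 0.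
Proof.
move=> hS Sap nSa Ss sum0.
have /choice[t tE] e : exists y : sftype hS, sf_val y = s e by apply: sf_ex.
have [b bE] := sf_ex hS Sap.
pose f : {poly sftype hS} := \poly_(e < p) t e.
have [v vE] : exists v : {rmorphism sftype hS -> R}, forall x, v x = sf_val x.
  by exists (sf_morph hS).
have froot : root (map_poly v f) a.
  rewrite /root.
  rewrite /f map_polyE; apply/eqP; rewrite -[RHS]sum0.
  rewrite -map_polyE (@horner_coef_wide _ p); last first.
    by rewrite size_map_poly size_poly.
  rewrite big_mkord; apply: eq_bigr => e _.
  by rewrite coef_map coef_poly ltn_ord /= vE -tE.
have [f0|f0] := eqVneq f 0.
  move=> e ep; have : f`_e = 0 by rewrite f0 coef0.
  by rewrite coef_poly ep => te; by rewrite -tE te -vE rmorph0.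
exfalso; pose g : {poly sftype hS} := 'X^p - b%:P.
have pP : p \in [pchar {poly R}] by rewrite pchar_poly.
have gE : map_poly v g = ('X - a%:P) ^+ p.
  rewrite rmorphB /= map_polyXn map_polyC /= vE bE.
  by rewrite -[RHS](pFrobenius_autE pP) rmorphB /= !pFrobenius_autE polyC_exp.
pose h := gcdp f g; have : map_poly v h %| ('X - a%:P) ^+ p.
  by rewrite -gE dvdp_map dvdp_gcdr.
have hroot : root (map_poly v h) a.
  rewrite gcdp_map root_gcd froot gE /=.
  by rewrite /root horner_exp hornerXsubC subrr expr0n eqn0Ngt p_gt0.
move=> /dvdp_exp_XsubCP[k kp hk].
have h0 : h != 0 by rewrite gcdp_eq0 negb_and f0.
have sk : size h = k.+1.
  by rewrite -(size_map_poly v) (eqp_size hk) size_exp_XsubC.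
have k0 : (0 < k)%N.
  rewrite lt0n; apply: contraTneq hroot => k0; move: hk; rewrite k0 expr0 => /eqp_root ->.
  by rewrite root1.
have kltp : (k < p)%N.
  rewrite -sk; apply: leq_trans (size_poly p t); apply: dvdp_leq => //.
  exact: dvdp_gcdl.
pose h' := (lead_coef h)^-1 *: h.
have h'E : map_poly v h' = ('X - a%:P) ^+ k.
  apply/eqP; rewrite -eqp_monic ?monic_exp ?monicXsubC //.
    by rewrite linearZ /= (eqp_trans _ hk) // eqp_scale // fmorphV invr_eq0 fmorph_eq0 lead_coef_eq0.
  by rewrite map_monic monicE lead_coefZ mulVf ?lead_coef_eq0.
have kaS : S (a *+ k).
  have : (map_poly v h')`_k.-1 = - (a *+ k).
    rewrite h'E; move: k0; clear; case: k => // k _ /=; elim: k => [|k IH]; first by rewrite expr1 coefB coefX coefC /= sub0r mulr1n.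
    rewrite exprS mulrBl coefB coefXM coefCM /= IH.
    have -> : (('X - a%:P) ^+ k.+1)`_k.+1 = 1.
      have := monic_exp k.+1 (monicXsubC a).
      by rewrite monicE lead_coefE size_exp_XsubC => /eqP.
    by rewrite mulr1 [in RHS]mulrSr opprD.
  rewrite coef_map /= vE => /(congr1 -%R); rewrite opprK => <-.
  by apply: (sr_N hS); apply: sf_valP.
apply: nSa; have kR0 : (k%:R : R) != 0.
  apply/negP; rewrite -(dvdn_pcharf pR) => /dvdn_leq -/(_ k0).
  by rewrite leqNgt kltp.
rewrite -(mulfK kR0 a) mulr_natr; apply: (sr_M hS) => //.
apply: (sf_V hS).
by elim: (k) => [|j IH]; [exact: (sr_0 hS)|rewrite mulrS; apply: (sr_D hS) => //; exact: (sr_1 hS)].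
Qed.

End PthPowers.

Section Exponents.
Variable p : nat.

Fixpoint exps n : seq (seq nat) :=
  if n is m.+1 then [seq e :: t | e <- iota 0 p, t <- exps m] else [:: [::]].

Lemma expsP n t : reflect (size t = n /\ all (ltn^~ p) t) (t \in exps n).
Proof.
elim: n t => [|n IH] [|e t] /=; rewrite ?inE.
- by apply: ReflectT.
- by apply: ReflectF => -[].
- by apply: (iffP idP) => [/allpairsP[x []]|[]].
apply: (iffP allpairsP) => [[[e' t'] /= [+ /IH[<- tp] [-> ->]]]|[[st] /andP[ep tp]]].
  by rewrite mem_iota add0n tp andbT.
exists (e, t); rewrite /= mem_iota add0n; by split=> //; apply/(IH t).
Qed.

Lemma exps_uniq n : uniq (exps n).
Proof.
elim: n => //= n IH; apply: allpairs_uniq => //; first exact: iota_uniq.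
by move=> [e t] [e' t'] _ _ [-> ->].
Qed.

Lemma size_exps n : size (exps n) = (p ^ n)%N.
Proof. by elim: n => //= n IH; rewrite size_allpairs size_iota IH expnS. Qed.

End Exponents.

Section Monomials.
Variables (p : nat) (I : eqType) (R : comNzRingType).
Implicit Types (r : I -> R) (l : seq I) (t : seq nat) (c : seq nat -> R).

Fixpoint mon r l t : R :=
  if l is b :: l' then if t is e :: t' then r b ^+ e * mon r l' t' else 1 else 1.

Definition lcomb c r l := \sum_(t <- exps p (size l)) c t * mon r l t.

Lemma mon_prod r l (f : I -> nat) : mon r l (map f l) = \prod_(b <- l) r b ^+ f b.
Proof. by elim: l => [|b l IH] /=; rewrite ?big_nil // big_cons IH. Qed.

(** Exponents attached to the variables rather than to positions survive a permutation or an
    enlargement of the list. *)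
Lemma exps_fun l t : uniq l -> t \in exps p (size l) ->
  exists2 f : I -> nat, t = map f l & forall b, b \in l -> (f b < p)%N.
Proof.
move=> ul /expsP[st /allP tp]; exists (fun b => nth 0%N t (index b l)).
  apply: (@eq_from_nth _ 0%N); rewrite ?size_map // => i it.
  case: l => [|b l] in ul st *; first by rewrite st in it.
  rewrite (nth_map b) -?st // index_uniq // -st //.
by move=> b bl; apply: tp; rewrite mem_nth // st index_mem.
Qed.

Lemma map_exps l (f : I -> nat) : (forall b, b \in l -> (f b < p)%N) ->
  map f l \in exps p (size l).
Proof.
by move=> fp; apply/expsP; rewrite size_map; split=> //; apply/allP => _ /mapP[b /fp ? ->].
Qed.

Lemma lcomb_cons c r b l : lcomb c r (b :: l) =
  \sum_(0 <= e < p) lcomb (fun t => c (e :: t)) r l * r b ^+ e.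
Proof.
rewrite /lcomb /= big_allpairs_dep /index_iota subn0; apply: eq_bigr => e _.
by rewrite big_distrl; apply: eq_bigr => t _ /=; rewrite -mulrA [mon _ _ _ * _]mulrC.
Qed.

Lemma lcombD c c' r l : lcomb c r l + lcomb c' r l = lcomb (fun t => c t + c' t) r l.
Proof. by rewrite -big_split; apply: eq_bigr => t _; rewrite mulrDl. Qed.

Lemma lcombZ a c r l : a * lcomb c r l = lcomb (fun t => a * c t) r l.
Proof. by rewrite big_distrr; apply: eq_bigr => t _; rewrite /= mulrA. Qed.

Lemma lcomb_eq c c' r l :
  {in exps p (size l), c =1 c'} -> lcomb c r l = lcomb c' r l.
Proof. by move=> cc'; apply: eq_big_seq => t /cc' ->. Qed.

Lemma lcomb_delta r l t : t \in exps p (size l) ->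
  mon r l t = lcomb (fun u => (u == t)%:R) r l.
Proof.
move=> te; rewrite /lcomb (bigD1_seq t) ?exps_uniq //= eqxx mul1r big1 ?addr0 //.
by move=> u /negbTE ->; rewrite mul0r.
Qed.

Lemma mon_ext r l l' t : (0 < p)%N -> uniq l -> uniq l' -> {subset l <= l'} ->
  t \in exps p (size l) -> exists2 t', t' \in exps p (size l') & mon r l t = mon r l' t'.
Proof.
move=> p0 ul ul' ll' tl; have [f -> fp] := exps_fun ul tl.
pose f' b := if b \in l then f b else 0%N; exists (map f' l').
  by apply: map_exps => b _; rewrite /f'; case: ifP => [/fp|].
rewrite !mon_prod [RHS](bigID (mem l)) /= [X in _ = _ * X]big1 ?mulr1; last first.
  by move=> b /negbTE bl; rewrite /f' bl expr0.
rewrite -[RHS]big_filter (perm_big [seq b <- l' | b \in l]) /=; last first.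
  rewrite uniq_perm ?filter_uniq // => b; rewrite mem_filter.
  by case bl: (b \in l); rewrite //= ll'.
by rewrite !big_filter; apply: eq_bigr => b bl; rewrite /f' bl.
Qed.

Lemma lcomb_perm c r l l' : uniq l -> perm_eq l l' -> exists2 h : seq nat -> seq nat,
  forall t, t \in exps p (size l) -> exists2 t', t' \in exps p (size l') & h t' = t &
  lcomb c r l = lcomb (c \o h) r l'.
Proof.
move=> ul ll'; have ul' : uniq l' by rewrite -(perm_uniq ll').
pose h t := [seq nth 0%N t (index b l') | b <- l].
have hE f : h (map f l') = map f l.
  apply/eq_in_map => b; rewrite (perm_mem ll') => bl'.
  by rewrite (nth_map b) ?index_mem // nth_index.
have hP t : t \in exps p (size l) -> exists2 t', t' \in exps p (size l') & h t' = t.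
  move=> /(exps_fun ul)[f -> fp]; exists (map f l') => //.
  by apply: map_exps => b; rewrite -(perm_mem ll'); apply: fp.
exists h => //; rewrite {2}/lcomb.
rewrite /lcomb (perm_big (map h (exps p (size l')))) /=; last first.
  apply: uniq_perm; first exact: exps_uniq.
    rewrite map_inj_in_uniq ?exps_uniq // => t u.
    move=> /(exps_fun ul')[f -> _] /(exps_fun ul')[g -> _]; rewrite !hE.
    by move=> /eq_in_map fg; apply/eq_in_map => b; rewrite -(perm_mem ll') => /fg.
  move=> t; apply/idP/mapP => [/hP[t' ? <-]|[t' t'l' ->]]; first by exists t'.
  have [f -> fp] := exps_fun ul' t'l'; rewrite hE; apply: map_exps => b.
  by rewrite (perm_mem ll') => /fp.
rewrite big_map big_seq [RHS]big_seq; apply: eq_bigr => t /(exps_fun ul')[f -> _].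
by rewrite /= hE !mon_prod (perm_big _ ll').
Qed.

Lemma lcomb_cat c r l1 l2 : lcomb c r (l1 ++ l2) =
  \sum_(t <- exps p (size l1)) lcomb (fun u => c (t ++ u)) r l2 * mon r l1 t.
Proof.
elim: l1 c => [|b l1 IH] c; first by rewrite big_seq1 mulr1.
rewrite cat_cons lcomb_cons /= big_allpairs_dep /index_iota subn0.
apply: eq_bigr => e _; rewrite IH big_distrl; apply: eq_bigr => t _ /=.
by rewrite -mulrA [mon _ _ _ * _]mulrC.
Qed.

End Monomials.

Lemma rmorph_mon (I : eqType) (R R' : comNzRingType) (f : {rmorphism R -> R'})
    (r : I -> R) l t : f (mon r l t) = mon (f \o r) l t.
Proof.
elim: l t => [|b l IH] [|e t] /=; rewrite ?rmorph1 //.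
by rewrite rmorphM rmorphXn IH.
Qed.

Lemma rmorph_lcomb (p : nat) (I : eqType) (R R' : comNzRingType)
    (f : {rmorphism R -> R'}) (r : I -> R) (c : seq nat -> R) l :
  f (lcomb p c r l) = lcomb p (f \o c) (f \o r) l.
Proof.
by rewrite rmorph_sum; apply: eq_bigr => t _; rewrite rmorphM rmorph_mon.
Qed.

Lemma mon_comp (I J : eqType) (R : comNzRingType) (r : I -> R) (h : J -> I) l t :
  mon (r \o h) l t = mon r (map h l) t.
Proof. by elim: l t => [|b l IH] [|e t] //=; rewrite IH. Qed.

Lemma lcomb_comp p (I J : eqType) (R : comNzRingType) c (r : I -> R) (h : J -> I) l :
  lcomb p c (r \o h) l = lcomb p c r (map h l).
Proof. by rewrite /lcomb size_map; apply: eq_bigr => t _; rewrite mon_comp. Qed.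

(** * Spans of reduced monomials over a subring *)

Section RedSpan.
Variables (p : nat) (I : eqType) (R : comNzRingType) (S : set R) (r : I -> R).
Hypotheses (p_gt1 : (1 < p)%N) (hS : is_subring S).
Implicit Types (l : seq I) (c : seq nat -> R) (X : set I).

Definition redspan X : set R := [set y | exists l c,
  [/\ uniq l, forall b, b \in l -> X b, forall t, S (c t) & y = lcomb p c r l]].

Lemma lcomb_ext l l' c : uniq l -> uniq l' -> {subset l <= l'} ->
  (forall t, S (c t)) -> exists2 c', forall t, S (c' t) & lcomb p c r l = lcomb p c' r l'.
Proof.
move=> ul ul' ll' Sc.
pose P y := exists2 c', forall t, S (c' t) & y = lcomb p c' r l'.
rewrite -/(P _) [lcomb _ _ _ _]big_seq; apply: (big_ind P) => [|_ _ [c1 Sc1 ->] [c2 Sc2 ->]|t tl].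
- exists (fun=> 0) => [_|]; first exact: (sr_0 hS).
  by rewrite /lcomb big1 // => t _; rewrite mul0r.
- exists (fun t => c1 t + c2 t); first by move=> t; apply: (sr_D hS).
  by rewrite lcombD.
have [t' t'l' ->] := mon_ext r (ltnW p_gt1) ul ul' ll' tl.
exists (fun u => c t * (u == t')%:R).
  move=> u; apply: (sr_M hS) => //; case: eqP => _; [exact: (sr_1 hS)|exact: (sr_0 hS)].
by rewrite -lcombZ -lcomb_delta.
Qed.

Lemma redspan_seq l y : uniq l -> redspan [set` l] y ->
  exists2 c, forall t, S (c t) & y = lcomb p c r l.
Proof. by move=> ul [l' [c [ul' l'l Sc ->]]]; apply: lcomb_ext. Qed.

Lemma redspan_list X y : redspan X y ->
  exists l, [/\ uniq l, forall b, b \in l -> X b & redspan [set` l] y].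
Proof. by move=> [l [c [ul lX Sc ->]]]; exists l; split=> //; exists l, c. Qed.

Lemma redspan_sub X Y : X `<=` Y -> redspan X `<=` redspan Y.
Proof. by move=> XY _ [l [c [ul lX Sc ->]]]; exists l, c; split=> // b /lX/XY. Qed.

Lemma redspan_common (s : seq (seq nat)) (c : seq nat -> R) Y :
  (forall t, redspan Y (c t)) -> exists l, [/\ uniq l, forall b, b \in l -> Y b &
    forall t, t \in s -> redspan [set` l] (c t)].
Proof.
move=> Yc; elim: s => [|t s [l [ul lY ls]]]; first by exists [::].
have [l' [ul' l'Y cl']] := redspan_list (Yc t).
exists (undup (l ++ l')); split; first exact: undup_uniq.
  by move=> b; rewrite mem_undup mem_cat => /orP[/lY|/l'Y].
move=> u; rewrite inE => /predU1P[->|/ls].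
  by apply: redspan_sub cl' => b /= bl; rewrite mem_undup mem_cat bl orbT.
by apply: redspan_sub => b /= bl; rewrite mem_undup mem_cat bl.
Qed.

Lemma redspanD X x y : redspan X x -> redspan X y -> redspan X (x + y).
Proof.
move=> [l1 [c1 [u1 X1 S1 ->]]] [l2 [c2 [u2 X2 S2 ->]]].
pose l := undup (l1 ++ l2); have ul : uniq l by apply: undup_uniq.
have [|c1' S1' ->] := lcomb_ext u1 ul _ S1.
  by move=> b; rewrite mem_undup mem_cat => ->.
have [|c2' S2' ->] := lcomb_ext u2 ul _ S2.
  by move=> b; rewrite mem_undup mem_cat => ->; rewrite orbT.
rewrite lcombD; exists l, (fun t => c1' t + c2' t); split=> // [b|t].
  by rewrite mem_undup mem_cat => /orP[/X1|/X2].
exact: (sr_D hS).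
Qed.

Lemma redspanZ X a y : S a -> redspan X y -> redspan X (a * y).
Proof.
move=> Sa [l [c [ul lX Sc ->]]]; rewrite lcombZ; exists l, (fun t => a * c t).
by split=> // t; apply: (sr_M hS).
Qed.

Lemma redspanC X a : S a -> redspan X a.
Proof.
by move=> Sa; exists [::], (fun=> a); split=> //; rewrite /lcomb big_seq1 mulr1.
Qed.

Lemma redspan_sum X J (s : seq J) (P : pred J) (F : J -> R) :
  (forall i, P i -> redspan X (F i)) -> redspan X (\sum_(i <- s | P i) F i).
Proof.
move=> XF; apply: big_ind => //; last exact: redspanD.
by apply: redspanC; exact: (sr_0 hS).
Qed.

Lemma mon_seq l t : exists2 s, {subset s <= l} & mon r l t = \prod_(b <- s) r b.
Proof.
elim: l t => [|b l IH] [|e t] /=; try by exists [::]; rewrite ?big_nil.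
have [s sl ->] := IH t; exists (nseq e b ++ s).
  by move=> a; rewrite mem_cat inE => /orP[/nseqP[-> _]|/sl ->]; rewrite ?eqxx ?orbT.
by rewrite big_cat /= big_nseq iter_mulr_1.
Qed.

Section Ring.
Variable X : set I.
(* Reducing a [p]-th power lowers the degree, so this suffices to reduce all
   monomials. *)
Hypothesis rp : forall b, X b ->
  exists a (s : seq (R * I)), [/\ S a, forall x, x \in s -> S x.1 /\ X x.2 &
    r b ^+ p = a + \sum_(x <- s) x.1 * r x.2].

Lemma redspan_prod (s : seq I) : (forall b, b \in s -> X b) ->
  redspan X (\prod_(b <- s) r b).
Proof.
have [n] := ubnP (size s); elim: n s => // n IH s sn sX.
have [sp|/allPn[b bs]] := boolP (all (fun b => count_mem b s < p)%N s).
  pose f b := count_mem b s; pose l := undup s.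
  have te : map f l \in exps p (size l).
    by apply: map_exps => b; rewrite mem_undup => /(allP sp).
  exists l, (fun u => (u == map f l)%:R); split; rewrite ?undup_uniq //.
  - by move=> b; rewrite mem_undup => /sX.
  - by move=> u; case: eqP => _; [exact: (sr_1 hS)|exact: (sr_0 hS)].
  rewrite -lcomb_delta // mon_prod -big_undup_iterop_count.
  by apply: eq_bigr => b _.
rewrite -leqNgt => pb.
pose s' := [seq a <- s | a != b] ++ nseq (count_mem b s - p) b.
have perm_s : perm_eq s (nseq p b ++ s').
  apply/allP => a _; rewrite /= !count_cat !count_nseq count_filter /=.
  have [->|ab] := eqVneq a b; rewrite ?eqxx ?mul1n /=.
    rewrite [X in (_ + (X + _))%N](@eq_count _ _ pred0) => [|x /=]; last by case: eqP.
    by rewrite count_pred0 add0n subnKC.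
  rewrite !mul0n addn0 add0n; apply/eqP/eq_count => x /=.
  by case: (eqVneq x a) => //= ->; rewrite ab.
have s's : (size s' + p = size s)%N.
  by rewrite (perm_size perm_s) size_cat size_nseq addnC.
have s'X a : a \in s' -> X a.
  by move=> as'; apply: sX; rewrite (perm_mem perm_s) mem_cat as' orbT.
have [a [q [Sa Sq rbE]]] := rp (sX b bs).
rewrite (perm_big _ perm_s) /= big_cat /= big_nseq iter_mulr_1.
rewrite rbE mulrDl; apply: redspanD.
  by apply: redspanZ => //; apply: IH => //; lia.
rewrite big_distrl /= [\sum_(i <- q) _]big_seq; apply: redspan_sum => y yq; have [Sy Xy] := Sq y yq.
rewrite -mulrA; apply: redspanZ => //.
have -> : r y.2 * \prod_(i <- s') r i = \prod_(i <- y.2 :: s') r i by rewrite big_cons.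
apply: IH => [|x]; first by rewrite /=; lia.
by rewrite inE => /predU1P[->|/s'X].
Qed.

Lemma redspan_prodM y (s : seq I) : redspan X y -> (forall b, b \in s -> X b) ->
  redspan X (y * \prod_(b <- s) r b).
Proof.
move=> [l [c [ul lX Sc ->]]] sX; rewrite /lcomb big_distrl; apply: redspan_sum => t _ /=.
rewrite -mulrA; apply: redspanZ => //; have [s' s'l ->] := mon_seq l t.
rewrite -big_cat; apply: redspan_prod => b; rewrite mem_cat => /orP[/s'l/lX|/sX] //.
Qed.

Lemma redspan_subring : is_subring (redspan X).
Proof.
split; first by apply: redspanC; exact: (sr_1 hS).
- move=> x y Xx Xy; rewrite -mulN1r addrC; apply: redspanD => //.
  by apply: redspanZ => //; apply: (sr_N hS); exact: (sr_1 hS).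
move=> x _ Xx [l [c [ul lX Sc ->]]]; rewrite /lcomb big_distrr.
apply: redspan_sum => t _ /=; rewrite mulrCA; apply: redspanZ => //.
by have [s sl ->] := mon_seq l t; apply: redspan_prodM => // b /sl/lX.
Qed.

Lemma redspan_gen b : X b -> redspan X (r b).
Proof.
move=> Xb; have -> : r b = \prod_(a <- [:: b]) r a by rewrite big_seq1.
by apply: redspan_prod => a; rewrite inE => /eqP ->.
Qed.

End Ring.

Lemma redspan_min X (V : set R) : is_subring V -> S `<=` V ->
  (forall b, X b -> V (r b)) -> redspan X `<=` V.
Proof.
move=> hV SV rV _ [l [c [ul lX Sc ->]]]; apply: sr_sum => // t _.
apply: (sr_M hV); first exact: SV; have [s sl ->] := mon_seq l t.
by rewrite big_seq; elim/big_ind: _ => [|x y ? ?|b /sl/lX/rV//];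
  [exact: (sr_1 hV)|exact: (sr_M hV)].
Qed.

Definition rfree X := forall l c, uniq l -> (forall b, b \in l -> X b) ->
  (forall t, S (c t)) -> lcomb p c r l = 0 -> forall t, t \in exps p (size l) -> c t = 0.

Lemma rfree_notin X Y b : rfree X -> X b -> Y `<=` X -> ~ Y b -> ~ redspan Y (r b).
Proof.
move=> Xf Xb YX nYb [l [c [ul lY Sc rE]]]; pose z := nseq (size l) 0%N.
(* The equation for [r b] as a relation in the list [b :: l]: coefficient [1] at the monomial [r b],
   whose exponent [1] is reduced as [p > 1], and [- c] at the monomials without [b]. *)
pose d u : R := if u is e :: t then
  if e == 0%N then - c t else if e == 1%N then (t == z)%:R else 0 else 0.
have zl : z \in exps p (size l).
  by apply/expsP; rewrite size_nseq; split=> //; apply/allP => e /nseqP[-> _]; exact: ltnW.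
have := Xf (b :: l) d; rewrite /= ul andbT.
have -> : b \notin l by apply/negP => /lY.
have e1 : 1%N :: z \in exps p (size (b :: l)).
  by have /expsP[sz zp] := zl; apply/expsP; rewrite /= sz p_gt1.
move=> /(_ isT) H; have /eqP := oner_neq0 R; apply.
have <- : d (1%N :: z) = 1 by rewrite /d /= eqxx.
apply: H e1 => [a|u|].
- by rewrite inE => /predU1P[->//|/lY/YX].
- case: u => [|[|[|e]] u] /=; try exact: (sr_0 hS); first exact: (sr_N hS).
  by case: eqP => _; [exact: (sr_1 hS)|exact: (sr_0 hS)].
rewrite lcomb_cons big_ltn ?(ltnW p_gt1) // big_ltn // big_nat big1; last first.
  by move=> [|[|e]] // _; rewrite /lcomb big1 ?mul0r // => t _; rewrite mul0r.
have -> : lcomb p (fun t => d (1%N :: t)) r l = 1.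
  transitivity (mon r l z); first by rewrite (lcomb_delta _ zl).
  by rewrite /z; elim: (l) => //= a l' ->; rewrite expr0 mul1r.
rewrite addr0 mul1r expr0 mulr1 expr1 rE -[X in _ + X](mulr1) /lcomb mulr1.
by rewrite -big_split big1 // => t _; rewrite /= mulNr addNr.
Qed.

End RedSpan.

(** * p-independence *)

Section PIndependence.
Variables (R : fieldType) (p : nat) (pR : p \in [pchar R]).

Let p_gt1 : (1 < p)%N := prime_gt1 (pcharf_prime pR).
Let p_gt0 : (0 < p)%N := ltnW p_gt1.

(** Every element of [R] is then a [p]-th root over [S], so the reduced monomials in any set span a
    subring, and such a subring is a field. *)
Definition pclosed (S : set R) := is_subring S /\ forall y, S (y ^+ p).

Section Closure.
Variables (S : set R) (hS : pclosed S).
Implicit Types (l : seq R) (X Y : set R).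

Definition pclosure X := redspan p S id X.
Definition pfree X := rfree p S (id : R -> R) X.

Section PowerSpan.
Variables (I : eqType) (r : I -> R) (Z : set I).

Let rp b : Z b -> exists a (s : seq (R * I)),
  [/\ S a, forall x, x \in s -> S x.1 /\ Z x.2 & r b ^+ p = a + \sum_(x <- s) x.1 * r x.2].
Proof. by exists (r b ^+ p), [::]; rewrite big_nil addr0; split=> //; exact: hS.2. Qed.

Lemma pspan_subring : is_subring (redspan p S r Z).
Proof. exact: (redspan_subring p_gt1 hS.1 rp). Qed.

Lemma pspan_gen b : Z b -> redspan p S r Z (r b).
Proof. exact: (redspan_gen p_gt1 hS.1 rp). Qed.

End PowerSpan.

Lemma pclosure_subring X : is_subring (pclosure X).
Proof. exact: pspan_subring. Qed.

Lemma pclosure_base X : S `<=` pclosure X.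
Proof. by move=> x; apply: redspanC. Qed.

Lemma pclosure_gen X : X `<=` pclosure X.
Proof. by move=> b; apply: (@pspan_gen R id). Qed.

Lemma pclosure_pclosed X : pclosed (pclosure X).
Proof. split; [exact: pclosure_subring|move=> y; apply: pclosure_base; exact: hS.2]. Qed.

Lemma pclosure_sub X Y : X `<=` Y -> pclosure X `<=` pclosure Y.
Proof. exact: redspan_sub. Qed.

Lemma pclosure_min X (V : set R) : is_subring V -> S `<=` V -> X `<=` V -> pclosure X `<=` V.
Proof. exact: redspan_min. Qed.

Lemma pclosed_is_subfield : is_subfield S.
Proof. by have [h1 h2] := hS; apply: (pclosed_subfield pR). Qed.

(** Over the field [pclosure X], an element outside it has degree [p], so its powers of exponent
    less than [p] are independent. *)
Lemma pfree_ext X a : pfree X -> ~ pclosure X a -> pfree (a |` X).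
Proof.
move=> Xf aX l c ul lX Sc l0; have [al|al] := boolP (a \in l); last first.
  by apply: Xf => // b bl; case: (lX b bl) => // ba; rewrite -ba bl in al.
have pl : perm_eq l (a :: rem a l) by rewrite perm_to_rem.
have [h hP hE] := lcomb_perm p c id ul pl; move: l0; rewrite {}hE lcomb_cons => l0.
have u' : uniq (rem a l) by rewrite rem_uniq.
have lX' b : b \in rem a l -> X b.
  rewrite (mem_rem_uniq _ ul) !inE => /andP[ba bl].
  by case: (lX b bl) => // /eqP; rewrite (negbTE ba).
have Fs e : pclosure X (lcomb p (fun t => (c \o h) (e :: t)) id (rem a l)).
  by exists (rem a l), (fun t => (c \o h) (e :: t)); split=> // t; apply: Sc.
have s0 := pth_root_free pR (pclosed_subfield pR (pclosure_subring X)
  (pclosure_pclosed X).2) ((pclosure_pclosed X).2 a) aX Fs l0.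
move=> t /hP[t' /expsP[]] + + <-; case: t' => // e t' [st'].
move=> /= /andP[ep t'p]; apply: (Xf _ (fun t => c (h (e :: t))) u' lX') => //.
  exact: s0.
by apply/expsP.
Qed.

Lemma pbasis_ex X0 : pfree X0 -> exists X, [/\ X0 `<=` X, pfree X & forall y, pclosure X y].
Proof.
move=> X0f; pose Q l := uniq l -> forall c, (forall t, S (c t)) -> lcomb p c id l = 0 ->
  forall t, t \in exps p (size l) -> c t = 0.
have QE X : pfree X <-> forall l, (forall x, x \in l -> X x) -> Q l.
  by split=> H l => [lX ul c|c ul lX]; apply: H.
have [X [X0X Xf Xmax]] := tukey (iffLR (QE X0) X0f); exists X; split=> //.
  exact/QE.
move=> y; apply: contrapT => ny; suff : X y by move=> /pclosure_gen.
have <- // : y |` X = X; last by left.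
apply: Xmax => [x|]; first by right.
by apply/QE; apply: pfree_ext => //; apply/QE.
Qed.

(** The finitely many coefficients are expanded over one common list in [Y]. A relation over
    [pclosure Y] becomes one over [S] in [X] and [Y] together, and no monomials merge as the two
    sets are disjoint. *)
Lemma pfree_tower X Y : pfree (X `|` Y) -> (forall x, X x -> ~ Y x) ->
  rfree p (pclosure Y) id X.
Proof.
move=> XYf XY l c ul lX Yc l0.
have [l' [ul' l'Y cl']] := redspan_common (exps p (size l)) Yc.
have /choice[d dP] t : exists d : seq nat -> R, (forall u, S (d u)) /\
    (t \in exps p (size l) -> c t = lcomb p d id l').
  have [/cl' H|_] := boolP (t \in exps p (size l)).
    by have [d Sd cE] := redspan_seq p_gt1 hS.1 ul' H; exists d.
  by exists (fun=> 0); split=> // _; exact: (sr_0 hS.1).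
pose n := size l; pose e u := d (take n u) (drop n u).
have e0 : lcomb p e id (l ++ l') = 0.
  rewrite lcomb_cat -[RHS]l0 /lcomb big_seq [RHS]big_seq; apply: eq_bigr => t tl.
  rewrite (dP t).2 //; congr (_ * _); apply: eq_bigr => u _; rewrite /e.
  have /expsP[st _] := tl.
  by rewrite take_size_cat ?drop_size_cat.
have := XYf (l ++ l') e; rewrite cat_uniq ul ul' andbT /=.
have -> : ~~ has (mem l) l'.
  by apply/hasPn => b bl'; apply/negP => bl; apply: (XY b); [exact: lX|exact: l'Y].
move=> /(_ isT) H t tl; rewrite (dP t).2 // /lcomb big_seq big1 // => u ul'p.
suff -> : d t u = 0 by rewrite mul0r.
have /expsP[st tp] := tl; have /expsP[su up] := ul'p.
have := H _ (fun _ => (dP _).1 _) e0 (t ++ u); rewrite /e take_size_cat ?drop_size_cat //.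
apply=> [b|]; first by rewrite mem_cat => /orP[/lX|/l'Y]; [left|right].
by apply/expsP; rewrite !size_cat st su all_cat tp up.
Qed.

Definition pmonomials X := [set y | exists l t,
  [/\ uniq l, forall b, b \in l -> X b, t \in exps p (size l) & y = mon id l t]].

Lemma pmonomials_list X n (b : 'I_n -> R) : (forall i, pmonomials X (b i)) ->
  exists l, [/\ uniq l, forall a, a \in l -> X a &
    forall i, exists2 t, t \in exps p (size l) & b i = mon id l t].
Proof.
move=> Xb; suff [l [ul lX lP]] : exists l, [/\ uniq l, forall a, a \in l -> X a &
    forall i, i \in enum 'I_n -> exists2 t, t \in exps p (size l) & b i = mon id l t].
  by exists l; split=> // i; apply: lP; rewrite mem_enum.
elim: (enum 'I_n) => [|i s [l [ul lX ls]]]; first by exists [::].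
have [l' [t [ul' l'X tl' bE]]] := Xb i.
exists (undup (l ++ l')); split; first exact: undup_uniq.
  by move=> a; rewrite mem_undup mem_cat => /orP[/lX|/l'X].
move=> j; rewrite inE => /predU1P[->|/ls[u ul'' ->]].
  rewrite bE; apply: mon_ext => //; first exact: undup_uniq.
  by move=> a al; rewrite mem_undup mem_cat al orbT.
apply: mon_ext => //; first exact: undup_uniq.
by move=> a al; rewrite mem_undup mem_cat al.
Qed.

Lemma pmonomials_basis X : pfree X -> (forall y, pclosure X y) ->
  is_basis S (pmonomials X).
Proof.
move=> Xf Xall; split=> [n b c binj Xb Sc sum0 k|y].
  have [l [ul lX bl]] := pmonomials_list Xb.
  have /choice[t tP] i : exists t, t \in exps p (size l) /\ b i = mon id l t.
    by have [t ? ?] := bl i; exists t.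
  have tinj i j : t i = t j -> i = j.
    by move=> tij; apply: binj; rewrite (tP i).2 (tP j).2 tij.
  have := Xf l (fun u => \sum_i c i * (u == t i)%:R) ul lX _ _ (t k) (tP k).1.
  rewrite (bigD1 k) //= eqxx mulr1 big1 ?addr0 => [|i ik]; first apply.
  - move=> u; apply: (sr_sum hS.1) => i _; apply: (sr_M hS.1) => //.
    by case: eqP => _; [exact: (sr_1 hS.1)|exact: (sr_0 hS.1)].
  - rewrite -[RHS]sum0 /lcomb; under eq_bigr do rewrite big_distrl /=.
    rewrite exchange_big; apply: eq_bigr => i _ /=.
    rewrite (tP i).2 (lcomb_delta id (tP i).1) /lcomb big_distrr.
    by apply: eq_bigr => u _ /=; rewrite mulrA.
  by case: eqP => [/tinj ki|]; rewrite ?mulr0 //; rewrite ki eqxx in ik.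
have [l [c [ul lX Sc ->]]] := Xall y.
exists (size (exps p (size l))), (fun i => mon id l (nth [::] (exps p (size l)) i)),
  (fun i => c (nth [::] (exps p (size l)) i)); split=> [i|i|].
- by exists l, (nth [::] (exps p (size l)) i); split=> //; rewrite mem_nth.
- exact: Sc.
by rewrite /lcomb (big_nth ([::] : seq nat)) big_mkord.
Qed.

Lemma mon_inj X l : pfree X -> uniq l -> (forall b, b \in l -> X b) ->
  {in exps p (size l) &, injective (mon (id : R -> R) l)}.
Proof.
move=> Xf ul lX t u tl ul' tu; apply: contrapT => /eqP ntu.
have := Xf l (fun v => (v == t)%:R - (v == u)%:R) ul lX _ _ t tl.
rewrite eqxx (negbTE ntu) subr0 => H; have /eqP := oner_neq0 R; apply; apply: H.
  by move=> v; apply: (sr_B hS.1); case: eqP => _; (exact: (sr_1 hS.1) || exact: (sr_0 hS.1)).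
transitivity (mon id l t - mon id l u); last by rewrite tu subrr.
rewrite (lcomb_delta _ tl) (lcomb_delta _ ul') /lcomb -sumrB.
by apply: eq_bigr => v _; rewrite mulrBl.
Qed.

Lemma pmonomials_finite X n : pfree X -> X #= `I_n -> pmonomials X #= `I_(p ^ n).
Proof.
move=> Xf Xn; have /finite_seqP[l0 XE] : finite_set X by exists n.
pose l := undup l0; have ul : uniq l := undup_uniq _.
have {}XE : X = [set` l] by rewrite XE; apply/seteqP; split=> b /=; rewrite mem_undup.
have sl : size l = n.
  apply/card_eq_II; apply: card_eq_trans Xn; rewrite card_eq_sym XE.
  exact: card_uniq_seq.
have lX b : b \in l -> X b by rewrite XE.
rewrite -sl -size_exps -(size_map (mon id l)).
apply: card_eq_trans (card_uniq_seq _); last first.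
  by rewrite map_inj_in_uniq ?exps_uniq //; exact: (mon_inj Xf ul lX).
rewrite (_ : pmonomials X = [set` map (mon id l) (exps p (size l))]) //.
apply/seteqP; split=> [_ [l' [t [ul' l'X tl' ->]]]|_ /mapP[t tl ->]]; last by exists l, t.
have [|t' t'l ->] := mon_ext id p_gt0 ul' ul _ tl'; last exact: map_f.
by move=> b /l'X; rewrite XE.
Qed.

(** A reduced monomial is the product of a list in [X], and there are no more such lists than
    elements of [X]. *)
Lemma pmonomials_infinite X : infinite_set X -> pmonomials X #= X.
Proof.
move=> Xinf; apply/card_eqPle; split; last first.
  apply: subset_card_le => x Xx; exists [:: x], [:: 1%N]; split=> //.
  - by move=> b; rewrite inE => /eqP ->.
  - by apply/expsP; rewrite /= p_gt1.
  - by rewrite /= expr1 mulr1.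
apply: card_le_trans (card_seq_le Xinf).
have /choice[s sP] y : exists s : seq {classic R}, pmonomials X y ->
    (forall x, x \in s -> X x) /\ y = \prod_(b <- s) (b : R).
  have [[l [t [ul lX tl ->]]]|ny] := EM (pmonomials X y); last by exists [::].
  have [s sl sE] := mon_seq (id : R -> R) l t; exists s => _; split=> // x xs.
  apply: lX; apply: sl; elim: s xs {sE} => //= a s IH.
  by rewrite !inE => /predU1P[->|/IH ->]; rewrite ?eqxx ?orbT.
apply: (@card_le_inj _ _ _ _ s) => [y /sP[]//|x y /sP[_ {2}->] /sP[_ {2}->] ->].
by [].
Qed.

End Closure.
End PIndependence.

Lemma pfree_sub (R : fieldType) p (S X Y : set R) : X `<=` Y -> pfree p S Y -> pfree p S X.
Proof. by move=> XY Yf l c ul lX; apply: Yf => // b /lX/XY. Qed.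

Lemma pfree_notin (R : fieldType) p (S X Y : set R) u : p \in [pchar R] ->
  pclosed p S -> pfree p S X -> X u -> Y `<=` X -> ~ Y u -> ~ pclosure p S Y u.
Proof.
move=> pR hS; apply: rfree_notin; last exact: hS.1.
exact: prime_gt1 (pcharf_prime pR).
Qed.

(** A converse to [rfree_notin]: [pth_root_free] peels off the head of the list. The family is
    indexed, so that a repeated value counts as a dependence. *)
Lemma rfree_of_notin (R : fieldType) p (S : set R) (J : eqType) (t : J -> R) (X : set J) :
  p \in [pchar R] -> pclosed p S ->
  (forall a l, uniq (a :: l) -> (forall b, b \in a :: l -> X b) ->
     ~ redspan p S t [set` l] (t a)) -> rfree p S t X.
Proof.
move=> pR hS notin; have p_gt1 : (1 < p)%N := prime_gt1 (pcharf_prime pR).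
elim=> [|a l IH] c ul lX Sc l0 u.
  by rewrite inE => /eqP ->; rewrite -l0 /lcomb big_seq1 mulr1.
move=> /expsP[]; case: u => // e u [su] /= /andP[ep up].
have ul' : uniq l by case/andP: ul.
have hF : is_subring (redspan p S t [set` l]) := pspan_subring pR hS t _.
have Fp y : redspan p S t [set` l] (y ^+ p) by apply: redspanC; apply: hS.2.
move: l0; rewrite lcomb_cons => l0.
have s0 := pth_root_free pR (pclosed_subfield pR hF Fp) (Fp (t a)) (notin a l ul lX) _ l0.
apply: (IH (fun v => c (e :: v)) ul') => //; last by apply/expsP.
  by move=> b bl; apply: lX; rewrite inE bl orbT.
apply: s0 => // e'; exists l, (fun v => c (e' :: v)); split=> //.
Qed.

Section FreeFamily.
Variables (R : fieldType) (p : nat) (pR : p \in [pchar R]) (S : set R) (hS : pclosed p S).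
Variables (J : choiceType) (t : J -> R) (X : set J) (tX : rfree p S t X).

Lemma rfree_inj a b : X a -> X b -> t a = t b -> a = b.
Proof.
move=> Xa Xb tab; apply: contrapT => ab.
apply: (@rfree_notin p _ _ _ t (prime_gt1 (pcharf_prime pR)) hS.1 X [set b] a tX) => //.
  by move=> x ->.
by rewrite tab; apply: (pspan_gen pR hS).
Qed.

Lemma rfree_image J0 : J0 `<=` X -> pfree p S (t @` J0).
Proof.
move=> JX l cf ul lJ Sc l0.
have [l' l'J lE] : exists2 l' : seq J, (forall a, a \in l' -> J0 a) & l = map t l'.
  elim: (l) lJ => [|y q IH] qJ; first by exists [::].
  have [a Ja ay] := qJ y (mem_head _ _).
  have [b bq|q' q'J ->] := IH; first by apply: qJ; rewrite inE bq orbT.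
  exists (a :: q'); last by rewrite /= ay.
  by move=> b; rewrite inE => /predU1P[->|/q'J].
have ul' : uniq l' by move: ul; rewrite lE => /map_uniq.
have := tX ul' (fun b bl => JX _ (l'J b bl)) Sc; rewrite lE size_map; apply.
have : lcomb p cf (id \o t) l' = 0 by rewrite lcomb_comp -lE.
by [].
Qed.

End FreeFamily.

(** * Valuation bases *)

Section GroupBasis.
Variables (G : oagType) (p : nat) (p_prime : prime p).

Let p_gt0 : (0 < p)%N := prime_gt0 p_prime.

(** The span modulo [pG]; repetitions in the list replace coefficients. *)
Definition gspan (X : set G) : set G := [set g | exists (l : seq G) (h : G),
  (forall b, b \in l -> X b) /\ g = \sum_(b <- l) b + h *+ p].

Lemma gspan_sub (X Y : set G) : X `<=` Y -> gspan X `<=` gspan Y.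
Proof. by move=> XY _ [l [h [lX ->]]]; exists l, h; split=> // b /lX/XY. Qed.

Lemma gspanD X x y : gspan X x -> gspan X y -> gspan X (x + y).
Proof.
move=> [l [h [lX ->]]] [l' [h' [lX' ->]]]; exists (l ++ l'), (h + h').
split; last by rewrite big_cat mulrnDl addrACA.
by move=> b; rewrite mem_cat => /orP[/lX|/lX'].
Qed.

Lemma gspan_mult X h : gspan X (h *+ p).
Proof. by exists [::], h; rewrite big_nil add0r. Qed.

Lemma gspanMn X x n : gspan X x -> gspan X (x *+ n).
Proof.
move=> Xx; elim: n => [|n IH]; last by rewrite mulrS; apply: gspanD.
by rewrite mulr0n -(mul0rn _ p); apply: gspan_mult.
Qed.

Lemma gspanN X x : gspan X x -> gspan X (- x).
Proof.
move=> Xx; have -> : - x = x *+ p.-1 + (- x) *+ p.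
  by rewrite -{2}(prednK p_gt0) mulrS addrCA mulNrn subrr addr0.
by apply: gspanD; [apply: gspanMn|apply: gspan_mult].
Qed.

Lemma gspan_gen X x : X x -> gspan X x.
Proof.
move=> Xx; exists [:: x], 0; rewrite big_seq1 mul0rn addr0; split=> //.
by move=> b; rewrite inE => /eqP ->.
Qed.

(** An integer prime to [p] is invertible modulo [p], by Bezout. *)
Lemma gspan_unit X x n : gspan X (x *+ n) -> ~~ (p %| n)%N -> gspan X x.
Proof.
move=> Xx pn; have n0 : (0 < n)%N by case: n pn {Xx} => //; rewrite dvdn0.
have /(coprimeP _ n0)[[u v] /= uv] : coprime n p.
  by rewrite coprime_sym prime_coprime.
have -> : x = x *+ n *+ u + (- x) *+ v *+ p.
  rewrite -!mulrnA -{1}[x]mulr1n -uv mulrnBr; last by lia.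
  by rewrite mulNrn mulnC.
by apply: gspanD; [apply: gspanMn|apply: gspan_mult].
Qed.

Lemma gspan_seq X (l : seq G) (n : G -> nat) : (forall b, b \in l -> X b) ->
  gspan X (\sum_(b <- l) b *+ n b).
Proof.
move=> lX; rewrite big_seq; apply: (big_ind (gspan X)); last first.
- by move=> b /lX Xb; apply/gspanMn/gspan_gen.
- exact: gspanD.
- by rewrite -(mul0rn _ p); apply: gspan_mult.
Qed.

Definition gfree (X : set G) := forall l (n : G -> nat), uniq l ->
  (forall b, b \in l -> X b) -> (forall b, (n b < p)%N) ->
  (exists h, \sum_(b <- l) b *+ n b = h *+ p) -> forall b, b \in l -> n b = 0%N.

Lemma gfree_ext X a : gfree X -> ~ gspan X a -> gfree (a |` X).
Proof.
move=> Xf aX l n ul lX np [h hE]; have [al|al] := boolP (a \in l); last first.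
  apply: Xf => // [b bl|]; last by exists h.
  by case: (lX b bl) => // ba; rewrite -ba bl in al.
have lX' b : b \in rem a l -> X b.
  rewrite (mem_rem_uniq _ ul) !inE => /andP[ba bl].
  by case: (lX b bl) => // /eqP; rewrite (negbTE ba).
have pl := perm_to_rem al; move: hE; rewrite (perm_big _ pl) big_cons /= => hE.
have na : n a = 0%N.
  apply/eqP; rewrite -leqn0 leqNgt; apply/negP => na; apply: aX.
  apply: (@gspan_unit _ _ (n a)); last first.
    by apply/negP => /dvdn_leq -/(_ na); rewrite leqNgt np.
  move: hE => /(canRL (addrK _)) ->; apply: gspanD; first exact: gspan_mult.
  by apply/gspanN/gspan_seq.
move: hE; rewrite na mulr0n add0r => hE b; rewrite (perm_mem pl) inE.
move=> /predU1P[->//|]; apply: Xf => //; first exact: rem_uniq.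
by exists h.
Qed.

Lemma gbasis_ex : exists X, gfree X /\ forall g, gspan X g.
Proof.
pose Q l := uniq l -> forall n : G -> nat, (forall b, (n b < p)%N) ->
  (exists h, \sum_(b <- l) b *+ n b = h *+ p) -> forall b, b \in l -> n b = 0%N.
have QE X : gfree X <-> forall l, (forall x, x \in l -> X x) -> Q l.
  by split=> H l => [lX ul n|n ul lX]; apply: H.
have [|X [_ Xf Xmax]] := @tukey _ Q set0; first by case=> // a l /(_ a (mem_head _ _)).
exists X; split=> [|g]; first exact/QE.
apply: contrapT => ng; suff : X g by move=> /gspan_gen.
have <- // : g |` X = X; last by left.
apply: Xmax => [x|]; first by right.
by apply/QE; apply: gfree_ext => //; apply/QE.
Qed.

Lemma gfree_notin X Y x : gfree X -> X x -> Y `<=` X -> ~ Y x -> ~ gspan Y x.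
Proof.
move=> Xf Xx YX nYx [l [h [lY xE]]]; pose l' := undup l.
have xl : x \notin l' by rewrite mem_undup; apply/negP => /lY.
(* The coefficient [p - 1] at [x] stands for [-1]; the others are multiplicities reduced modulo [p],
   the excess going into the multiple of [p]. *)
pose n b := if b == x then p.-1 else (count_mem b l %% p)%N.
have := Xf (x :: l') n; rewrite /= xl undup_uniq => /(_ isT) H.
have : n x = 0%N.
  apply: (H _ _ _ _ (mem_head _ _)) => [b|b|].
  - by rewrite inE mem_undup => /predU1P[->//|/lY/YX].
  - by rewrite /n; case: eqP => _; rewrite ?ltn_pmod // ltn_predL.
  exists (x - h - \sum_(b <- l') b *+ (count_mem b l %/ p)).
  have lE : \sum_(b <- l) b = \sum_(b <- l') b *+ count_mem b l.
    by rewrite -big_undup_iterop_count; apply: eq_bigr => b _.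
  rewrite big_cons /n eqxx; under eq_big_seq => b bl'.
    rewrite ifN; last by apply: contraNneq xl => <-.
    over.
  have {}lE : \sum_(b <- l') b *+ (count_mem b l %% p) =
      \sum_(b <- l) b - (\sum_(b <- l') b *+ (count_mem b l %/ p)) *+ p.
    rewrite lE -sumrMnl -sumrB; apply: eq_bigr => b _.
    by rewrite {2}(divn_eq (count_mem b l) p) mulrnDr mulrnA addrAC subrr add0r.
  rewrite lE -[in LHS](addrK (h *+ p) (\sum_(b <- l) b)) -xE.
  rewrite !mulrnBl; have -> : x *+ p = x *+ p.-1 + x by rewrite -mulrSr prednK.
  by rewrite !addrA.
by rewrite /n eqxx => p0; have := prime_gt1 p_prime; rewrite -(prednK p_gt0) p0.
Qed.
End GroupBasis.

Section ValuationBasis.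
Variables (K : valuedField) (p : nat) (pK : p \in [pchar K]).
Let G := vgroup K.
Let k := residue K.
Let p_prime : prime p := pcharf_prime pK.
Let p_gt1 : (1 < p)%N := prime_gt1 p_prime.
Let p_gt0 : (0 < p)%N := prime_gt0 p_prime.
Let pk : p \in [pchar k] := rs_pchar pK.

Lemma ppowers_subring (R : fieldType) : p \in [pchar R] -> is_subring (ppowers R p).
Proof.
move=> pR; have -> : ppowers R p = range (pFrobenius_aut pR).
  by apply/seteqP; split=> _ [x _ <-]; exists x; rewrite // pFrobenius_autE.
by have [] := range_is_subfield (pFrobenius_aut pR).
Qed.

Lemma ppowers_pclosed (R : fieldType) : p \in [pchar R] -> pclosed p (ppowers R p).
Proof. by move=> pR; split; [exact: ppowers_subring|move=> y; exists y]. Qed.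

(* [vb1] is a basis of [vK] modulo [pvK] and [vb2] a p-basis of [Kv]; they are lifted
   to [K] by [vlift]. *)
Record vbasis := VBasis {
  vb1 : set G; vb2 : set k; vlift : G + k -> K;
  vb1_free : gfree p vb1;
  vb1_span : forall g, gspan p vb1 g;
  vb2_free : pfree p (ppowers k p) vb2;
  vb2_span : forall a, pclosure p (ppowers k p) vb2 a;
  vlift1 : forall g, val_of (vlift (inl g)) = Some g;
  vlift2 : forall a, a != 0 -> val_of (vlift (inr a)) = Some 0;
  vlift2_rs : forall a, rs (vlift (inr a)) = a
}.

Definition vbset (W : vbasis) : set (G + k) :=
  fun i => match i with inl g => vb1 W g | inr a => vb2 W a end.

Lemma vbasis_ex : exists W : vbasis, True.
Proof.
have [X1 [X1f X1s]] := gbasis_ex G p_prime.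
have [|X2 [_ X2f X2s]] := @pbasis_ex _ _ pk _ (ppowers_pclosed pk) set0.
  move=> [|a l] c _ lX Sc; last by case: (lX a (mem_head _ _)).
  by rewrite /lcomb big_seq1 /= mulr1 => c0 t; rewrite inE => /eqP ->.
have /choice[f fP] (i : G + k) : exists x : K, match i with
    inl g => val_of x = Some g | inr a => vle (Some 0) (val_of x) /\ rs x = a end.
  case: i => [g|a]; first by have [x] := val_onto g; exists x.
  by have [x] := rs_onto a; exists x.
have f2 a : a != 0 -> val_of (f (inr a)) = Some 0.
  move=> a0; have [f0 fa] := fP (inr a); have [//|lt] := vle_eqVlt f0.
  by move: a0; rewrite -{}fa rs_eq0 // lt.
by exists (@VBasis X1 X2 f X1f X1s X2f X2s (fun g => fP (inl g)) f2 (fun a => (fP (inr a)).2)).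
Qed.

Section VI.
Variable W : vbasis.
Let x := vlift W.

Lemma vb2_neq0 a : vb2 W a -> a != 0.
Proof.
move=> Wa; apply/eqP => a0; have := @pfree_notin _ p (ppowers k p) _ set0 a pk
  (ppowers_pclosed pk) (@vb2_free W) Wa.
apply=> //; rewrite a0; apply: pclosure_base.
exact: (sr_0 (ppowers_subring pk)).
Qed.

Definition lin1 (l : seq (G + k)) : set G := [set g | inl g \in l].
Definition lin2 (l : seq (G + k)) : set k := [set a | inr a \in l].

Let V (l : seq (G + k)) := redspan p (ppowers K p) x [set` l].

Lemma V_pclosed l : pclosed p (V l).
Proof.
split; last by move=> y; apply: redspanC; exists y.
exact: (pspan_subring pK (ppowers_pclosed pK)).
Qed.

Lemma V_lcomb l z : uniq l -> V l z -> exists c, z = lcomb p (fun t => c t ^+ p) x l.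
Proof.
move=> ul /(redspan_seq p_gt1 (ppowers_subring pK) ul)[c Sc ->].
have /choice[d dP] t : exists d, d ^+ p = c t by have [d _ <-] := Sc t; exists d.
by exists d; apply: lcomb_eq => t _; rewrite dP.
Qed.

Lemma lcomb_V l c : uniq l -> V l (lcomb p (fun t => c t ^+ p) x l).
Proof. by move=> ul; exists l, (fun t => c t ^+ p); split=> // t; exists (c t). Qed.

(** The three claims feed each other in the induction. When a value element is adjoined, the second
    claim gives the terms with different powers of it different values, so a single term dominates.
    When a residue element is adjoined, the third claim keeps its residue outside the field of the
    earlier residues, so that the terms of least value cannot cancel. *)
Lemma val_indep l : uniq l -> (forall b, b \in l -> vbset W b) ->
  [/\ forall c t, t \in exps p (size l) ->
        vle (val_of (lcomb p (fun t => c t ^+ p) x l)) (val_of (c t ^+ p * mon x l t)),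
      forall z g, V l z -> val_of z = Some g -> gspan p (lin1 l) g &
      forall z, V l z -> val_of z = Some 0 -> pclosure p (ppowers k p) (lin2 l) (rs z)].
Proof.
elim: l => [|b l IH].
  move=> _ _; split=> [c t|z g|z].
  - by rewrite inE => /eqP ->; rewrite /lcomb big_seq1 vle_refl.
  - move=> /V_lcomb[//|c ->]; rewrite /lcomb big_seq1 mulr1.
    case vc: (val_of (c [::])) => [h|]; last first.
      by rewrite (val_None vc) expr0n eqn0Ngt p_gt0 val0.
    by rewrite (val_expn _ vc) => -[<-]; apply: gspan_mult.
  move=> /V_lcomb[//|c ->]; rewrite /lcomb big_seq1 mulr1 => vc.
  apply: pclosure_base.
  exists (rs (c [::])); rewrite // rsX //.
  by have := @val_exp_leE K 1 (c [::]) p p_gt0; rewrite expr1n val1 vc vle_refl => <-.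
move=> /andP[bl ul] lW; have lW' a : a \in l -> vbset W a.
  by move=> al; apply: lW; rewrite inE al orbT.
have [IH1 IH2 IH3] := IH ul lW'.
have Wb : vbset W b by apply: lW; rewrite mem_head.
have VlF := V_pclosed l; have VlS := pclosed_is_subfield pK VlF.
have sub1 g : gspan p (lin1 l) g -> gspan p (lin1 (b :: l)) g.
  by apply: gspan_sub => h; rewrite /lin1 /= inE => ->; rewrite orbT.
have sub2 a : pclosure p (ppowers k p) (lin2 l) a -> pclosure p (ppowers k p) (lin2 (b :: l)) a.
  by apply: pclosure_sub => h; rewrite /lin2 /= inE => ->; rewrite orbT.
have xb0 : x b != 0.
  case: b Wb {bl sub1 sub2 lW} => [g|a] Wb; rewrite -val_eqNone ?vlift1 //.
  by rewrite vlift2 ?vb2_neq0.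
(* The inductive step in one variable: the coefficients of the powers of [x b] range over the field
   [V l]. *)
have step (s : nat -> K) : (forall e, V l (s e)) ->
   forall z, z = \sum_(0 <= e < p) s e * x b ^+ e ->
   [/\ forall e, (e < p)%N -> vle (val_of z) (val_of (s e * x b ^+ e)),
     forall g, val_of z = Some g -> gspan p (lin1 (b :: l)) g &
     val_of z = Some 0 -> pclosure p (ppowers k p) (lin2 (b :: l)) (rs z)].
  move=> Vs z zE.
  have [|e0 e0p emin] := @val_min_ex K _ (iota 0 p) (fun e => s e * x b ^+ e) 0%N.
    by rewrite mem_iota.
  have {}emin e : (e < p)%N -> vle (val_of (s e0 * x b ^+ e0)) (val_of (s e * x b ^+ e)).
    by move=> ep; apply: emin; rewrite mem_iota.
  move: e0p; rewrite mem_iota add0n /= => e0p.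
  have [F0|F0] := eqVneq (s e0 * x b ^+ e0) 0.
    have z0 : z = 0.
      rewrite zE big_nat big1 // => e /= ep; apply: val_None.
      by move: (emin e ep); rewrite F0 val0; case: val_of.
    rewrite z0 val0; split=> // e ep; move: (emin e ep); by rewrite F0 val0.
  have se0 : s e0 != 0 by apply: contraNneq F0 => ->; rewrite mul0r.
  case: b bl Wb {lW} sub1 sub2 xb0 zE emin F0 => [g|a] bl Wb sub1 sub2 xb0 zE emin F0.
    have gnot : ~ gspan p (lin1 l) g.
      apply: (gfree_notin p_prime (@vb1_free W) Wb) => [h /lW'//|].
      by rewrite /lin1 /= (negbTE bl).
    have vxe e : val_of (x (inl g) ^+ e) = Some (g *+ e) by apply: val_expn; exact: vlift1.
    have lt e : (e < p)%N -> e != e0 ->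
        vlt (val_of (s e0 * x (inl g) ^+ e0)) (val_of (s e * x (inl g) ^+ e)).
      move=> ep ee0; have [eqv|//] := vle_eqVlt (emin e ep).
      have [h vse0] := val_neq0 se0; move: eqv; rewrite !val_mul !vxe vse0.
      case vse: (val_of (s e)) => [h'|] //= -[eqg]; case: gnot.
      have dE : forall i j : nat, (i < j)%N -> (j < p)%N -> forall h1 h2 : G,
          gspan p (lin1 l) h1 -> gspan p (lin1 l) h2 -> h1 + g *+ i = h2 + g *+ j ->
          gspan p (lin1 l) g.
        move=> i j ij jp h1 h2 H1 H2 E; apply: (@gspan_unit _ _ p_prime _ _ (j - i)).
          rewrite mulrnBr 1?ltnW // (_ : _ - _ = h1 - h2).
            by apply: gspanD => //; apply: gspanN.
          by rewrite -[h1](addrK (g *+ i)) E addrAC [h2 + _]addrC addrK.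
        by apply/negP => /dvdn_leq; lia.
      have [Vh Vh'] := (IH2 _ _ (Vs e0) vse0, IH2 _ _ (Vs e) vse).
      by case: (ltngtP e e0) ee0 => // ee0 _; [apply: (dE e e0) Vh' Vh _|apply: (dE e0 e) Vh Vh' _].
    have zsim : sim (s e0 * x (inl g) ^+ e0) z.
      rewrite /sim zE (bigD1_seq e0) ?mem_index_iota ?iota_uniq //= opprD addrA subrr sub0r valN.
      rewrite big_seq_cond; apply: val_sum_gt; first by rewrite val_NoneP.
      by move=> e /andP[]; rewrite mem_index_iota => /lt.
    have [h vse0] := val_neq0 se0.
    have vz : val_of z = Some (h + g *+ e0).
      by rewrite (sim_val zsim) val_mul vxe vse0.
    split=> [e ep|g'|]; first by rewrite (sim_val zsim) emin.
      rewrite vz => -[<-]; apply: gspanD; first exact: sub1 (IH2 _ _ (Vs e0) vse0).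
      by apply: gspanMn => //; apply: gspan_gen; rewrite /lin1 /= mem_head.
    (* A sum of value [0] has its dominant term at exponent [0], as otherwise [g] would be in the
       span of the earlier values; so its residue is that of a coefficient. *)
    rewrite vz => -[hg]; have e00 : e0 = 0%N.
      apply/eqP/negP => /negP e00; apply: gnot.
      apply: (@gspan_unit _ _ p_prime _ _ e0); last first.
        by apply/negP => /dvdn_leq; lia.
      rewrite -[_ *+ _](addKr h) hg addr0; apply: gspanN => //.
      exact: IH2 (Vs e0) vse0.
    have {}vse0 : val_of (s e0) = Some 0 by rewrite vse0 -hg e00 mulr0n addr0.
    have -> : rs z = rs (s e0).
      apply/eqP; rewrite eq_sym rs_eq ?vse0 ?vz ?hg ?vle_refl //.
      by move: zsim; rewrite /sim e00 expr0 mulr1 -e00 vse0.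
    by apply: sub2; apply: IH3.
  have anot : ~ pclosure p (ppowers k p) (lin2 l) a.
    apply: (pfree_notin pk (ppowers_pclosed pk) (@vb2_free W) Wb) => [h /lW'//|].
    by rewrite /lin2 /= (negbTE bl).
  have vx : val_of (x (inr a)) = Some 0 by apply/vlift2/vb2_neq0.
  have rx : rs (x (inr a)) = a by apply: vlift2_rs.
  have vxe e : val_of (x (inr a) ^+ e) = Some 0 by rewrite (val_expn _ vx) mul0rn.
  have vF e : val_of (s e * x (inr a) ^+ e) = val_of (s e) by rewrite val_mul vxe vadd0.
  have vF0 e : (e < p)%N -> vle (val_of (s e0)) (val_of (s e)).
    by move=> /emin; rewrite !vF.
  have rsz (s' : nat -> K) : (forall e, (e < p)%N -> vle (Some 0) (val_of (s' e))) ->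
      vle (Some 0) (val_of (\sum_(0 <= e < p) s' e * x (inr a) ^+ e)) /\
      rs (\sum_(0 <= e < p) s' e * x (inr a) ^+ e) = \sum_(0 <= e < p) rs (s' e) * a ^+ e.
    move=> s'0; have F'0 e : (e < p)%N -> vle (Some 0) (val_of (s' e * x (inr a) ^+ e)).
      by move=> ep; rewrite val_mul vxe vadd0 s'0.
    split; first by rewrite big_nat; apply: val_sum_ge => e /F'0.
    rewrite big_nat rs_sum => [|e /F'0//]; rewrite [RHS]big_nat.
    by apply: eq_bigr => e ep; rewrite rsM ?s'0 ?vxe ?vle_refl // rsX ?rx // vx vle_refl.
  have Wrs s' : V l s' -> vle (Some 0) (val_of s') ->
      pclosure p (ppowers k p) (lin2 l) (rs s').
    move=> Vs' /[dup] s'0 /vle_eqVlt[/esym/IH3|lt]; first exact.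
    move: (rs_eq0 s'0); rewrite lt => /eqP ->; apply: sr_0.
    exact: pclosure_subring (ppowers_pclosed pk) _.
  (* After division by the coefficient of least value, the residue of the sum is a polynomial in [a]
     of degree less than [p] with coefficient [1] at [e0], hence nonzero. *)
  have vz : val_of z = val_of (s e0).
    pose s' e := s e / s e0.
    have Vs' e : V l (s' e) by apply: (sr_M VlS) => //; apply: (sf_V VlS).
    have s'0 e : (e < p)%N -> vle (Some 0) (val_of (s' e)).
      move=> /vF0; rewrite -(@vle_add2r _ (val_of (s e0)) (Some 0)) ?val_NoneP //.
      by rewrite -val_mul divfK //; case: (val_of (s e0)) => //= h; rewrite add0r.
    have zE' : z = s e0 * \sum_(0 <= e < p) s' e * x (inr a) ^+ e.
      rewrite zE big_distrr; apply: eq_bigr => e _ /=.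
      by rewrite /s' mulrA mulrCA divff ?mulr1.
    have [s'z0 s'z] := rsz s' s'0.
    rewrite zE' val_mul; suff -> : val_of (\sum_(0 <= e < p) s' e * x (inr a) ^+ e) = Some 0.
      by rewrite vadd0.
    have [//|lt] := vle_eqVlt s'z0; exfalso.
    have kC := pclosure_pclosed pk (ppowers_pclosed pk) (lin2 l).
    have /= := pth_root_free pk (pclosed_is_subfield pk kC) (kC.2 a) anot
      (s := fun e => if (e < p)%N then rs (s' e) else 0).
    move=> /(_ _ _ e0 e0p); rewrite e0p /s' divff // rs1.
    suff H : \sum_(0 <= e < p) (if (e < p)%N then rs (s' e) else 0) * a ^+ e = 0.
      move=> /(_ _ H) H'; have /eqP := oner_neq0 k; apply; apply: H' => e.
      by case: ifP => [ep|_]; [apply: Wrs; [exact: Vs'|exact: s'0]|exact: (sr_0 kC.1)].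
    move: (rs_eq0 s'z0); rewrite lt => /eqP; rewrite s'z => s0.
    by rewrite -[RHS]s0 !big_nat; apply: eq_bigr => e /= ->.
  split=> [e ep|g|]; first by rewrite vz vF vF0.
    by rewrite vz => /(IH2 _ _ (Vs e0))/sub1.
  rewrite vz zE => vse0; have [|_ ->] := rsz s; first by move=> e /vF0; rewrite vse0.
  have kC := pclosure_subring pk (ppowers_pclosed pk) (lin2 (inr a :: l)).
  rewrite big_nat; apply: (sr_sum kC) => e ep; apply: (sr_M kC).
    by apply: sub2; apply: Wrs => //; rewrite -vse0 vF0.
  apply: (sr_X kC); apply: (pclosure_gen pk (ppowers_pclosed pk)).
  by rewrite /lin2 /= mem_head.
have lcombE (c : seq nat -> K) : lcomb p (fun t => c t ^+ p) x (b :: l) =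
   \sum_(0 <= e < p) lcomb p (fun t => c (e :: t) ^+ p) x l * x b ^+ e.
  by rewrite lcomb_cons.
split=> [c t|z g Vz|z Vz].
- move=> /expsP[]; case: t => // e t [st] /= /andP[ep tp]; rewrite lcombE.
  have [|H _ _] := step (fun e => lcomb p (fun t => c (e :: t) ^+ p) x l) _ _ erefl.
    by move=> e'; apply: lcomb_V.
  apply: vle_trans (H e ep) _.
  have -> : c (e :: t) ^+ p * (x b ^+ e * mon x l t) =
    c (e :: t) ^+ p * mon x l t * x b ^+ e by rewrite mulrCA mulrC.
  rewrite val_mul [X in vle _ X]val_mul; apply: vleD; last exact: vle_refl.
  by apply: (IH1 (fun t => c (e :: t))); apply/expsP.
- have [|c zE] := @V_lcomb (b :: l) z _ Vz; first by rewrite /= bl.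
  have [|_ H _] := step (fun e => lcomb p (fun t => c (e :: t) ^+ p) x l) _ z (etrans zE (lcombE c)).
    by move=> e'; apply: lcomb_V.
  exact: H.
have [|c zE] := @V_lcomb (b :: l) z _ Vz; first by rewrite /= bl.
have [|_ _ H] := step (fun e => lcomb p (fun t => c (e :: t) ^+ p) x l) _ z (etrans zE (lcombE c)).
  by move=> e'; apply: lcomb_V.
exact: H.
Qed.

End VI.
End ValuationBasis.

(** * Leading terms of combinations of reduced monomials *)

Section LeadingTerms.
Variables (K : valuedField) (p : nat) (pK : p \in [pchar K]) (W : vbasis K p).
Let p_prime : prime p := pcharf_prime pK.
Let p_gt0 : (0 < p)%N := prime_gt0 p_prime.

Lemma ext_pchar (L : valuedField) (f : valuedExt K L) : p \in [pchar L].
Proof. exact: rmorph_pchar f _ pK. Qed.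

Lemma vlift_neq0 i : vbset W i -> vlift W i != 0.
Proof.
by case: i => [g|a] Wi; rewrite -val_eqNone ?vlift1 // vlift2 // (vb2_neq0 pK Wi).
Qed.

Section Family.
Variables (L : valuedField) (f : valuedExt K L) (J : eqType) (beta : J -> vgroup K + residue K).
Variables (e : J -> K) (w : J -> L) (X : set J).
Hypothesis beta_inj : injective beta.
Hypothesis betaW : forall b, X b -> vbset W (beta b).
Hypothesis e_neq0 : forall b, e b != 0.
(** [w b] imitates [e b] times the [p]-th root of a basis element. Only its leading term is
    prescribed, which covers perturbed roots and Vandermonde combinations alike. *)
Let zeta b := e b ^+ p * vlift W (beta b).
Hypothesis wsim : forall b, X b -> sim (f (zeta b)) (w b ^+ p).

Lemma lcomb_zeta (c : seq nat -> K) l :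
  lcomb p (fun t => c t ^+ p) zeta l =
  lcomb p (fun t => (c t * mon e l t) ^+ p) (vlift W) (map beta l).
Proof.
rewrite /lcomb size_map; apply: eq_bigr => t _; rewrite exprMn -mulrA; congr (_ * _).
elim: l t => [|b l IH] [|k t] /=; rewrite ?expr1n ?mul1r //.
by rewrite IH !exprMn exprAC mulrACA.
Qed.

Lemma lcomb_zeta_le l (c : seq nat -> K) t : uniq l -> (forall b, b \in l -> X b) ->
  t \in exps p (size l) ->
  vle (val_of (lcomb p (fun t => c t ^+ p) zeta l)) (val_of (c t ^+ p * mon zeta l t)).
Proof.
move=> ul lX tl; rewrite lcomb_zeta.
have -> : c t ^+ p * mon zeta l t = (c t * mon e l t) ^+ p * mon (vlift W) (map beta l) t.
  rewrite exprMn -mulrA; congr (_ * _); elim: l t {ul lX tl} => [|b l IH] [|k t] /=; rewrite ?expr1n ?mul1r //.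
  by rewrite IH !exprMn exprAC mulrACA.
have [||H _ _] := @val_indep K p pK W (map beta l).
- by rewrite map_inj_uniq.
- by move=> _ /mapP[b /lX/betaW Wb ->].
by apply: (H (fun u => c u * mon e l u)); rewrite size_map.
Qed.

Lemma zeta_neq0 b : X b -> zeta b != 0.
Proof. by move=> /betaW Wb; rewrite mulf_neq0 ?expf_neq0 ?vlift_neq0. Qed.

Lemma sim_mon (I : eqType) (u v : I -> L) l t : (forall b, b \in l -> sim (u b) (v b)) ->
  sim (mon u l t) (mon v l t).
Proof.
elim: l t => [|b l IH] [|k t] /= uv; rewrite ?sim_refl ?oner_neq0 //.
apply: sim_mul; first by apply/sim_exp/uv; rewrite mem_head.
by apply: IH => a al; apply: uv; rewrite inE al orbT.
Qed.

(** Taking [p]-th powers brings in a combination over [K], none of whose terms has smaller value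
    than the sum, by [val_indep]. Replacing each [zeta b] by [w b ^+ p] therefore changes the sum
    only beyond its leading term. *)
Lemma lcomb_sim l (c : seq nat -> K) : uniq l -> (forall b, b \in l -> X b) ->
  (exists2 t, t \in exps p (size l) & c t != 0) ->
  sim (f (lcomb p (fun t => c t ^+ p) zeta l)) (lcomb p (f \o c) w l ^+ p).
Proof.
move=> ul lX [t0 t0l ct0]; set y := lcomb p _ zeta l; have pL := ext_pchar f.
have mon0 t : mon zeta l t != 0.
  elim: (l) (t) lX => [|b l' IH] [|k t'] /= lX; rewrite ?oner_neq0 //.
  apply: mulf_neq0; first by apply/expf_neq0/zeta_neq0/lX/mem_head.
  by apply: IH => a al; apply: lX; rewrite inE al orbT.
have y0 : y != 0.
  apply/negP => /eqP y0; have := lcomb_zeta_le c ul lX t0l; rewrite -/y y0 val0.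
  by case E: (val_of _) => //; move/val_None/eqP: E; rewrite mulf_eq0 expf_eq0 (negbTE ct0) andbF (negbTE (mon0 _)).
have powE : lcomb p (f \o c) w l ^+ p = \sum_(t <- exps p (size l)) f (c t ^+ p) * mon (fun b => w b ^+ p) l t.
  rewrite -(pFrobenius_autE pL) /lcomb rmorph_sum; apply: eq_bigr => t _.
  rewrite /= pFrobenius_autE exprMn rmorphXn; congr (_ * _).
  by elim: (l) t => [|b l' IH] [|k t] /=; rewrite ?expr1n // exprMn IH exprAC.
have fy : f y = \sum_(t <- exps p (size l)) f (c t ^+ p) * mon (f \o zeta) l t.
  by rewrite rmorph_sum; apply: eq_bigr => t _; rewrite rmorphM rmorph_mon.
rewrite /sim {2}fy powE -sumrB big_seq; apply: val_sum_gt; first by rewrite val_NoneP // fmorph_eq0.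
move=> t tl; rewrite -mulrBr; have [->|ct] := eqVneq (c t) 0.
  by rewrite expr0n eqn0Ngt p_gt0 rmorph0 mul0r val0 vltNone val_NoneP // fmorph_eq0.
apply: (@vle_lt_trans _ (val_of (f (c t ^+ p * mon zeta l t)))).
  by rewrite ext_le; apply: lcomb_zeta_le.
rewrite rmorphM !val_mul ![vadd (val_of (f (_ ^+ _))) _]vaddC.
rewrite vlt_add2r; last by rewrite val_NoneP // fmorph_eq0 expf_neq0.
by rewrite rmorph_mon; apply: sim_mon => b /lX/wsim.
Qed.

Lemma lead_free : rfree p (range f) w X.
Proof.
move=> l c ul lX fc l0 t tl.
have /choice[d dP] u : exists a, f a = c u by have [a _ <-] := fc u; exists a.
rewrite -dP; apply/eqP; rewrite fmorph_eq0; apply/negPn/negP => dt.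
have : sim (f (lcomb p (fun t => d t ^+ p) zeta l)) (lcomb p (f \o d) w l ^+ p).
  by apply: lcomb_sim => //; exists t.
move=> /sim_neq0r; rewrite expf_eq0 p_gt0 /= (_ : lcomb p (f \o d) w l = 0) ?eqxx //.
by rewrite -[RHS]l0; apply: lcomb_eq => u _; apply: dP.
Qed.

End Family.

Lemma rs_lcomb (L : valuedField) (I : eqType) (c : seq nat -> L) (r : I -> L) l :
  (forall t, vle (Some 0) (val_of (c t))) -> (forall b, vle (Some 0) (val_of (r b))) ->
  vle (Some 0) (val_of (lcomb p c r l)) /\
  rs (lcomb p c r l) = lcomb p (fun t => rs (c t)) (fun b => rs (r b)) l.
Proof.
move=> c0 r0; have mon0 t : vle (Some 0) (val_of (mon r l t)) /\
    rs (mon r l t) = mon (fun b => rs (r b)) l t.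
  elim: l t => [|b l IH] [|k t] /=; rewrite ?val1 ?vle_refl ?rs1 //.
  have [h1 h2] := IH t; have h3 := vge0X k (r0 b); split; first exact: vge0M.
  by rewrite rsM // rsX // h2.
split; first by apply: val_sum_ge => t _; apply: vge0M => //; exact: (mon0 t).1.
rewrite rs_sum => [|t _]; last by apply: vge0M => //; exact: (mon0 t).1.
by apply: eq_bigr => t _; rewrite rsM ?(mon0 t).2 //; exact: (mon0 t).1.
Qed.

Lemma rs_pclosure_lift (Y : set (residue K)) a : Y `<=` vb2 W ->
  pclosure p (ppowers (residue K) p) Y a -> exists l (c : seq nat -> K),
  [/\ uniq l, forall b, b \in l -> Y b,
    vle (Some 0) (val_of (lcomb p (fun t => c t ^+ p) (vlift W \o inr) l)) &
    rs (lcomb p (fun t => c t ^+ p) (vlift W \o inr) l) = a].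
Proof.
move=> YW [l [c [ul lY Sc ->]]].
have /choice[d dP] t : exists d : K, vle (Some 0) (val_of d) /\ rs d ^+ p = c t.
  by have [a' _ <-] := Sc t; have [d d0 <-] := rs_onto a'; exists d.
(* Outside [l] the family is set to [0], since [rs_lcomb] asks every member to be integral. *)
exists l, d; pose r b := if b \in l then vlift W (inr b) else 0.
have r0 b : vle (Some 0) (val_of (r b)).
  rewrite /r; case: ifP => [/lY/YW Wb|_]; last by rewrite val0.
  by rewrite vlift2 ?vle_refl // (vb2_neq0 pK Wb).
have -> : lcomb p (fun t => d t ^+ p) (vlift W \o inr) l = lcomb p (fun t => d t ^+ p) r l.
  rewrite /lcomb big_seq [RHS]big_seq; apply: eq_bigr => t tl; congr (_ * _).
  have [h -> _] := exps_fun ul tl; rewrite !mon_prod big_seq [RHS]big_seq.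
  by apply: eq_bigr => b bl; rewrite /r bl.
have [|//|u0 uE] := @rs_lcomb K _ (fun t => d t ^+ p) r l.
  by move=> t; rewrite vge0X // (dP t).1.
split=> //; rewrite uE.
rewrite /lcomb big_seq [RHS]big_seq; apply: eq_bigr => t tl.
rewrite rsX ?(dP t).1 // (dP t).2; congr (_ * _).
have [h -> _] := exps_fun ul tl; rewrite !mon_prod big_seq [RHS]big_seq.
by apply: eq_bigr => b bl; rewrite /r bl vlift2_rs.
Qed.

Lemma redspan_lift_subring (X : set (vgroup K + residue K)) :
  is_subring (redspan p (ppowers K p) (vlift W) X).
Proof. exact: (pspan_subring pK (ppowers_pclosed pK)). Qed.

Lemma redspan_lift_gen (X : set (vgroup K + residue K)) b :
  X b -> redspan p (ppowers K p) (vlift W) X (vlift W b).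
Proof. exact: (pspan_gen pK (ppowers_pclosed pK)). Qed.

Lemma value_approx g : exists l (h : K), [/\ forall b, b \in l -> vb1 W b, h != 0 &
  val_of (\prod_(b <- l) vlift W (inl b) * h ^+ p) = Some g].
Proof.
have [l [h [lX ->]]] := vb1_span W g; have [y vy] := val_onto h.
exists l, y; split=> //; first by rewrite -val_eqNone vy.
rewrite val_mul (val_expn p vy).
have -> : val_of (\prod_(b <- l) vlift W (inl b)) = Some (\sum_(b <- l) b).
  elim: l {lX} => [|b l IH]; first by rewrite !big_nil val1.
  by rewrite !big_cons val_mul vlift1 IH.
by [].
Qed.

(** The value is matched by a product of value elements and a [p]-th power, then the residue of the
    quotient by a combination of residue elements. *)
Lemma approx_base a : a != 0 ->
  exists2 y, redspan p (ppowers K p) (vlift W) (vbset W) y & sim a y.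
Proof.
move=> a0; have [g va] := val_neq0 a0; have [l [h [lX h0 vb]]] := value_approx g.
set b := _ * _ in vb; have b0 : b != 0 by rewrite -val_eqNone vb.
have Rb : redspan p (ppowers K p) (vlift W) (vbset W) b.
  apply: (sr_M (redspan_lift_subring _)); last first.
    by apply: redspanC; exists h.
  rewrite big_seq; elim/big_ind: _ => [|y z Ry Rz|c /lX Wc].
  - exact: (sr_1 (redspan_lift_subring _)).
  - exact: (sr_M (redspan_lift_subring _)).
  - exact: (@redspan_lift_gen (vbset W) (inl c)).
have vab : val_of (a / b) = Some 0.
  have := val_div a b0; rewrite vb va; case: (val_of (a / b)) => //= y [].
  by move=> /eqP; rewrite -subr_eq0 addrK => /eqP ->.
have [l2 [c [ul2 lX2 u0 ru]]] := @rs_pclosure_lift _ (rs (a / b)) (fun _ h => h) (vb2_span W _).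
set u := lcomb _ _ _ _ in u0 ru.
have Ru : redspan p (ppowers K p) (vlift W) (vbset W) u.
  exists (map inr l2), (fun t => c t ^+ p); split.
  - by rewrite map_inj_uniq // => ? ? [].
  - by move=> _ /mapP[x /lX2 Wx ->].
  - by move=> t; exists (c t).
  - by rewrite /u lcomb_comp.
exists (b * u); first exact: (sr_M (redspan_lift_subring _)).
rewrite -(divfK b0 a) mulrC; apply: sim_mul; first exact: sim_refl.
rewrite /sim vab.
by rewrite -rs_eq ?vab ?vle_refl // ru.
Qed.

End LeadingTerms.

(** * Series with a common sequence of terms *)

(** Both sides are the coefficient of degree [i] of [X^n], written on the left as its Lagrange
    interpolant at the [i + 1] nodes. *)
Lemma lagrange_sum (F : fieldType) (c : nat -> F) i n : (n <= i)%N ->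
  (forall a b, (a <= i)%N -> (b <= i)%N -> c a = c b -> a = b) ->
  \sum_(a < i.+1) (\prod_(b < i.+1 | b != a) (c a - c b))^-1 * c a ^+ n = (n == i)%:R.
Proof.
move=> ni cinj; pose l a : F := (\prod_(b < i.+1 | b != a :> nat) (c a - c b))^-1.
pose L (a : nat) : {poly F} := \prod_(b < i.+1 | b != a :> nat) ('X - (c b)%:P).
pose q := \sum_(a < i.+1) (l a * c a ^+ n) *: L a.
have cneq (a b : 'I_i.+1) : b != a -> c a - c b != 0.
  rewrite subr_eq0; apply: contraNneq => /cinj H; apply/eqP/val_inj/esym/H.
    by rewrite -ltnS. by rewrite -ltnS.
have Lother (a b : 'I_i.+1) : b != a -> (L b).[c a] = 0.
  by move=> ba; rewrite horner_prod (bigD1 a) 1?eq_sym //= hornerXsubC subrr mul0r.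
have Lself (a : 'I_i.+1) : l a * (L a).[c a] = 1.
  rewrite horner_prod /l; under [X in _ * X]eq_bigr do rewrite hornerXsubC.
  by rewrite mulVf //; apply/prodf_neq0 => b ba; apply: cneq.
have Lmonic a : L a \is monic by apply: monic_prod => b _; apply: monicXsubC.
have sL (a : 'I_i.+1) : size (L a) = i.+1.
  rewrite /L -big_filter size_prod_XsubC; congr _.+1.
  transitivity #|predC1 a|; last by rewrite cardC1 card_ord.
  rewrite -[LHS]sum1_size big_filter -sum1_card; apply: eq_bigl => b.
  by rewrite !inE.
have qX : q = 'X^n.
  apply/eqP; rewrite -subr_eq0; apply/negPn/negP => qX0.
  have := max_poly_roots qX0 (rs := [seq c (val a) | a <- enum 'I_i.+1]).
  rewrite size_map size_enum_ord map_inj_uniq ?enum_uniq; last first.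
    by move=> a b E; apply/val_inj/cinj => //; rewrite -ltnS; exact: ltn_ord.
  have -> : all (root (q - 'X^n)) [seq c (val a) | a <- enum 'I_i.+1].
    apply/allP => _ /mapP[a _ ->]; rewrite /root hornerD hornerN hornerXn subr_eq0.
    rewrite /q horner_sum (bigD1 a) //= big1 ?addr0 => [|b ba].
      by rewrite hornerZ mulrAC Lself mul1r.
    by rewrite hornerZ Lother ?mulr0.
  move=> /(_ isT isT); rewrite ltnNge => /negP; apply.
  apply: leq_trans (size_polyD _ _) _; rewrite size_polyN size_polyXn geq_max ltnS ni andbT.
  apply: leq_trans (size_sum _ _ _) _; apply/bigmax_leqP => a _.
  by apply: leq_trans (size_scale_leq _ _) _; rewrite sL.
have := congr1 (fun h : {poly F} => h`_i) qX; rewrite /= coefXn eq_sym => <-.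
rewrite /q coef_sum; apply: eq_bigr => a _; rewrite coefZ.
have -> : (L a)`_i = 1; last by rewrite mulr1.
by have /monicP := Lmonic a; rewrite lead_coefE sL.
Qed.

(* The terms of index less than [m] have free coefficients [k]; those of index
   between [m] and [m + i] are eliminated. *)
Lemma vandermonde_elim (K N : valuedField) (f : valuedExt K N) (s : nat)
    (c : nat -> K) (u z : nat -> N) :
  (forall a, (a < s)%N -> vlt (Some 0) (val_of (c a)) /\ c a != 0) ->
  (forall a b, (a < s)%N -> (b < s)%N -> a != b ->
     c a != c b /\ vle (val_of (c a - c b)) (val_of (c a))) ->
  (forall a P, (a < s)%N -> vle (val_of (f (c a) ^+ P * u P))
     (val_of (z a - \sum_(n < P) f (c a) ^+ n * u n))) ->
  forall i m, (i < s)%N -> exists lam k : nat -> K, [/\ forall a, (a <= i)%N -> lam a != 0 &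
    vle (val_of (u (m + i).+1)) (val_of (\sum_(a < i.+1) f (lam a) * z a
      - \sum_(n < m) f (k n) * u n - u (m + i)%N))].
Proof.
move=> cpos cdis zlim i m si.
pose l a := (\prod_(b < i.+1 | b != a :> nat) (c a - c b))^-1.
(* Lagrange weights divided by [c a ^+ m]: the combined coefficients of the terms [m] to [m + i]
   become [0], except for a [1] at the last. *)
pose lam a := l a * c a ^- m; pose k n := \sum_(a < i.+1) lam a * c a ^+ n.
have lt_s a : (a <= i)%N -> (a < s)%N by move=> ai; apply: leq_ltn_trans si.
have c0 a : (a <= i)%N -> c a != 0 by move=> /lt_s/cpos[].
have cab a b : (a <= i)%N -> (b <= i)%N -> b != a -> c a - c b != 0.
  by move=> /lt_s ai /lt_s bi ba; rewrite subr_eq0; have [] := cdis a b ai bi; rewrite 1?eq_sym.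
have cinj a b : (a <= i)%N -> (b <= i)%N -> c a = c b -> a = b.
  move=> ai bi /eqP; rewrite -subr_eq0; apply: contraTeq => ab; apply: cab => //.
  by rewrite eq_sym.
have ile (a : 'I_i.+1) : (a <= i)%N by rewrite -ltnS.
exists lam, k; split=> [a ai|].
  rewrite mulf_neq0 ?invr_neq0 ?expf_neq0 ?c0 //.
  by apply/prodf_neq0 => b ba; apply: cab.
pose T a := z a - \sum_(n < (m + i).+1) f (c a) ^+ n * u n.
have kE j : (j <= i)%N -> k (m + j)%N = (j == i)%:R.
  move=> ji; rewrite -(lagrange_sum ji cinj); apply: eq_bigr => a _.
  by rewrite /lam exprD mulrA mulfVK // expf_neq0 ?c0.
have -> : \sum_(a < i.+1) f (lam a) * z a - \sum_(n < m) f (k n) * u n - u (m + i)%N =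
    \sum_(a < i.+1) f (lam a) * T a.
  have zE a : z a = T a + \sum_(n < (m + i).+1) f (c a) ^+ n * u n by rewrite subrK.
  under eq_bigr do rewrite zE mulrDr.
  rewrite big_split /= -!addrA -[RHS]addr0; congr (_ + _).
  have -> : \sum_(a < i.+1) f (lam a) * (\sum_(n < (m + i).+1) f (c a) ^+ n * u n) =
      \sum_(n < (m + i).+1) f (k n) * u n.
    under eq_bigr do rewrite big_distrr; rewrite exchange_big; apply: eq_bigr => n _.
    rewrite /k rmorph_sum big_distrl; apply: eq_bigr => a _ /=.
    by rewrite (rmorphM f (lam a)) rmorphXn mulrA.
  rewrite -addnS big_split_ord /= big_ord_recr /= kE // eqxx rmorph1 mul1r.
  rewrite [X in _ + (X + _) + _]big1 ?add0r => [|j _].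
    by rewrite -opprD subrr.
  by rewrite kE 1?ltnW // ltn_eqF // rmorph0 mul0r.
(* The tails are multiplied by [lam a * c a ^+ (m + i).+1], which is integral: of its [i + 1]
   factors [c a], [i] pay for the denominators [c a - c b] and one is left over. *)
apply: val_sum_ge => a _; have cT := zlim a (m + i).+1 (lt_s _ (ile a)).
rewrite val_mul; apply: vle_trans (vleD (vle_refl _) cT).
rewrite -!val_mul mulrA val_mul -rmorphXn -rmorphM.
suff /vleD/(_ (vle_refl (val_of (u (m + i).+1)))) : vle (Some 0)
    (val_of (f (lam a * c a ^+ (m + i).+1))).
  by move=> h; apply: vle_trans h; case: (val_of (u _)) => //= g; rewrite add0r lexx.
rewrite ext_ge0 /lam -addnS exprD mulrA mulfVK ?expf_neq0 ?c0 //.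
have -> : c a ^+ i.+1 = c a * \prod_(b < i.+1 | b != a) c a.
  by rewrite exprS prodr_const cardC1 card_ord.
rewrite mulrCA; apply: vge0M; first by have [/vltW] := cpos a (lt_s _ (ile a)).
rewrite /l -prodfV -big_split; apply: (big_ind (fun x => vle (Some 0) (val_of x))) => [|x y|b ba].
- by rewrite val1 /= lexx.
- exact: vge0M.
have ab : val a != val b by rewrite eq_sym.
have [_ h] := cdis a b (lt_s _ (ile a)) (lt_s _ (ile b)) ab.
have d0 := cab a b (ile a) (ile b) ba.
suff: vle (Some 0) (val_of ((c a - c b)^-1 * c a)) by [].
rewrite -(@vle_add2r _ (val_of (c a - c b))) ?val_NoneP // -val_mul mulrAC mulVf // mul1r.
by case: (val_of (c a - c b)) h => //= g; rewrite add0r.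
Qed.

(** * Valued subfields *)

Section SubValued.
Variables (N : valuedField) (S : set N) (hS : is_subfield S).
Variables (G : oagType) (h : {additive G -> vgroup N}).
Hypothesis h_mono : {mono h : x y / x <= y}.
Hypothesis h_in : forall x, S x -> x != 0 -> exists g, val_of x = Some (h g).
Hypothesis h_on : forall g, exists2 x, S x & val_of x = Some (h g).

Definition sub_val (x : sftype hS) : option G :=
  xget None [set a | omap h a = val_of (sf_val x)].

Lemma sub_valE x : omap h (sub_val x) = val_of (sf_val x).
Proof.
rewrite /sub_val; case: xgetP => // H; exfalso.
have [x0|x0] := eqVneq (sf_val x) 0; first by apply: (H None); rewrite x0 /= val0.
by have [g vx] := h_in (sf_valP x) x0; apply: (H (Some g)).
Qed.

Lemma omap_h_le a b : vle (omap h a) (omap h b) = vle a b.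
Proof. by case: a b => [x|] [y|] //=; rewrite h_mono. Qed.

Lemma omap_h_inj : injective (omap h).
Proof. by move=> a b E; apply: vle_anti; rewrite -omap_h_le E vle_refl. Qed.

Lemma sub_val_eqNone x : (sub_val x == None) = (x == 0).
Proof.
transitivity (sf_val x == 0); last by rewrite -[0]/(sf_val (0 : sftype hS)) (inj_eq val_inj).
by rewrite -val_eqNone -sub_valE; case: (sub_val x).
Qed.

Lemma sub_val_mul x y : sub_val (x * y) = vadd (sub_val x) (sub_val y).
Proof.
apply: omap_h_inj; rewrite sub_valE /= val_mul -!sub_valE.
by case: (sub_val x) (sub_val y) => [a|] [b|] //=; rewrite raddfD.
Qed.

Lemma sub_val_add x y :
  vle (sub_val x) (sub_val (x + y)) || vle (sub_val y) (sub_val (x + y)).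
Proof. by rewrite -!omap_h_le !sub_valE val_add. Qed.

Lemma sub_val_onto g : exists x, sub_val x = Some g.
Proof.
have [x Sx vx] := h_on g; have [y yx] := sf_ex hS Sx; exists y.
by apply: omap_h_inj; rewrite sub_valE yx vx.
Qed.

(** The value group may be any [G] embedded in that of [N]. For the towers it is [vK] itself,
    embedded as [(1/p)vK] or as [vK], so that its values need no transport. *)
Definition subVF := ValuedField sub_val_eqNone sub_val_mul sub_val_add sub_val_onto.

Lemma sub_extE (x : subVF) : val_of (sf_morph hS x) = omap (h : vgroup subVF -> _) (val_of x).
Proof. by rewrite [val_of x in RHS]/= sub_valE. Qed.

Definition sub_ext : valuedExt subVF N := @ValuedExt subVF N (sf_morph hS) h h_mono sub_extE.

Section Lift.
Variables (K : valuedField) (f : valuedExt K N) (e : {additive vgroup K -> G}).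
Hypothesis he : forall g, h (e g) = ext_val f g.
Hypothesis fS : forall x, S (f x).

Definition lift_fun (x : K) : sftype hS := @Sftype _ _ hS (f x) (asboolT (fS x)).

Lemma lift_zmod : zmod_morphism lift_fun.
Proof. by move=> x y; apply: val_inj; rewrite /= rmorphB. Qed.

Lemma lift_monoid : monoid_morphism lift_fun.
Proof. by split=> [|x y]; apply: val_inj; rewrite /= ?rmorph1 ?rmorphM. Qed.

HB.instance Definition _ := GRing.isZmodMorphism.Build K (sftype hS) lift_fun lift_zmod.
HB.instance Definition _ :=
  GRing.isMonoidMorphism.Build K (sftype hS) lift_fun lift_monoid.

Lemma lift_mono : {mono e : x y / x <= y}.
Proof. by move=> x y; rewrite -h_mono !he ext_val_mono. Qed.

Lemma lift_valE x : @val_of subVF (lift_fun x) = omap e (val_of x).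
Proof.
apply: omap_h_inj; rewrite [val_of _ in LHS]/= sub_valE /= ext_valE.
by case: (val_of x) => //= g; rewrite he.
Qed.

Definition lift_ext : valuedExt K subVF :=
  @ValuedExt K subVF lift_fun e lift_mono lift_valE.

End Lift.
End SubValued.

(** * Limits of series *)

(** One condition for two settings: a spherically complete [M] has limits for every [C], a complete
    one if [C] is cofinal, the partial sums being Cauchy in that case. *)
Definition has_limits (K M : valuedField) (f : valuedExt K M) (C : nat -> vgroup K) : Prop :=
  forall s : nat -> M, (forall n, vlt (val_of (s n)) (val_of (s n.+1))) ->
  (forall n, vlt (Some (ext_val f (C n))) (val_of (s n.+1))) ->
  exists z, forall P, vle (val_of (s P)) (val_of (z - \sum_(n < P) s n)).

Lemma increasing_le (M : valuedField) (s : nat -> M) m n :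
  (forall n, vlt (val_of (s n)) (val_of (s n.+1))) -> (m <= n)%N ->
  vle (val_of (s m)) (val_of (s n)).
Proof.
move=> sinc /subnKC <-; elim: (n - m)%N => [|k IH]; first by rewrite addn0 vle_refl.
by rewrite addnS; apply: vle_trans IH (vltW (sinc _)).
Qed.

Lemma partial_sum_le (M : valuedField) (s : nat -> M) m n :
  (forall n, vlt (val_of (s n)) (val_of (s n.+1))) -> (m <= n)%N ->
  vle (val_of (s m)) (val_of (\sum_(k < n) s k - \sum_(k < m) s k)).
Proof.
move=> sinc mn; rewrite -!(big_mkord xpredT s) (@big_cat_nat _ _ _ m 0 n) //= addrAC subrr add0r.
by rewrite big_nat; apply: val_sum_ge => k /andP[mk _]; apply: increasing_le.
Qed.

Lemma sph_has_limits (K M : valuedField) (f : valuedExt K M) C :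
  sph_complete M -> has_limits f C.
Proof.
move=> hM s sinc _; pose B P := [set z | vle (val_of (s P)) (val_of (z - \sum_(n < P) s n))].
have BP m n : (m <= n)%N -> B n `<=` B m.
  move=> mn z zn; rewrite /B /= -[z - _](subrKA (\sum_(k < n) s k)).
  by apply: val_add_ge (partial_sum_le sinc mn); exact: vle_trans (increasing_le sinc mn) zn.
have Bgood A : range B A -> vball A /\ A !=set0.
  move=> [P _ <-]; split; last by exists (\sum_(n < P) s n); rewrite /B /= subrr val0 vle_None.
  move=> x y z Bx By le; rewrite /B /= -[z - _](subrKA x); apply: val_add_ge => //.
  apply: vle_trans le; rewrite -[y - x](subrKA (\sum_(n < P) s n)).
  by apply: val_add_ge => //; rewrite valBC.
have Bchain A A' : range B A -> range B A' -> A `<=` A' \/ A' `<=` A.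
  move=> [m _ <-] [n _ <-]; have /orP[mn|nm] := leq_total m n; [right|left]; exact: BP.
have [z zB] := hM (range B) Bgood Bchain.
by exists z => P; apply: (zB (B P)); exists P.
Qed.

Lemma complete_has_limits (K M : valuedField) (f : valuedExt K M) C :
  val_complete M -> (forall g, exists n, g <= ext_val f (C n)) -> has_limits f C.
Proof.
move=> hM Ccof s sinc sC.
pose F : set_system M := [set A | exists n, forall m, (n <= m)%N -> A (\sum_(k < m) s k)].
have Fp : ProperFilter F.
  split; first by move=> [n /(_ n (leqnn n))].
  split; first by exists 0%N.
    move=> P Q [m mP] [n nQ]; exists (maxn m n) => k; rewrite geq_max => /andP[mk nk].
    by split; [apply: mP|apply: nQ].
  by move=> P Q PQ [m mP]; exists m => k /mP/PQ.
have ge g : exists n, vlt (Some g) (val_of (s n)).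
  by have [n gn] := Ccof g; exists n.+1; apply: vle_lt_trans (sC n).
have [|z zF] := hM F Fp.
  move=> g; have [n gn] := ge g.
  exists [set x | exists2 m, (n <= m)%N & x = \sum_(k < m) s k].
    by exists n => m nm; exists m.
  have H m m' : (n <= m)%N -> (m <= m')%N ->
      vlt (Some g) (val_of (\sum_(k < m') s k - \sum_(k < m) s k)).
    move=> nm mm'; apply: vlt_le_trans (partial_sum_le sinc mm').
    exact: vlt_le_trans gn (increasing_le sinc nm).
  move=> _ _ [m nm ->] [m' nm' ->]; rewrite /val_ball /=.
  have /orP[mm'|mm'] := leq_total m m'; first exact: H.
  by rewrite valBC; apply: H.
exists z => P; case vP: (val_of (s P)) => [g|]; last first.
  by have := sinc P; rewrite vP vlt_None.
have [n nz] := zF g; pose m := maxn n P.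
rewrite -[z - _](subrKA (\sum_(k < m) s k)); apply: val_add_ge.
  by rewrite valBC; apply: vltW; apply: (nz m); rewrite leq_maxl.
by rewrite -vP; apply: partial_sum_le; rewrite // leq_maxr.
Qed.

(** Powers of [c] only raise values, by amounts growing with [n], so the scaled terms still increase
    and still exceed the bounds. *)
Lemma power_series_limit (K N : valuedField) (f : valuedExt K N) C (c : K) (s : nat -> N) :
  has_limits f C -> vlt (Some 0) (val_of c) /\ c != 0 ->
  (forall n, vlt (val_of (s n)) (val_of (s n.+1))) ->
  (forall n, vlt (Some (ext_val f (C n))) (val_of (s n.+1))) ->
  exists z, forall P,
    vle (val_of (f c ^+ P * s P)) (val_of (z - \sum_(n < P) f c ^+ n * s n)).
Proof.
move=> hlim [cp c0] s_inc sC; have ic0 : vlt (Some 0) (val_of (f c)).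
  by have := ext_val_lt f (Some 0) (val_of c); rewrite ext_valE /= raddf0 => ->.
have icn n : vle (Some 0) (val_of (f c ^+ n)) by apply: vge0X; apply: vltW.
have icle n : vle (val_of (s n)) (val_of (f c ^+ n * s n)).
  rewrite val_mul; have := vleD (icn n) (vle_refl (val_of (s n))).
  by case: (val_of (s n)) => //= g; rewrite add0r.
have [||z zP] := hlim (fun n => f c ^+ n * s n); last by exists z.
  move=> n; apply: (@vle_lt_trans _ (val_of (f c ^+ n.+1 * s n))); last first.
    rewrite val_mul [X in vlt _ X]val_mul vaddC [X in vlt _ X]vaddC vlt_add2r.
      exact: s_inc.
    by rewrite val_NoneP // expf_neq0 ?fmorph_eq0.
  rewrite exprS -mulrA [X in vle _ X]val_mul.
  have := vleD (vltW ic0) (vle_refl (val_of (f c ^+ n * s n))).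
  by case: (val_of (_ * s n)) => //= g; rewrite add0r.
by move=> n; apply: vlt_le_trans (icle _).
Qed.

Definition cofinal_ext (K N : valuedField) (f : valuedExt K N) : Prop :=
  forall g, exists2 d, d != 0 & vlt (Some g) (val_of (f d)).

Lemma positive_ex (G : oagType) : (exists g : G, g != 0) ->
  exists g : G, vlt (Some 0) (Some g).
Proof.
move=> [g g0]; have /orP[le|le] := oag_total g 0; [exists (- g)|exists g].
  rewrite /vlt /=; apply: contra g0 => le'; rewrite eq_le le /=.
  by have := oag_leD2r g le'; rewrite addNr add0r.
by rewrite /vlt /=; apply: contra g0 => le'; rewrite eq_le le le'.
Qed.

Lemma cofinal_of_values (K L : valuedField) (j : valuedExt K L) : nontrivial_valuation K ->
  (forall g, exists a, g <= ext_val j a) -> cofinal_ext j.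
Proof.
move=> /positive_ex[b b0] H g; have [a ga] := H g.
have [d vd] := val_onto (a + b); exists d; first by rewrite -val_eqNone vd.
rewrite ext_valE vd /= raddfD; apply: (@vle_lt_trans _ (Some (ext_val j a))) => //.
have := @vlt_add2r _ (Some (ext_val j a)) (Some 0) (Some (ext_val j b)) isT.
rewrite /= add0r addrC => ->.
by have := ext_val_lt j (Some 0) (Some b); rewrite /= raddf0 => ->.
Qed.

Lemma oag_max_ex (G : oagType) (l : seq G) : exists g, forall x, x \in l -> x <= g.
Proof.
elim: l => [|a l [g gP]]; first by exists 0.
have /orP[ag|ga] := oag_total a g; [exists g|exists a] => x.
  by rewrite inE => /predU1P[->|/gP].
by rewrite inE => /predU1P[->|/gP/le_trans]; [rewrite lexx|apply].
Qed.

Lemma cofinal_mul (K N : valuedField) (f : valuedExt K N) (u : N) g :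
  cofinal_ext f -> u != 0 -> exists2 d, d != 0 & vlt (Some g) (val_of (f d * u)).
Proof.
move=> fcof u0; have [a vu] := val_neq0 u0; have [d d0 vd] := fcof (g - a).
exists d => //; rewrite val_mul.
rewrite (_ : Some g = vadd (Some (g - a)) (val_of u)); last by rewrite vu /= subrK.
by rewrite vlt_add2r ?val_NoneP.
Qed.

(* The bound on the [n]-th scaled term may depend on the previous scalar. *)
Lemma fast_seq (K N : valuedField) (f : valuedExt K N) (u : nat -> N)
    (bound : nat -> K -> vgroup N) : cofinal_ext f -> (forall n, u n != 0) ->
  exists D : nat -> K, (forall n, D n != 0) /\
    forall n, vlt (Some (bound n (D n))) (val_of (f (D n.+1) * u n.+1)).
Proof.
move=> fcof u0.
have /choice[Phi PhiP] (x : nat * K) : exists d : K, d != 0 /\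
    vlt (Some (bound x.1 x.2)) (val_of (f d * u x.1.+1)).
  by have [d ? ?] := cofinal_mul (bound x.1 x.2) fcof (u0 x.1.+1); exists d.
pose D := nat_rect (fun=> K) 1 (fun n d => Phi (n, d)).
exists D; split=> [[|n]|n] /=; first exact: oner_neq0.
  by case: (PhiP (n, D n)).
by case: (PhiP (n, D n)).
Qed.

(** * The field of p-th roots *)

Section PthRoots.
Variables (K : valuedField) (p : nat) (pK : p \in [pchar K]) (W : vbasis K p).
Variables (E : valuedField) (i : valuedExt K E) (hE : is_pth_roots p i).
Let p_prime : prime p := pcharf_prime pK.
Let p_gt1 : (1 < p)%N := prime_gt1 p_prime.
Let p_gt0 : (0 < p)%N := prime_gt0 p_prime.
Let pE : p \in [pchar E] := ext_pchar pK i.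

Lemma val_pth (y : E) x g a : y ^+ p = i x -> val_of y = Some g -> val_of x = Some a ->
  g *+ p = ext_val i a.
Proof. by move=> yx vy vx; have := val_expn p vy; rewrite yx ext_valE vx => -[]. Qed.

Lemma pth_value (g : vgroup E) : exists a, g *+ p = ext_val i a.
Proof.
have [y vy] := val_onto g; have [x yx] := hE.2 y.
have [|a va] := @val_neq0 _ x.
  rewrite -(fmorph_eq0 i) -yx expf_neq0 //.
  by rewrite -val_eqNone vy.
by exists a; apply: val_pth yx vy va.
Qed.

Lemma pth_cofinal_value (g : vgroup E) : exists a, g <= ext_val i a.
Proof.
have /orP[g0|g0] := oag_total g 0; first by exists 0; rewrite raddf0.
have [a ga] := pth_value g; exists a; rewrite -ga.
rewrite -(prednK p_gt0) mulrS -{1}[g]addr0; apply: oag_leD2l.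
by rewrite -(mul0rn _ p.-1); apply: oag_leMn.
Qed.

Lemma pth_cofinal : nontrivial_valuation K -> cofinal_ext i.
Proof. by move/cofinal_of_values; apply; apply: pth_cofinal_value. Qed.

Lemma sim_root (x y : E) : sim (x ^+ p) (y ^+ p) -> sim x y.
Proof.
rewrite /sim (_ : x ^+ p - y ^+ p = (x - y) ^+ p) ?val_exp_ltE //.
by rewrite -!(pFrobenius_autE pE) rmorphB.
Qed.

Variable xi : vgroup K + residue K -> E.
Hypothesis xiP : forall b, xi b ^+ p = i (vlift W b).

Lemma xi_neq0 b : vbset W b -> xi b != 0.
Proof.
move=> Wb; have := xiP b; apply: contra_eq_neq => ->; rewrite expr0n eqn0Ngt p_gt0 eq_sym.
by rewrite fmorph_eq0 (vlift_neq0 pK).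
Qed.

Lemma range_pclosed : pclosed p (range i).
Proof.
split; first exact: range_is_subfield.
by move=> y; have [x ->] := hE.2 y; exists x.
Qed.

Definition Lxi X := redspan p (range i) xi X.

Lemma Lxi_pclosed X : pclosed p (Lxi X).
Proof.
split; last by move=> y; apply: redspanC; apply: range_pclosed.2.
exact: (pspan_subring pE range_pclosed).
Qed.

Lemma Lxi_range X x : Lxi X (i x).
Proof. by apply: redspanC; exists x. Qed.

Lemma Lxi_gen (X : set (vgroup K + residue K)) b : X b -> Lxi X (xi b).
Proof. exact: (pspan_gen pE range_pclosed). Qed.

Lemma lcomb_pth (J : eqType) (beta : J -> vgroup K + residue K) (d : seq nat -> K) l :
  lcomb p (i \o d) (xi \o beta) l ^+ p =
  i (lcomb p (fun t => d t ^+ p) (vlift W \o beta) l).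
Proof.
rewrite -(pFrobenius_autE pE) /lcomb !rmorph_sum; apply: eq_bigr => t _ /=.
rewrite pFrobenius_autE exprMn rmorphM rmorphXn; congr (_ * _).
by elim: l t => [|b l IH] [|k t] /=; rewrite ?expr1n ?rmorph1 // exprMn IH exprAC xiP rmorphM rmorphXn.
Qed.

(** This is why [E] is immediate over the field generated by the [xi b]: Frobenius carries the
    question to [approx_base] in [K] and reflects leading terms. *)
Lemma approx_pth y : y != 0 -> exists2 y0, Lxi (vbset W) y0 & sim y y0.
Proof.
move=> y0; have [x yx] := hE.2 y.
have x0 : x != 0 by rewrite -(fmorph_eq0 i) -yx expf_neq0.
have [_ [l [c [ul lW Sc ->]]] xc] := approx_base pK W x0.
have /choice[d dP] t : exists d, d ^+ p = c t by have [d _ <-] := Sc t; exists d.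
exists (lcomb p (i \o d) xi l).
  by exists l, (i \o d); split=> // t; exists (d t).
apply: sim_root; rewrite yx (lcomb_pth id) ext_sim.
by rewrite (_ : lcomb _ _ _ _ = lcomb p c (vlift W) l) //; apply: lcomb_eq => t _; apply: dP.
Qed.

Lemma xi_free (e : vgroup K + residue K -> K) (w : vgroup K + residue K -> E) :
  (forall b, e b != 0) -> (forall b, vbset W b -> sim (w b) (i (e b) * xi b)) ->
  rfree p (range i) w (vbset W).
Proof.
move=> e0 wsim; apply: (@lead_free K p pK W E i _ id e) => // b Wb.
by rewrite rmorphM rmorphXn -xiP -exprMn; apply/sim_exp/sim_sym/wsim.
Qed.

(* The hypotheses on [c] say that its values have pairwise distinct leading terms. *)
Section Series.
Variables (T : Type) (kappa : set T) (c : T -> K).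
Hypothesis c_pos : forall a, kappa a -> vlt (Some 0) (val_of (c a)) /\ c a != 0.
Hypothesis c_dis : forall a b, kappa a -> kappa b -> a <> b ->
  c a != c b /\ vle (val_of (c a - c b)) (val_of (c a)).

Variables (beta : nat -> vgroup K + residue K).
Hypothesis beta_inj : injective beta.
Hypothesis betaW : forall n, vbset W (beta n).

Variables (D : nat -> K) (t : {classic T} -> E).
Hypothesis D_neq0 : forall n, D n != 0.
Let s n := i (D n) * xi (beta n).
Hypothesis s_inc : forall n, vlt (val_of (s n)) (val_of (s n.+1)).
Hypothesis t_lim : forall a P, kappa a ->
  vle (val_of (i (c a) ^+ P * s P)) (val_of (t a - \sum_(n < P) i (c a) ^+ n * s n)).

(** An equation for [t a] over other limits has coefficients involving finitely many [xi b]. Farther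
    out, Vandermonde combinations replace some of the [xi (beta n)] up to scalars without changing
    leading terms, so the new family [w] is still free. But its members other than the last
    combination would generate [t a], hence that combination as well. *)
Lemma series_free : rfree p (Lxi (vbset W)) t kappa.
Proof.
apply: (rfree_of_notin pE (Lxi_pclosed _)) => a l ual lk [l' [cf [ul' l'l Lcf ta]]].
have [F [uF FW cfF]] := redspan_common (exps p (size l')) Lcf.
have [N0 N0P] : exists N0, forall n, (N0 <= n)%N -> beta n \notin F.
  elim: (F) => [|b F' [N0 N0P]]; first by exists 0%N.
  have [[n bn]|nb] := EM (exists n, beta n = b).
    exists (maxn N0 n.+1) => m; rewrite geq_max => /andP[m0 mn].
    by rewrite inE negb_or N0P // andbT -bn (inj_eq beta_inj) neq_ltn mn orbT.
  exists N0 => m /N0P; rewrite inE negb_or => ->; rewrite andbT.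
  by apply/eqP => mb; apply: nb; exists m.
(* [a] comes last, so that [t a] enters only the last combination. *)
pose pts : seq {classic T} := rcons l a; pose sz := size pts.
have upts : uniq pts by rewrite rcons_uniq.
have kpts j : (j < sz)%N -> kappa (nth a pts j).
  by move=> jsz; apply: lk; rewrite -mem_rcons mem_nth.
pose z j := t (nth a pts j); pose c' j := c (nth a pts j).
have kz j : (j < sz)%N -> z j = t (nth a pts j) by [].
have /choice[lk' lkP] j : exists lk : (nat -> K) * (nat -> K), (j < sz)%N ->
    (forall b, (b <= j)%N -> lk.1 b != 0) /\
    vle (val_of (s (N0 + j).+1)) (val_of (\sum_(b < j.+1) i (lk.1 b) * z b
      - \sum_(n < N0) i (lk.2 n) * s n - s (N0 + j)%N)).
  have [jsz|_] := ltnP j sz; last by exists (fun=> 0, fun=> 0).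
  have [||| lam [k [lam0 kP]]] := @vandermonde_elim K E i sz c' s z _ _ _ j N0 jsz.
  - by move=> b /kpts/c_pos.
  - move=> b b' bs bs' bb'; apply: c_dis; try exact: kpts.
    by move=> Ebb; move: bb'; rewrite -(nth_uniq a bs bs' upts) => /eqP; apply.
  - by move=> b P /kpts; apply: t_lim.
  by exists (lam, k).
pose Wj j := \sum_(b < j.+1) i ((lk' j).1 b) * z b - \sum_(n < N0) i ((lk' j).2 n) * s n.
have Wsim j : (j < sz)%N -> sim (s (N0 + j)%N) (Wj j).
  by move=> /lkP[_ H]; rewrite /sim valBC; apply: vlt_le_trans H; apply: s_inc.
pose w b := if [pick j : 'I_sz | b == beta (N0 + j)%N] is Some j then Wj j else xi b.
pose e b := if [pick j : 'I_sz | b == beta (N0 + j)%N] is Some j then D (N0 + j)%N else 1.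
have e0 b : e b != 0 by rewrite /e; case: pickP => [j _|_]; rewrite ?oner_neq0.
have wsim b : vbset W b -> sim (w b) (i (e b) * xi b).
  rewrite /w /e; case: pickP => [j /eqP -> _|_ Wb]; first exact/sim_sym/Wsim.
  rewrite rmorph1 mul1r; exact/sim_refl/xi_neq0.
have wfree := xi_free e0 wsim.
have wW j : (j < sz)%N -> w (beta (N0 + j)%N) = Wj j.
  move=> jsz; rewrite /w; case: pickP => [j' /eqP/beta_inj/addnI ->//|/(_ (Ordinal jsz))].
  by rewrite eqxx.
have wxi b : (forall n, (N0 <= n)%N -> b != beta n) -> w b = xi b.
  by move=> nb; rewrite /w; case: pickP => // j /eqP bE; case/eqP: (nb _ (leq_addr j N0)).
(* The indices of all members of [w] except the combination that involves [t a]. *)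
pose Y := [set b | vbset W b /\ b <> beta (N0 + size l)%N].
pose V := redspan p (range i) w Y.
have Vring : is_subring V := pspan_subring pE range_pclosed w Y.
have Vgen b : Y b -> V (w b) := @pspan_gen _ _ pE _ range_pclosed _ w Y b.
have VK x : V (i x) by apply: redspanC; exists x.
have ssz : sz = (size l).+1 by rewrite /sz size_rcons.
have Vs n : (n < N0)%N -> V (s n).
  move=> nN; apply: (sr_M Vring) => //; rewrite -wxi; last first.
    by move=> m Nm; rewrite (inj_eq beta_inj) neq_ltn (leq_trans nN).
  apply: Vgen; split=> // /beta_inj nE; by move: nN; rewrite nE ltnNge leq_addr.
have Vcf u : u \in exps p (size l') -> V (cf u).
  move=> /cfF; apply: redspan_min => // [x [y _ <-]//|b bF].
  have bN n : (N0 <= n)%N -> b != beta n.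
    by move=> /N0P; apply: contraNneq => <-.
  by rewrite -wxi //; apply: Vgen; split; [exact: FW|apply/eqP/bN; rewrite leq_addr].
have Vsum j : V (\sum_(n < N0) i ((lk' j).2 n) * s n).
  by apply: (sr_sum Vring) => n _; apply: (sr_M Vring) => //; apply: Vs.
(* The system is triangular: each limit is recovered from its combination and the earlier limits. *)
have Vz j : (j < size l)%N -> V (z j).
  elim/ltn_ind: j => j IH jl; have jsz : (j < sz)%N by rewrite ssz ltnW.
  have [lam0 _] := lkP j jsz.
  have -> : z j = i ((lk' j).1 j)^-1 * (Wj j + \sum_(n < N0) i ((lk' j).2 n) * s n -
      \sum_(b < j) i ((lk' j).1 b) * z b).
    rewrite /Wj subrK big_ord_recr /= addrAC subrr add0r fmorphV mulKf //.
    by rewrite fmorph_eq0 lam0.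
  apply: (sr_M Vring) => //; apply: (sr_B Vring).
    apply: (sr_D Vring) => //; rewrite -wW //; apply: Vgen; split=> // /beta_inj/addnI jE.
    by rewrite jE ltnn in jl.
  apply: (sr_sum Vring) => b _; apply: (sr_M Vring) => //.
  by apply: IH => //; apply: ltn_trans (ltn_ord b) jl.
have zl : z (size l) = t a by rewrite /z /pts nth_rcons ltnn eqxx.
have Vta : V (t a).
  rewrite ta; rewrite /lcomb big_seq; apply: (sr_sum Vring) => u ul.
  apply: (sr_M Vring); first exact: Vcf.
  have [q ql ->] := mon_seq t l' u; rewrite big_seq.
  elim/big_ind: _ => [|x y|b bq]; [exact: (sr_1 Vring)|exact: (sr_M Vring)|].
  have bl : b \in l by apply: (l'l b); apply: ql.
  have := Vz (index b l); rewrite index_mem bl => /(_ isT).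
  by rewrite /z /pts nth_rcons index_mem bl nth_index.
apply: (@rfree_notin p _ _ _ w p_gt1 range_pclosed.1 (vbset W) Y (beta (N0 + size l)) wfree) => //.
- by move=> b [].
- by case=> _.
rewrite wW ?ssz //; apply: (sr_B Vring) => //; apply: (sr_sum Vring) => b _.
apply: (sr_M Vring) => //; have := ltn_ord b; rewrite ltnS leq_eqVlt => /predU1P[->|].
  by rewrite zl.
exact: Vz.
Qed.

End Series.

Section Core.
Hypotheses (hK : nontrivial_valuation K) (sE : sph_complete E).
Variables (T : Type) (kappa : set T) (c : T -> K).
Hypothesis c_pos : forall a, kappa a -> vlt (Some 0) (val_of (c a)) /\ c a != 0.
Hypothesis c_dis : forall a b, kappa a -> kappa b -> a <> b ->
  c a != c b /\ vle (val_of (c a - c b)) (val_of (c a)).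
Hypothesis W_inf : infinite_set (vbset W).

Lemma fast_series (C : nat -> vgroup K) : exists (beta : nat -> vgroup K + residue K)
    (D : nat -> K), [/\ injective beta, forall n, vbset W (beta n), forall n, D n != 0 &
  forall n, vlt (val_of (i (D n) * xi (beta n))) (val_of (i (D n.+1) * xi (beta n.+1))) /\
    vlt (Some (ext_val i (C n))) (val_of (i (D n.+1) * xi (beta n.+1)))].
Proof.
have [beta [betaW beta_inj]] := infinite_inj_nat W_inf.
have xi0 n : xi (beta n) != 0 by apply: xi_neq0.
have /choice[bd bdP] (x : nat * K) : exists g : vgroup E,
    vle (Some (ext_val i (C x.1))) (Some g) /\
    (x.2 != 0 -> vle (val_of (i x.2 * xi (beta x.1))) (Some g)).
  case vs: (val_of (i x.2 * xi (beta x.1))) => [h|]; last first.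
    exists (ext_val i (C x.1)); split=> [|x0]; first exact: vle_refl.
    by move/val_None/eqP: vs; rewrite mulf_eq0 fmorph_eq0 (negbTE x0) (negbTE (xi0 _)).
  have [g gP] := oag_max_ex [:: ext_val i (C x.1); h].
  by exists g; split=> [|_]; rewrite /= gP // !inE eqxx ?orbT.
have [D [D0 DP]] := fast_seq (fun n d => bd (n, d)) (pth_cofinal hK) xi0.
exists beta, D; split=> // n; have [h1 h2] := bdP (n, D n).
by split; [apply: vle_lt_trans (h2 (D0 n)) (DP n)|apply: vle_lt_trans h1 (DP n)].
Qed.

Lemma alg_of_pth (F R : fieldType) (f : {rmorphism F -> R}) y x :
  y ^+ p = f x -> algebraicOver f y.
Proof.
move=> yx; exists ('X^p - x%:P); first by rewrite -size_poly_gt0 size_XnsubC.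
by rewrite /root rmorphB /= map_polyXn map_polyC !hornerE /= yx subrr.
Qed.

(** [J0] prescribes which limits are left out of [L]; the reduced monomials in them form a basis of
    [E] over [L]. A cofinal [C] puts these limits in the topological closure of [L]. *)
Lemma immediate_pth_subext (C : nat -> vgroup K) (J0 : set T) : J0 `<=` kappa ->
  exists (L : valuedField) (j : valuedExt K L) (k : valuedExt L E),
  [/\ forall x, k (j x) = i x, immediate k, algebraic_ext k,
    (forall n, J0 #= `I_n -> has_degree (range k) `I_(p ^ n)) /\
    (infinite_set J0 -> has_degree (range k) J0) &
    (forall g, exists n, g <= C n) -> forall y g, exists x, val_ball g y (k x)].
Proof.
move=> Jk; have [beta [D [beta_inj betaW D0 sP]]] := fast_series C.
pose s n := i (D n) * xi (beta n).
have s_inc n : vlt (val_of (s n)) (val_of (s n.+1)) by case: (sP n).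
have /choice[t tP] (a : {classic T}) : exists z : E, kappa a -> forall P,
    vle (val_of (i (c a) ^+ P * s P)) (val_of (z - \sum_(n < P) i (c a) ^+ n * s n)).
  have [ka|nka] := EM (kappa a); last by exists 0.
  have [n|z zP] := power_series_limit (@sph_has_limits K E i C sE) (c_pos ka) s_inc.
    by case: (sP n).
  by exists z.
have t_lim a P : kappa a ->
    vle (val_of (i (c a) ^+ P * s P)) (val_of (t a - \sum_(n < P) i (c a) ^+ n * s n)).
  by move=> /tP.
pose L0 := Lxi (vbset W); have L0p : pclosed p L0 := Lxi_pclosed _.
pose T0 := t @` J0.
have tfree : rfree p L0 t kappa.
  exact: (series_free c_pos c_dis beta_inj betaW D0 s_inc t_lim).
have T0free : pfree p L0 T0 := rfree_image tfree Jk.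
have [X [T0X Xfree Xall]] := pbasis_ex pE L0p T0free.
pose S := X `\` T0; pose Ls := pclosure p L0 S.
have Lsp : pclosed p Ls := pclosure_pclosed pE L0p S.
have Lsf : is_subfield Ls := pclosed_is_subfield pE Lsp.
have L0Ls : L0 `<=` Ls := @pclosure_base _ _ _ _.
have iLs x : Ls (i x) by apply/L0Ls/Lxi_range.
have T0free' : pfree p Ls T0.
  apply: (pfree_tower pE L0p) => [|x T0x []//].
  by apply: pfree_sub Xfree => x [/T0X|[]].
have T0all y : pclosure p Ls T0 y.
  apply: (pclosure_min (pclosure_subring pE Lsp T0) _ _ (Xall y)) => x.
    by move=> /L0Ls; apply: pclosure_base.
  move=> Xx; have [Tx|nTx] := EM (T0 x); first exact: (pclosure_gen pE Lsp).
  by apply: pclosure_base; apply: (pclosure_gen pE L0p).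
have h_in x : Ls x -> x != 0 -> exists g, val_of x = Some (idfun g : vgroup E).
  by move=> _ /val_neq0[g vx]; exists g.
have h_on g : exists2 x, Ls x & val_of x = Some (idfun g : vgroup E).
  have [y vy] := val_onto g.
  have [|y0 Ly0 /sim_val vy0] := @approx_pth y; first by rewrite -val_eqNone vy.
  by exists y0; [apply: L0Ls|rewrite vy0].
pose idm : {mono (idfun : {additive vgroup E -> vgroup E}) : x y / x <= y} := fun _ _ => erefl.
pose L := subVF Lsf idm h_in h_on; pose k := sub_ext Lsf idm h_in h_on.
pose j := @lift_ext E Ls Lsf (vgroup E) idfun idm h_in h_on K i (ext_val i) (fun=> erefl) iLs.
have kE : range k = Ls.
  apply/seteqP; split=> [_ [x _ <-]|x Lx]; first exact: (sf_valP x).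
  by have [y yx] := sf_ex Lsf Lx; exists y.
have T0J : T0 #= J0.
  apply: inj_card_eq => a b /set_mem Ja /set_mem Jb.
  by apply: (rfree_inj pE L0p tfree); apply: Jk.
exists L, j, k; split=> //.
- apply: immediate_of_sim => y /approx_pth[y0 /L0Ls Ly0 yy0].
  by have [x xy] := sf_ex Lsf Ly0; exists x; rewrite [k x]xy.
- move=> y; have [x yx] := hE.2 y; exact: (@alg_of_pth _ _ k y (j x)).
- have Tb := pmonomials_basis pE Lsp T0free' T0all; rewrite kE; split=> [n Jn|Jinf].
    exists (pmonomials p T0) => //.
    by apply: (pmonomials_finite pE Lsp T0free'); apply: card_eq_trans Jn.
  exists (pmonomials p T0) => //; apply: card_eq_trans (T0J).
  by apply: (pmonomials_infinite pE); move=> T0f; apply: Jinf; rewrite -(eq_finite_set T0J).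
move=> Ccof y g.
(* The topological closure of [L] in [E]: a ring that contains [L] and the omitted limits, hence all
   of [E]. *)
pose Z := [set y : E | forall g, exists2 x, Ls x & vlt (Some g) (val_of (x - y))].
suff /(_ g)[x Lx xy] : Z y by have [u ux] := sf_ex Lsf Lx; exists u; move: xy; rewrite -ux.
have LsZ : Ls `<=` Z by move=> x Lx h; exists x; rewrite // subrr val0 vltNone.
have Zring : is_subring Z.
  split; first exact/LsZ/(sr_1 Lsf).
    move=> x x' Zx Zx' h; have [u Lu ux] := Zx h; have [u' Lu' ux'] := Zx' h.
    exists (u - u'); first exact: (sr_B Lsf).
    by rewrite opprD addrACA; apply: val_add_gt; rewrite // -opprD valN.
  move=> x x' Zx Zx' h.
  have bnd (v : E) : exists g', forall w, vlt (Some g') (val_of w) -> vlt (Some h) (val_of (w * v)).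
    have [->|v0] := eqVneq v 0; first by exists h => w _; rewrite mulr0 val0 vltNone.
    have [b vb] := val_neq0 v0; exists (h - b) => w hw.
    rewrite val_mul vb (_ : Some h = vadd (Some (h - b)) (Some b)) /= ?subrK //.
    by have := @vlt_add2r _ (Some b) (Some (h - b)) (val_of w) isT; rewrite /= subrK hw.
  have [g1 g1P] := bnd x'; have [u Lu ux] := Zx g1.
  have [g2 g2P] := bnd u; have [u' Lu' ux'] := Zx' g2.
  exists (u * u'); first exact: (sr_M Lsf).
  rewrite (_ : u * u' - x * x' = (u' - x') * u + (u - x) * x').
    by apply: val_add_gt; [apply: g2P|apply: g1P].
  by rewrite !mulrBl [u' * u]mulrC [x' * u]mulrC addrA subrK.
apply: (pclosure_min Zring LsZ _ (T0all y)) => _ [a /Jk ka <-] h.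
have [a0 ha0] := pth_cofinal_value h; have [n hn] := Ccof a0.
exists (\sum_(n0 < n.+1) i (c a) ^+ n0 * s n0).
  apply: (sr_sum Lsf) => m _; apply: (sr_M Lsf); first by rewrite -rmorphXn.
  by apply: (sr_M Lsf) => //; apply/L0Ls/Lxi_gen.
rewrite valBC; apply: vlt_le_trans (t_lim _ n.+1 ka).
have [cp c0] := c_pos ka.
have icn : vle (Some 0) (val_of (i (c a) ^+ n.+1)).
  by apply: vge0X; rewrite ext_ge0 vltW.
have icle : vle (val_of (s n.+1)) (val_of (i (c a) ^+ n.+1 * s n.+1)).
  rewrite val_mul; have := vleD icn (vle_refl (val_of (s n.+1))).
  by case: (val_of (s n.+1)) => //= b; rewrite add0r.
apply: vlt_le_trans icle; have [_] := sP n; apply: vle_lt_trans.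
by apply: le_trans ha0 _; rewrite ext_val_mono.
Qed.

End Core.
End PthRoots.

(** * The perfect hull of a valued field *)

(* The direct limit of [V -> V -> V -> ...], all maps being [phi]; [dl n x] is
   the class of the element [x] of the [n]-th copy. *)
Section DirectLimit.
Variables (V : choiceType) (phi : V -> V) (phi_inj : injective phi).

Definition dl_rel (x y : V * nat) := iter y.2 phi x.1 == iter x.2 phi y.1.

Lemma iter_inj n : injective (iter n phi).
Proof. by elim: n => [|n IH] x y //= /phi_inj/IH. Qed.

Lemma iterC m n x : iter m phi (iter n phi x) = iter n phi (iter m phi x).
Proof. by rewrite -!iterD addnC. Qed.

Lemma dl_rel_refl : reflexive dl_rel.
Proof. by move=> x; apply: eqxx. Qed.

Lemma dl_rel_sym : ssrbool.symmetric dl_rel.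
Proof. by move=> x y; apply: eq_sym. Qed.

Lemma dl_rel_trans : transitive dl_rel.
Proof.
move=> [y m] [x n] [z k]; rewrite /dl_rel /= => /eqP xy /eqP yz.
apply/eqP/(@iter_inj m); rewrite -!iterD addnC iterD xy -iterD addnC iterD yz.
by rewrite -!iterD addnC.
Qed.

Definition dl_equiv := EquivRel dl_rel dl_rel_refl dl_rel_sym dl_rel_trans.
Definition dlim := {eq_quot dl_equiv}.
HB.instance Definition _ := Choice.on dlim.

Definition dl n x : dlim := \pi_dlim (x, n).

Lemma dl_eq n m x y : (dl n x == dl m y) = (iter m phi x == iter n phi y).
Proof. by rewrite /dl eqmodE. Qed.

Lemma dl_shift n k x : dl (n + k) (iter k phi x) = dl n x.
Proof. by apply/eqP; rewrite dl_eq -iterD. Qed.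

Lemma dl_inj n : injective (dl n).
Proof. by move=> x y /eqP; rewrite dl_eq => /eqP/iter_inj. Qed.

Lemma dl_repr u : u = dl (repr u).2 (repr u).1.
Proof. by rewrite /dl -surjective_pairing reprK. Qed.

Lemma dl_ex1 u : exists n x, u = dl n x.
Proof. by exists (repr u).2, (repr u).1; apply: dl_repr. Qed.

Lemma dl_ex2 u v : exists n x y, u = dl n x /\ v = dl n y.
Proof.
have [n [x ->]] := dl_ex1 u; have [m [y ->]] := dl_ex1 v.
exists (n + m)%N, (iter m phi x), (iter n phi y); split; first by rewrite dl_shift.
by rewrite addnC dl_shift.
Qed.

Lemma dl_ex3 u v w : exists n x y z, [/\ u = dl n x, v = dl n y & w = dl n z].
Proof.
have [n [x [y [-> ->]]]] := dl_ex2 u v; have [m [z ->]] := dl_ex1 w.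
exists (n + m)%N, (iter m phi x), (iter m phi y), (iter n phi z).
by split; rewrite ?dl_shift // addnC dl_shift.
Qed.

Definition dl_map (o : V -> V) (u : dlim) : dlim := dl (repr u).2 (o (repr u).1).

Definition dl_op (o : V -> V -> V) (u v : dlim) : dlim :=
  dl ((repr u).2 + (repr v).2)
     (o (iter (repr v).2 phi (repr u).1) (iter (repr u).2 phi (repr v).1)).

Definition dl_le (r : rel V) (u v : dlim) :=
  r (iter (repr v).2 phi (repr u).1) (iter (repr u).2 phi (repr v).1).

Lemma dl_repr_eq n x : iter n phi (repr (dl n x)).1 = iter (repr (dl n x)).2 phi x.
Proof. by apply/eqP; rewrite -dl_eq -dl_repr. Qed.

Lemma dl_mapE o : {morph phi : x / o x} -> forall n x, dl_map o (dl n x) = dl n (o x).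
Proof.
move=> om n x; have oi k y : iter k phi (o y) = o (iter k phi y).
  by elim: k => //= k ->; rewrite om.
by apply/eqP; rewrite dl_eq !oi dl_repr_eq.
Qed.

Lemma dl_opE o : {morph phi : x y / o x y} ->
  forall n x y, dl_op o (dl n x) (dl n y) = dl n (o x y).
Proof.
move=> om n x y; have oi k a b : iter k phi (o a b) = o (iter k phi a) (iter k phi b).
  by elim: k => //= k ->; rewrite om.
by apply/eqP; rewrite dl_eq !oi !(iterC n) !dl_repr_eq !iterD [in X in o X _]iterC.
Qed.

Lemma dl_leE (r : rel V) : {mono phi : x y / r x y} ->
  forall n x y, dl_le r (dl n x) (dl n y) = r x y.
Proof.
move=> rm n x y; have ri k : {mono iter k phi : a b / r a b}.
  by elim: k => // k IH a b /=; rewrite rm IH.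
by rewrite /dl_le -(ri n) !(iterC n) !dl_repr_eq [in X in r X _]iterC !ri.
Qed.

End DirectLimit.

Section PerfectHull.
Variables (K : valuedField) (p : nat) (pK : p \in [pchar K]).
Let p_prime : prime p := pcharf_prime pK.
Let p_gt0 : (0 < p)%N := prime_gt0 p_prime.

Let fr : K -> K := fun x => x ^+ p.

Lemma fr_inj : injective fr.
Proof. exact: (exprp_inj pK). Qed.

Lemma frD : {morph fr : x y / x + y}.
Proof. by move=> x y; rewrite /fr -!(pFrobenius_autE pK) rmorphD. Qed.

Lemma frN : {morph fr : x / - x}.
Proof. by move=> x; rewrite /fr -!(pFrobenius_autE pK) rmorphN. Qed.

Lemma frM : {morph fr : x y / x * y}.
Proof. by move=> x y; rewrite /fr exprMn. Qed.

Lemma frV : {morph fr : x / x^-1}.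
Proof. by move=> x; rewrite /fr exprVn. Qed.

Definition hull := dlim fr_inj.
HB.instance Definition _ := Choice.on hull.

(** The element [x^(1/p^n)]: the copy of index [n] is [K^(1/p^n)], and Frobenius on [K] expresses
    its inclusion into the next one. *)
Definition hl n (x : K) : hull := dl fr_inj n x.

Definition hull_opp : hull -> hull := @dl_map _ _ fr_inj -%R.
Definition hull_add : hull -> hull -> hull := @dl_op _ _ fr_inj +%R.
Definition hull_mul : hull -> hull -> hull := @dl_op _ _ fr_inj *%R.
Definition hull_inv : hull -> hull := @dl_map _ _ fr_inj GRing.inv.

Lemma hull_addE n x y : hull_add (hl n x) (hl n y) = hl n (x + y).
Proof. exact: (dl_opE _ frD). Qed.
Lemma hull_mulE n x y : hull_mul (hl n x) (hl n y) = hl n (x * y).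
Proof. exact: (dl_opE _ frM). Qed.
Lemma hull_oppE n x : hull_opp (hl n x) = hl n (- x).
Proof. exact: (dl_mapE _ frN). Qed.
Lemma hull_invE n x : hull_inv (hl n x) = hl n x^-1.
Proof. exact: (dl_mapE _ frV). Qed.

Lemma iter_fr n x : iter n fr x = x ^+ (p ^ n).
Proof. by elim: n => [|n IH] /=; rewrite ?expr1 // IH /fr -exprM -expnSr. Qed.

Lemma hl0 n : hl n 0 = hl 0 0.
Proof.
by apply/eqP; rewrite dl_eq !iter_fr !expr0n !eqn0Ngt !expn_gt0 !p_gt0.
Qed.
Lemma hl1 n : hl n 1 = hl 0 1.
Proof. by apply/eqP; rewrite dl_eq !iter_fr !expr1n. Qed.

Lemma hull_addA : associative hull_add.
Proof.
by move=> u v w; have [n [x [y [z [-> -> ->]]]]] := dl_ex3 u v w; rewrite !hull_addE addrA.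
Qed.
Lemma hull_addC : commutative hull_add.
Proof. by move=> u v; have [n [x [y [-> ->]]]] := dl_ex2 u v; rewrite !hull_addE addrC. Qed.
Lemma hull_add0 : left_id (hl 0 0) hull_add.
Proof. by move=> u; have [n [x ->]] := dl_ex1 u; rewrite -(hl0 n) hull_addE add0r. Qed.
Lemma hull_addN : left_inverse (hl 0 0) hull_opp hull_add.
Proof. by move=> u; have [n [x ->]] := dl_ex1 u; rewrite hull_oppE hull_addE addNr hl0. Qed.

HB.instance Definition _ :=
  GRing.isZmodule.Build hull hull_addA hull_addC hull_add0 hull_addN.

Lemma hull_mulA : associative hull_mul.
Proof.
by move=> u v w; have [n [x [y [z [-> -> ->]]]]] := dl_ex3 u v w; rewrite !hull_mulE mulrA.
Qed.
Lemma hull_mulC : commutative hull_mul.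
Proof. by move=> u v; have [n [x [y [-> ->]]]] := dl_ex2 u v; rewrite !hull_mulE mulrC. Qed.
Lemma hull_mul1 : left_id (hl 0 1) hull_mul.
Proof. by move=> u; have [n [x ->]] := dl_ex1 u; rewrite -(hl1 n) hull_mulE mul1r. Qed.
Lemma hull_mulDl : left_distributive hull_mul +%R.
Proof.
move=> u v w; have [n [x [y [z [-> -> ->]]]]] := dl_ex3 u v w.
by rewrite -[_ + _]/(hull_add _ _) -[X in _ = X]/(hull_add _ _) !(hull_addE, hull_mulE) mulrDl.
Qed.
Lemma hull_neq0 : hl 0 1 != 0.
Proof. by rewrite dl_eq /= oner_neq0. Qed.

HB.instance Definition _ := GRing.Zmodule_isComNzRing.Build hull
  hull_mulA hull_mulC hull_mul1 hull_mulDl hull_neq0.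

Lemma hull_mulVf u : u != 0 -> hull_inv u * u = 1.
Proof.
have [n [x ->]] := dl_ex1 u; rewrite -[0]/(hl 0 0) -(hl0 n) (inj_eq (@dl_inj _ _ fr_inj n)) => x0.
by rewrite -[LHS]/(hull_mul _ _) hull_invE hull_mulE mulVf // hl1.
Qed.
Lemma hull_inv0 : hull_inv 0 = 0.
Proof. by rewrite -[0]/(hl 0 0) hull_invE invr0. Qed.

HB.instance Definition _ := GRing.ComNzRing_isField.Build hull hull_mulVf hull_inv0.

Lemma hlD n x y : hl n x + hl n y = hl n (x + y).
Proof. exact: hull_addE. Qed.
Lemma hlM n x y : hl n x * hl n y = hl n (x * y).
Proof. exact: hull_mulE. Qed.
Lemma hlX n x k : hl n x ^+ k = hl n (x ^+ k).
Proof. by elim: k => [|k IH]; rewrite ?expr0 ?hl1 // !exprS IH hlM. Qed.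
Lemma hlS n x : hl n.+1 (x ^+ p) = hl n x.
Proof. by rewrite -[n.+1]addn1; apply: (dl_shift fr_inj n 1). Qed.
Lemma hl_eq0 n x : (hl n x == 0) = (x == 0).
Proof. by rewrite -[0]/(hl 0 0) -(hl0 n) (inj_eq (@dl_inj _ _ fr_inj n)). Qed.

End PerfectHull.

(** * The p-divisible hull of an ordered group *)

Section DivisibleHull.
Variables (G : oagType) (p : nat) (p_gt0 : (0 < p)%N).

Let mu : G -> G := fun x => x *+ p.

Lemma mu_inj : injective mu.
Proof. exact: oag_mulIn. Qed.

Lemma muD : {morph mu : x y / x + y}.
Proof. by move=> x y; rewrite /mu mulrnDl. Qed.
Lemma muN : {morph mu : x / - x}.
Proof. by move=> x; rewrite /mu mulNrn. Qed.
Lemma mu_mono : {mono mu : x y / x <= y}.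
Proof. by move=> x y; apply: oag_leMnE. Qed.

Definition ghull := dlim mu_inj.
HB.instance Definition _ := Choice.on ghull.

(** The element [x / p^n]. *)
Definition gh n (x : G) : ghull := dl mu_inj n x.

Definition ghull_opp : ghull -> ghull := @dl_map _ _ mu_inj -%R.
Definition ghull_add : ghull -> ghull -> ghull := @dl_op _ _ mu_inj +%R.
Definition ghull_le : rel ghull := @dl_le _ _ mu_inj <=%O.
Definition ghull_lt : rel ghull := fun u v => (v != u) && ghull_le u v.

Lemma ghull_addE n x y : ghull_add (gh n x) (gh n y) = gh n (x + y).
Proof. exact: (dl_opE _ muD). Qed.
Lemma ghull_oppE n x : ghull_opp (gh n x) = gh n (- x).
Proof. exact: (dl_mapE _ muN). Qed.
Lemma ghull_leE n x y : ghull_le (gh n x) (gh n y) = (x <= y).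
Proof. exact: (dl_leE _ mu_mono). Qed.

Lemma iter_mu n x : iter n mu x = x *+ (p ^ n).
Proof. by elim: n => [|n IH] //=; rewrite IH /mu -mulrnA -expnSr. Qed.

Lemma gh0 n : gh n 0 = gh 0 0.
Proof. by apply/eqP; rewrite dl_eq !iter_mu !mul0rn. Qed.

Lemma ghull_addA : associative ghull_add.
Proof.
by move=> u v w; have [n [x [y [z [-> -> ->]]]]] := dl_ex3 u v w; rewrite !ghull_addE addrA.
Qed.
Lemma ghull_addC : commutative ghull_add.
Proof. by move=> u v; have [n [x [y [-> ->]]]] := dl_ex2 u v; rewrite !ghull_addE addrC. Qed.
Lemma ghull_add0 : left_id (gh 0 0) ghull_add.
Proof. by move=> u; have [n [x ->]] := dl_ex1 u; rewrite -(gh0 n) ghull_addE add0r. Qed.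
Lemma ghull_addN : left_inverse (gh 0 0) ghull_opp ghull_add.
Proof. by move=> u; have [n [x ->]] := dl_ex1 u; rewrite ghull_oppE ghull_addE addNr gh0. Qed.

HB.instance Definition _ :=
  GRing.isZmodule.Build ghull ghull_addA ghull_addC ghull_add0 ghull_addN.

Lemma ghull_le_refl : reflexive ghull_le.
Proof. by move=> u; have [n [x ->]] := dl_ex1 u; rewrite ghull_leE lexx. Qed.
Lemma ghull_le_anti : antisymmetric ghull_le.
Proof.
by move=> u v; have [n [x [y [-> ->]]]] := dl_ex2 u v; rewrite !ghull_leE => /le_anti ->.
Qed.
Lemma ghull_le_trans : ssrbool.transitive ghull_le.
Proof.
move=> v u w; have [n [x [y [z [-> -> ->]]]]] := dl_ex3 u v w; rewrite !ghull_leE.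
exact: le_trans.
Qed.
Lemma ghull_lt_def u v : ghull_lt u v = (v != u) && ghull_le u v.
Proof. by []. Qed.

HB.instance Definition _ := Order.isPOrder.Build ring_display ghull
  ghull_lt_def ghull_le_refl ghull_le_anti ghull_le_trans.

Lemma ghull_total (u v : ghull) : (u <= v) || (v <= u).
Proof.
have [n [x [y [-> ->]]]] := dl_ex2 u v.
rewrite -[_ <= _]/(ghull_le _ _) -[X in _ || X]/(ghull_le _ _) !ghull_leE; exact: oag_total.
Qed.

Lemma ghull_leD2l (w u v : ghull) : u <= v -> w + u <= w + v.
Proof.
have [n [x [y [z [-> -> ->]]]]] := dl_ex3 u v w.
rewrite -[_ <= _]/(ghull_le _ _) -[X in _ -> X]/(is_true (ghull_le (ghull_add _ _) (ghull_add _ _))).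
rewrite !ghull_addE !ghull_leE; exact: oag_leD2l.
Qed.

HB.instance Definition _ := isOrderedAbelianGroup.Build ghull ghull_total ghull_leD2l.

Lemma gh_le n x y : (gh n x <= gh n y) = (x <= y).
Proof. exact: ghull_leE. Qed.
Lemma ghD n x y : gh n x + gh n y = gh n (x + y).
Proof. exact: ghull_addE. Qed.
Lemma ghS n x : gh n.+1 (x *+ p) = gh n x.
Proof. by rewrite -[n.+1]addn1; apply: (dl_shift mu_inj n 1). Qed.

Lemma gh_zmod n : zmod_morphism (gh n).
Proof. by move=> x y; rewrite -ghD -ghull_oppE. Qed.
HB.instance Definition _ n := GRing.isZmodMorphism.Build G ghull (gh n) (gh_zmod n).

End DivisibleHull.

Section HullVal.
Variables (K : valuedField) (p : nat) (pK : p \in [pchar K]).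
Let p_prime : prime p := pcharf_prime pK.
Let p_gt0 : (0 < p)%N := prime_gt0 p_prime.

Local Notation Gh := (@ghull (vgroup K) p p_gt0).
Local Notation gh := (@gh (vgroup K) p p_gt0).
Local Notation hl := (@hl K p pK).

Definition hull_val (u : hull pK) : option Gh :=
  omap (gh (repr u).2) (val_of (repr u).1).

Lemma hull_valE n x : hull_val (hl n x) = omap (gh n) (val_of x).
Proof.
rewrite /hull_val; have := dl_repr_eq (@fr_inj K p pK) n x.
set u := repr _; rewrite !iter_fr => E.
have pn k : (0 < p ^ k)%N by rewrite expn_gt0 p_gt0.
case vx: (val_of x) E => [g|] E; last first.
  move: E; rewrite (val_None vx) expr0n eqn0Ngt pn => /eqP.
  by rewrite expf_eq0 pn => /eqP ->; rewrite val0.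
case vu: (val_of u.1) => [h|]; last first.
  move/esym/eqP: E; rewrite (val_None vu) expr0n eqn0Ngt pn expf_eq0 pn => /eqP x0.
  by move: vx; rewrite x0 val0.
move/(congr1 (@val_of K)): E; rewrite (val_expn _ vx) (val_expn _ vu) => -[E].
by congr Some; apply/eqP; rewrite dl_eq !iter_mu E.
Qed.

Lemma hull_val_eqNone u : (hull_val u == None) = (u == 0).
Proof.
have [n [x ->]] := dl_ex1 u; rewrite -/(hl n x) hull_valE hl_eq0 -val_eqNone.
by case: (val_of x).
Qed.

Lemma hull_val_mul u v : hull_val (u * v) = vadd (hull_val u) (hull_val v).
Proof.
have [n [x [y [-> ->]]]] := dl_ex2 u v; rewrite -!/(hl n _) hlM !hull_valE val_mul.
by case: (val_of x) (val_of y) => [a|] [b|] //=; rewrite ghD.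
Qed.

Lemma omap_gh_le n a b : vle (omap (gh n) a) (omap (gh n) b) = vle a b.
Proof. by case: a b => [x|] [y|] //=; rewrite gh_le. Qed.

Lemma hull_val_add u v :
  vle (hull_val u) (hull_val (u + v)) || vle (hull_val v) (hull_val (u + v)).
Proof.
have [n [x [y [-> ->]]]] := dl_ex2 u v; rewrite -!/(hl n _) hlD !hull_valE !omap_gh_le.
exact: val_add.
Qed.

Lemma hull_val_onto g : exists u, hull_val u = Some g.
Proof.
have [n [h ->]] := dl_ex1 g; have [x vx] := val_onto h.
by exists (hl n x); rewrite hull_valE vx.
Qed.

Definition hullVF := ValuedField hull_val_eqNone hull_val_mul hull_val_add hull_val_onto.

Definition hull_emb (x : K) : hull pK := hl 0 x.

Lemma hull_emb_zmod : zmod_morphism hull_emb.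
Proof. by move=> x y; rewrite /hull_emb -hlD -[hl 0 (- y)]hull_oppE. Qed.
Lemma hull_emb_monoid : monoid_morphism hull_emb.
Proof. by split=> [//|x y]; rewrite /hull_emb hlM. Qed.
HB.instance Definition _ := GRing.isZmodMorphism.Build K (hull pK) hull_emb hull_emb_zmod.
HB.instance Definition _ := GRing.isMonoidMorphism.Build K (hull pK) hull_emb hull_emb_monoid.

Definition hull_ext : valuedExt K hullVF :=
  @ValuedExt K hullVF hull_emb (gh 0) (@gh_le _ _ p_gt0 0) (hull_valE 0).

Lemma hull_root (u : hullVF) : exists v : hullVF, v ^+ p = u.
Proof. by have [n [x ->]] := dl_ex1 u; exists (hl n.+1 x); rewrite hlX hlS. Qed.

Lemma hull_insep : purely_inseparable_ext p hull_ext.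
Proof.
move=> u; have [n [x ->]] := dl_ex1 u; exists n, x.
rewrite -[RHS]/(hl 0 x) -/(hl n x) hlX; elim: n => [|n IH]; first by rewrite expr1.
by rewrite expnSr exprM hlS.
Qed.

End HullVal.

(** * Towers in the perfect hull *)

Section Tower.
Variables (K : valuedField) (p : nat) (pK : p \in [pchar K]) (W : vbasis K p).
Let p_prime : prime p := pcharf_prime pK.
Let p_gt0 : (0 < p)%N := prime_gt0 p_prime.
Let Om := hullVF pK.
Let f : valuedExt K Om := hull_ext pK.
Let pO : p \in [pchar Om] := ext_pchar pK f.
Local Notation I := (vgroup K + residue K)%type.

Lemma hull_sim_value (x : Om) (a : K) g : sim (f a) (x ^+ p) -> val_of a = Some g ->
  val_of x = Some (gh p_gt0 1 g).
Proof.
move=> /sim_val xa va; move: xa; rewrite ext_valE va.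
have -> : omap (ext_val f) (Some g) = Some (gh p_gt0 1 g *+ p).
  by rewrite -(raddfMn (gh p_gt0 1)); congr Some; apply/esym/(ghS p_gt0 0 g).
case vx: (val_of x) => [h|]; last by rewrite (val_None vx) expr0n eqn0Ngt p_gt0 val0.
by rewrite (val_expn p vx) => -[] /oag_mulIn ->.
Qed.

Lemma hull_cofinal_value (g : vgroup Om) : exists a, g <= ext_val f a.
Proof.
have [n [x ->]] := dl_ex1 g; have /orP[x0|x0] := oag_total x 0.
  by exists 0; rewrite raddf0 -[0]/(gh p_gt0 0 0) -(gh0 _ p_gt0 n) gh_le.
exists x; have -> : ext_val f x = gh p_gt0 n (x *+ (p ^ n)).
  elim: n => [|n IH]; first by rewrite expn0 mulr1n.
  by rewrite expnSr mulrnA ghS.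
rewrite gh_le; have pn : (0 < p ^ n)%N by rewrite expn_gt0 p_gt0.
rewrite -(prednK pn) mulrS -{1}[x]addr0; apply: oag_leD2l.
by rewrite -(mul0rn _ (p ^ n).-1); apply: oag_leMn.
Qed.

Hypothesis hK : nontrivial_valuation K.
Variable Y : set I.
Hypotheses (Y_inf : infinite_set Y) (YW : Y `<=` vbset W).

(* [r] is close to the family of [p]-th roots of the basis, but the [p]-th power
   of each [r (beta (n, k.+1))] involves [r (beta (n, k))]. *)
Lemma tower_ex : exists (r : I -> Om) (beta : nat * nat -> I) (d : nat -> nat -> K),
  [/\ injective beta /\ (forall x, Y (beta x)),
    forall b, Y b -> sim (f (vlift W b)) (r b ^+ p),
    forall n, r (beta (n, 0%N)) ^+ p = f (vlift W (beta (n, 0%N))),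
    forall n k, d n k != 0 /\ r (beta (n, k.+1)) ^+ p =
      f (vlift W (beta (n, k.+1))) + f (d n k) * r (beta (n, k)) &
    forall b, Y b -> (forall x, b != beta x) -> r b ^+ p = f (vlift W b)].
Proof.
have [gam [gamY gam_inj]] := infinite_inj_nat Y_inf.
pose beta (x : nat * nat) := gam (pickle x).
have beta_inj : injective beta by move=> x y /gam_inj/(pcan_inj pickleK).
have betaY x : Y (beta x) by apply: gamY.
have /choice[rt rtP] := @hull_root K p pK.
pose xi b := rt (f (vlift W b)).
have xiP b : xi b ^+ p = f (vlift W b) by rewrite rtP.
have xi0 b : Y b -> xi b != 0.
  move=> /YW Wb; have := xiP b; apply: contra_eq_neq => ->; rewrite expr0n eqn0Ngt p_gt0 eq_sym.
  by rewrite fmorph_eq0 (vlift_neq0 pK).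
have rt0 u : u != 0 -> rt u != 0.
  by apply: contraNneq => ru; rewrite -(rtP u) ru expr0n eqn0Ngt p_gt0.
have fcof : cofinal_ext f := cofinal_of_values hK hull_cofinal_value.
have /choice[Phi PhiP] (x : Om * Om) : exists d : K, d != 0 /\
    (x.1 != 0 -> x.2 != 0 -> sim x.1 (x.1 + f d * x.2)).
  have [u0|u0] := eqVneq x.2 0; first by exists 1; split=> [|_ /eqP//]; exact: oner_neq0.
  have [y0|/val_neq0[g vg]] := eqVneq x.1 0; first by exists 1; split=> [|/eqP//]; exact: oner_neq0.
  have [d d0 vd] := cofinal_mul g fcof u0; exists d; split=> // _ _.
  by apply: sim_addl; rewrite vg.
pose rho n := fix rho k := if k is k'.+1 then
   xi (beta (n, k)) + f (Phi (xi (beta (n, k)), rt (rho k'))) * rt (rho k')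
  else xi (beta (n, 0%N)).
have rho_sim n k : sim (xi (beta (n, k))) (rho n k).
  elim: k => [|k /sim_neq0r IH] /=; first exact/sim_refl/xi0.
  by apply: (PhiP (_, _)).2 => //=; [apply: xi0|apply: rt0].
pose r b := if pselect (exists x, b = beta x) is left h
  then rho (projT1 (cid h)).1 (projT1 (cid h)).2 else xi b.
have rbeta x : r (beta x) = rho x.1 x.2.
  rewrite /r; case: pselect => [h|[]]; last by exists x.
  by case: (cid h) => y /= /beta_inj ->.
(* The scalar is a [p]-th power because the perturbation is [Phi] times a [p]-th root of the
   preceding member. *)
exists r, beta, (fun n k => Phi (xi (beta (n, k.+1)), rt (rho n k)) ^+ p).
split=> [//|b Yb|n|n k|b Yb nb].
- rewrite -xiP; apply: sim_exp; rewrite /r; case: pselect => [h|_]; last exact/sim_refl/xi0.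
  by case: (cid h) => -[n k] /= ->.
- by rewrite rbeta /= xiP.
- split; first by rewrite expf_neq0 // (PhiP _).1.
  rewrite !rbeta /= -(pFrobenius_autE pO) rmorphD rmorphM /= !pFrobenius_autE xiP rtP.
  by rewrite -rmorphXn.
- by rewrite /r; case: pselect => [[x bx]|_ //]; case/eqP: (nb x).
Qed.

End Tower.

Section TowerField.
Variables (K : valuedField) (p : nat) (pK : p \in [pchar K]) (W : vbasis K p).
Let p_prime : prime p := pcharf_prime pK.
Let p_gt1 : (1 < p)%N := prime_gt1 p_prime.
Let p_gt0 : (0 < p)%N := prime_gt0 p_prime.
Let Om := hullVF pK.
Let f : valuedExt K Om := hull_ext pK.
Local Notation I := (vgroup K + residue K)%type.

Variables (Y : set I) (r : I -> Om).
Hypothesis YW : Y `<=` vbset W.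
Hypothesis r_sim : forall b, Y b -> sim (f (vlift W b)) (r b ^+ p).
Hypothesis rp : forall b, Y b -> exists a (s : seq (Om * I)),
  [/\ range f a, forall x, x \in s -> range f x.1 /\ Y x.2 &
    r b ^+ p = a + \sum_(x <- s) x.1 * r x.2].

Let S := redspan p (range f) r Y.
Let fS : is_subfield (range f) := range_is_subfield f.

(** The inverse of [y] is a power of [y] divided by a [p^n]-th power of [y] that lies in [K]. *)
Lemma tower_subfield : is_subfield S.
Proof.
have Sr : is_subring S by apply: (redspan_subring p_gt1 fS).
split=> // y Sy; have [->|y0] := eqVneq y 0; first by rewrite invr0; apply: (sr_0 Sr).
have [n [x yx]] := @hull_insep K p pK y.
have -> : y^-1 = y ^+ (p ^ n).-1 * (f x)^-1.
  have pn : (0 < p ^ n)%N by rewrite expn_gt0 p_gt0.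
  by rewrite -yx -[in X in _ / X](prednK pn) exprSr invfM mulrA divff ?mul1r // expf_neq0.
apply: (sr_M Sr); first exact: (sr_X Sr).
by rewrite -fmorphV; apply: redspanC; exists x^-1.
Qed.

Let Sf := tower_subfield.

Lemma tower_gen b : Y b -> S (r b).
Proof. exact: (redspan_gen p_gt1 fS). Qed.

Lemma tower_base x : S (f x).
Proof. by apply: redspanC; exists x. Qed.

(** The [p]-th power of [y] need not lie in [K], but it has the leading term of an element [z] of
    [K] in the span of the basis; values and residues of the tower field are read off from [z] by
    [val_indep]. *)
Lemma tower_lead y : S y -> y != 0 -> exists l z, [/\ uniq l, forall b, b \in l -> Y b,
  redspan p (ppowers K p) (vlift W) [set` l] z & sim (f z) (y ^+ p)].
Proof.
move=> [l [c [ul lY fc ->]]] y0.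
have /choice[d dP] t : exists a, f a = c t by have [a _ <-] := fc t; exists a.
have cd t : t \in exps p (size l) -> c t = (f \o d) t by rewrite /= dP.
rewrite (lcomb_eq _ cd) in y0 *; exists l, (lcomb p (fun t => d t ^+ p) (vlift W) l).
split=> //; first by exists l, (fun t => d t ^+ p); split=> // t; exists (d t).
have -> : lcomb p (fun t => d t ^+ p) (vlift W) l =
    lcomb p (fun t => d t ^+ p) (fun b => (1 : K) ^+ p * vlift W b) l.
  apply: eq_bigr => t _; congr (_ * _).
  by elim: (l) t => [|b l' IH] [|k t] //=; rewrite IH expr1n mul1r.
apply: (@lcomb_sim K p pK W Om f I id (fun=> 1) r Y) => //.
- by move=> b; apply: oner_neq0.
- by move=> b Yb; rewrite expr1n mul1r; apply: r_sim.
apply: contrapT => H; case/eqP: y0; rewrite /lcomb big_seq big1 // => t tl.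
have [dt|dt] := eqVneq (d t) 0; first by rewrite /= dt rmorph0 mul0r.
by case: H; exists t.
Qed.

Variables (lev : nat) (e : {additive vgroup K -> vgroup K}).
Let h : {additive vgroup K -> vgroup Om} := gh p_gt0 lev.
Hypothesis he : forall g, h (e g) = ext_val f g.
Hypothesis h_in : forall x, S x -> x != 0 -> exists g, val_of x = Some (h g).
Hypothesis h_on : forall g, exists2 x, S x & val_of x = Some (h g).

Let h_mono : {mono h : x y / x <= y} := @gh_le _ _ p_gt0 lev.

(** [lev] is [1], with [e] multiplication by [p], when the value group is to be [(1/p)vK]; it is
    [0], with [e] the identity, when the value group is to stay [vK]. *)
Definition towerVF : valuedField := subVF Sf h_mono h_in h_on.
Definition tower_ext : valuedExt K towerVF := lift_ext Sf h_mono h_in h_on he tower_base.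
Let k : valuedExt towerVF Om := sub_ext Sf h_mono h_in h_on.

Lemma tower_insep : purely_inseparable_ext p tower_ext.
Proof.
move=> y; have [n [x yx]] := @hull_insep K p pK (k y); exists n, x.
by apply: (fmorph_inj k); rewrite rmorphXn yx.
Qed.

Lemma tower_cofinal_value (g : vgroup towerVF) : exists a, g <= ext_val tower_ext a.
Proof.
have [a ga] := hull_cofinal_value (h g : vgroup Om); exists a.
by move: ga; rewrite -he h_mono.
Qed.

Lemma tower_lead_sub (y : towerVF) : y != 0 -> exists l z, [/\ uniq l,
  forall b, b \in l -> Y b,
  redspan p (ppowers K p) (vlift W) [set` l] z & sim (tower_ext z) (y ^+ p)].
Proof.
move=> y0; have [||l [z [ul lY Vz yz]]] := @tower_lead (k y).
- exact: (sf_valP y).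
- by rewrite fmorph_eq0.
exists l, z; split=> //; rewrite -(ext_sim k) rmorphXn; exact: yz.
Qed.

Lemma rs_sim (L : valuedField) (x y : L) : vle (Some 0) (val_of x) -> sim x y -> rs x = rs y.
Proof.
move=> x0 xy; apply/eqP; rewrite rs_eq ?(sim_val xy) //; exact: vle_lt_trans xy.
Qed.

Lemma tower_res_pth a : exists b, a ^+ p = ext_res tower_ext b.
Proof.
have [y y0 <-] := rs_onto a; have [->|yn0] := eqVneq y 0.
  by exists 0; rewrite rs0 rmorph0 expr0n eqn0Ngt p_gt0.
have [l [z [_ _ _ zy]]] := tower_lead_sub yn0.
have z0 : vle (Some 0) (val_of (tower_ext z)) by rewrite -(sim_val zy) vge0X.
by exists (rs z); rewrite -rsX // -(rs_sim z0 zy) ext_res_rs // -(ext_ge0 tower_ext).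
Qed.

Lemma tower_res_roots : (forall a, vb2 W a -> Y (inr a)) -> is_pth_roots p (ext_res tower_ext).
Proof.
move=> Y2; split=> [a|]; last exact: tower_res_pth.
have [l [c [ul lX z0 ra]]] := @rs_pclosure_lift K p pK W _ a (fun _ h => h) (vb2_span W a).
have [H|H] := EM (exists2 t, t \in exps p (size l) & c t != 0); last first.
  exists 0; rewrite expr0n eqn0Ngt p_gt0 -ra /lcomb big_seq big1 ?rs0 ?rmorph0 // => t tl.
  have [->|ct] := eqVneq (c t) 0; first by rewrite expr0n eqn0Ngt p_gt0 mul0r.
  by case: H; exists t.
have Sy : S (lcomb p (f \o c) (r \o inr) l).
  exists (map inr l), (f \o c); split=> [||t|].
  - by rewrite map_inj_uniq // => ? ? [].
  - by move=> _ /mapP[b /lX/Y2 Yb ->].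
  - by exists (c t).
  - by rewrite -(lcomb_comp _ _ r inr).
have [y yE] := sf_ex Sf Sy.
set z := lcomb _ _ _ _ in z0 ra.
have zy : sim (tower_ext z) ((y : towerVF) ^+ p).
  rewrite -(ext_sim k) rmorphXn; have -> : k y = lcomb p (f \o c) (r \o inr) l by exact: yE.
  have -> : z = lcomb p (fun t => c t ^+ p) (fun b : residue K => (1 : K) ^+ p * vlift W (inr b)) l.
    apply: eq_bigr => t _; congr (_ * _).
    by elim: (l) t => [|b l' IH] [|n t] //=; rewrite IH expr1n mul1r.
  apply: (@lcomb_sim K p pK W Om f _ inr (fun=> 1) (r \o inr) (vb2 W)) => //.
  - by move=> ? ? [].
  - by move=> b; apply: oner_neq0.
  - by move=> b /Y2 Yb; rewrite expr1n mul1r; apply: r_sim.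
have tz0 : vle (Some 0) (val_of (tower_ext z)) by rewrite ext_ge0.
have y0 : vle (Some 0) (val_of (y : towerVF)).
  have := @val_exp_leE towerVF 1 y p p_gt0; rewrite expr1n val1 => <-.
  by rewrite (sim_val zy).
by exists (rs (y : towerVF)); rewrite -rsX // -(rs_sim tz0 zy) -ext_res_rs // ra.
Qed.

Lemma tower_res_onto : (forall a, ~ Y (inr a)) -> onto (ext_res tower_ext).
Proof.
move=> Y2 a; have [y y0 <-] := rs_onto a; case vy: (vlt (Some 0) (val_of y)).
  by exists 0; rewrite rmorph0; apply/esym/eqP; rewrite rs_eq0.
have {y0}vy : val_of y = Some 0.
  by case: (vle_eqVlt y0) => [<-//|]; rewrite vy.
have yn0 : y != 0 by rewrite -val_eqNone vy.
have [l [z [ul lY Vz zy]]] := tower_lead_sub yn0.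
have tz : val_of (tower_ext z) = Some 0 by rewrite -(sim_val zy) (val_expn p vy) mul0rn.
have vz : val_of z = Some 0.
  have := tz; rewrite ext_valE; case: (val_of z) => //= g [g0]; congr Some.
  by apply: (@ext_val_inj _ _ tower_ext); rewrite raddf0.
have [|_ _ /(_ z Vz vz)] := @val_indep K p pK W l ul; first by move=> b /lY/YW.
(* Without residue elements in [Y], the residue of [z] is a [p]-th power in [Kv], so that of [y]
   comes from [Kv]. *)
move=> [l' [c [_ lb Sc rz]]].
case: l' lb rz => [_|b l' lb _]; last first.
  by case: (Y2 b); apply: lY; apply: (lb b); rewrite mem_head.
rewrite /lcomb big_seq1 mulr1; have [d _ <-] := Sc [::] => rz.
exists d; apply: (exprp_inj (rs_pchar (ext_pchar pK tower_ext))).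
rewrite /= -rsX ?vy ?vle_refl // -(rs_sim _ zy) ?tz ?vle_refl //.
by rewrite -ext_res_rs ?vz ?vle_refl // rz rmorphXn.
Qed.

End TowerField.

Definition mulrn_map (G : zmodType) (n : nat) (x : G) := x *+ n.

Lemma mulrn_map_zmod (G : zmodType) n : zmod_morphism (@mulrn_map G n).
Proof. by move=> x y; rewrite /mulrn_map mulrnBl. Qed.

HB.instance Definition _ (G : zmodType) n :=
  GRing.isZmodMorphism.Build G G (@mulrn_map G n) (@mulrn_map_zmod G n).

Section TowerExists.
Variables (K : valuedField) (p : nat) (pK : p \in [pchar K]) (W : vbasis K p).
Let p_prime : prime p := pcharf_prime pK.
Let p_gt0 : (0 < p)%N := prime_gt0 p_prime.
Let Om := hullVF pK.
Let f : valuedExt K Om := hull_ext pK.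
Local Notation I := (vgroup K + residue K)%type.

(** Only relations in [L] are recorded, not the perfect hull, so the property passes to every
    extension of [L]. *)
Definition is_tower (L : valuedField) (j : valuedExt K L) : Prop :=
  exists (rho : nat -> nat -> L) (beta : nat * nat -> I) (d : nat -> nat -> K),
  [/\ injective beta /\ (forall x, vbset W (beta x)),
    forall n k, sim (j (vlift W (beta (n, k)))) (rho n k ^+ p),
    forall n, rho n 0%N ^+ p = j (vlift W (beta (n, 0%N))) &
    forall n k, d n k != 0 /\
      rho n k.+1 ^+ p = j (vlift W (beta (n, k.+1))) + j (d n k) * rho n k].

Definition good_tower (L : valuedField) (j : valuedExt K L) : Prop :=
  [/\ purely_inseparable_ext p j, forall g, exists a, g <= ext_val j a & is_tower j].

Hypothesis hK : nontrivial_valuation K.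
Variable Y : set I.
Hypotheses (Y_inf : infinite_set Y) (YW : Y `<=` vbset W).

(** The value group of [L] is [vK] by construction, which the existential hides; the quantifier over
    [P] carries properties of [e] over to the embedding of value groups. The last two hypotheses say
    that the values of the span, divided by [p], make up the group at level [lev]. *)
Lemma tower_field_ex (lev : nat) (e : {additive vgroup K -> vgroup K}) :
  (forall g, gh p_gt0 lev (e g) = gh p_gt0 0 g) ->
  (forall l z g, uniq l -> (forall b, b \in l -> Y b) ->
     redspan p (ppowers K p) (vlift W) [set` l] z -> val_of z = Some g ->
     exists g', gh p_gt0 1 g = gh p_gt0 lev g') ->
  (forall g, exists s (x : K) g', [/\ forall b, b \in s -> Y b,
     val_of (\prod_(b <- s) vlift W b * x ^+ p) = Some g' & gh p_gt0 1 g' = gh p_gt0 lev g]) ->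
  exists (L : valuedField) (j : valuedExt K L),
    [/\ good_tower j,
        forall P : forall G : oagType, {additive vgroup K -> G} -> Prop, P _ e -> P _ (ext_val j),
        (forall a, vb2 W a -> Y (inr a)) -> is_pth_roots p (ext_res j) &
        (forall a, ~ Y (inr a)) -> onto (ext_res j)].
Proof.
move=> he hin hon.
have [r [beta [d [[beta_inj betaY] r_sim r0 rS rY]]]] := tower_ex pK hK Y_inf YW.
have rp b : Y b -> exists a (s : seq (Om * I)),
    [/\ range f a, forall x, x \in s -> range f x.1 /\ Y x.2 &
      r b ^+ p = a + \sum_(x <- s) x.1 * r x.2].
  move=> Yb; have [[[n [|k]] bE]|nb] := EM (exists x, b = beta x).
  - exists (f (vlift W b)), [::]; split=> //.
    by rewrite big_nil addr0 bE r0.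
  - exists (f (vlift W b)), [:: (f (d n k), beta (n, k))]; split=> //.
      by move=> x; rewrite inE => /eqP -> /=; split; [exists (d n k)|apply: betaY].
    by rewrite big_seq1 bE (rS n k).2.
  exists (f (vlift W b)), [::]; split=> //.
  by rewrite big_nil addr0 rY // => x; apply/negP => /eqP bx; case: nb; exists x.
pose S := redspan p (range f) r Y; pose Sf : is_subfield S := tower_subfield rp.
have h_in x : S x -> x != 0 -> exists g, val_of x = Some (gh p_gt0 lev g).
  move=> Sx x0; have [l [z [ul lY Vz zx]]] := tower_lead YW r_sim Sx x0.
  have [|g vz] := @val_neq0 _ z; first by rewrite -(fmorph_eq0 f) (sim_neq0 zx).
  by have [g' gg'] := hin l z g ul lY Vz vz; exists g'; rewrite (hull_sim_value zx vz) gg'.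
have h_on g : exists2 x, S x & val_of x = Some (gh p_gt0 lev g).
  have [s [x [g' [sY vx gE]]]] := hon g.
  exists (\prod_(b <- s) r b * f x).
    apply: (sr_M Sf); last exact: tower_base.
    rewrite big_seq; elim/big_ind: _ => [|y z|b /sY Yb]; [exact: (sr_1 Sf)|exact: (sr_M Sf)|].
    exact: (tower_gen rp).
  rewrite -gE; apply: (hull_sim_value _ (vx)).
  rewrite rmorphM exprMn rmorphXn; apply: sim_mul; last first.
    apply: sim_refl; rewrite -rmorphXn fmorph_eq0; apply: contraPneq vx => ->.
    by rewrite mulr0 val0.
  elim: s sY {vx} => [|b s IH] sY; first by rewrite !big_nil rmorph1 expr1n sim_refl ?oner_neq0.
  rewrite !big_cons rmorphM exprMn; apply: sim_mul; first by apply/r_sim/sY/mem_head.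
  by apply: IH => a al; apply: sY; rewrite inE al orbT.
exists (towerVF rp h_in h_on), (tower_ext rp he h_in h_on).
have Sbeta n k : S (r (beta (n, k))) by apply: (tower_gen rp).
pose k := sub_ext Sf (@gh_le _ _ p_gt0 lev) h_in h_on.
have /choice[rho rhoP] (x : nat * nat) : exists y : towerVF rp h_in h_on, k y = r (beta x).
  by apply: (sf_ex Sf); apply: (tower_gen rp).
split=> //; [|exact: (tower_res_roots YW r_sim)|exact: (tower_res_onto YW r_sim)].
split; [exact: tower_insep|exact: tower_cofinal_value|].
exists (fun n m => rho (n, m)), beta, d; split.
- by split=> // x; apply: YW.
- by move=> n m; rewrite -(ext_sim k) rmorphXn rhoP; apply: r_sim.
- by move=> n; apply: (fmorph_inj k); rewrite rmorphXn rhoP r0.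
move=> n m; split; first exact: (rS n m).1.
by apply: (fmorph_inj k); rewrite rmorphXn rhoP (rS n m).2 rmorphD rmorphM rhoP.
Qed.

Lemma tower_parts_ex : (forall g, vb1 W g -> Y (inl g)) ->
  exists (L : valuedField) (j : valuedExt K L),
    [/\ good_tower j, is_pth_parts p (ext_val j),
        (forall a, vb2 W a -> Y (inr a)) -> is_pth_roots p (ext_res j) &
        (forall a, ~ Y (inr a)) -> onto (ext_res j)].
Proof.
move=> Y1; have [|l z g _ _ _ _|g|L [j [jt je j2 jo]]] :=
  @tower_field_ex 1 (@mulrn_map (vgroup K) p).
- by move=> g; apply: ghS.
- by exists g.
- have [l [h [lX h0 vb]]] := value_approx W g.
  exists (map inl l), h, g; split=> //; last by rewrite big_map.
  by move=> _ /mapP[b /lX/Y1 ? ->].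
exists L, j; split=> //.
by apply: (je (fun G u => is_pth_parts p u)); split=> x; exists x.
Qed.

Lemma tower_onto_ex : (forall g, ~ Y (inl g)) ->
  exists (L : valuedField) (j : valuedExt K L),
    [/\ good_tower j, onto (ext_val j) &
        (forall a, vb2 W a -> Y (inr a)) -> is_pth_roots p (ext_res j)].
Proof.
move=> Y1; have [|l z g ul lY Vz vz|g|L [j [jt je j2 jo]]] :=
  @tower_field_ex 0 (idfun : {additive vgroup K -> vgroup K}).
- by [].
- have [|_ /(_ z g Vz vz) + _] := @val_indep K p pK W l ul; first by move=> b /lY/YW.
  move=> [[|b l'] [g' [lb ->]]]; first by exists g'; rewrite big_nil add0r ghS.
  by case: (Y1 b); apply: lY; apply: (lb b); rewrite mem_head.
- have [x vx] := val_onto g; exists [::], x, (g *+ p); split=> //; last exact: ghS.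
  by rewrite big_nil mul1r (val_expn p vx).
by exists L, j; split=> //; apply: (je (fun G u => onto u)) => x; exists x.
Qed.

End TowerExists.

(** * Algebraic independence of limits *)

Section FrobeniusPowers.
Variables (R : comNzRingType) (p : nat) (pR : p \in [pchar R]) (m : nat).

Lemma pow_exprD (x y : R) : (x + y) ^+ (p ^ m) = x ^+ (p ^ m) + y ^+ (p ^ m).
Proof. by apply: exprDn_pchar; rewrite pnatX (eq_pnat _ (pcharf_eq pR)) pnat_id ?(pcharf_prime pR). Qed.

Lemma pow_exprN (x : R) : (- x) ^+ (p ^ m) = - x ^+ (p ^ m).
Proof. by apply: exprNn_pchar; rewrite pnatX (eq_pnat _ (pcharf_eq pR)) pnat_id ?(pcharf_prime pR). Qed.

Lemma pow_expr_sum I (s : seq I) (P : pred I) (F : I -> R) :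
  (\sum_(i <- s | P i) F i) ^+ (p ^ m) = \sum_(i <- s | P i) F i ^+ (p ^ m).
Proof.
apply: (big_morph (fun x => x ^+ (p ^ m))); first exact: pow_exprD.
by rewrite expr0n eqn0Ngt expn_gt0 prime_gt0 ?(pcharf_prime pR).
Qed.

End FrobeniusPowers.

Section Independence.
Variables (K : valuedField) (p : nat) (pK : p \in [pchar K]) (W : vbasis K p).
Let p_prime : prime p := pcharf_prime pK.
Let p_gt1 : (1 < p)%N := prime_gt1 p_prime.
Let p_gt0 : (0 < p)%N := prime_gt0 p_prime.
Variables (N : valuedField) (F : valuedExt K N).
Let pN : p \in [pchar N] := ext_pchar pK F.
Local Notation I := (vgroup K + residue K)%type.

Variables (rho : nat -> nat -> N) (beta : nat * nat -> I) (d : nat -> nat -> K).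
Hypotheses (beta_inj : injective beta) (betaW : forall x, vbset W (beta x)).
Hypothesis rho_sim : forall n k, sim (F (vlift W (beta (n, k)))) (rho n k ^+ p).
Hypothesis rho0 : forall n, rho n 0%N ^+ p = F (vlift W (beta (n, 0%N))).
Hypothesis rhoS : forall n k, d n k != 0 /\
  rho n k.+1 ^+ p = F (vlift W (beta (n, k.+1))) + F (d n k) * rho n k.

Lemma rho_neq0 n k : rho n k != 0.
Proof. by have := sim_neq0r (rho_sim n k); rewrite expf_eq0 p_gt0. Qed.

Lemma rho_pow n k m : exists x : K * K, x.2 != 0 /\
  rho n (k + m) ^+ (p ^ m) = F x.1 + F x.2 * rho n k.
Proof.
elim: m => [|m [[a b] /= [b0 E]]]; first by exists (0, 1); rewrite oner_neq0 addn0 rmorph0 add0r rmorph1 mul1r.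
exists (vlift W (beta (n, (k + m).+1)) ^+ (p ^ m) + d n (k + m) ^+ (p ^ m) * a,
  d n (k + m) ^+ (p ^ m) * b); split=> /=.
  by rewrite mulf_neq0 // expf_neq0 // (rhoS n _).1.
rewrite addnS expnS exprM (rhoS n _).2 (pow_exprD pN) exprMn E.
by rewrite rmorphD !rmorphM !rmorphXn mulrDr addrA mulrA.
Qed.

(** After [k] steps down one more [p]-th power takes the bottom of the tower into [K]. *)
Lemma rho_base n k m : (k < m)%N -> exists a, rho n k ^+ (p ^ m) = F a.
Proof.
move=> km; have [[a b] /= [_ E]] := rho_pow n 0 k.
exists ((a ^+ p + b ^+ p * vlift W (beta (n, 0%N))) ^+ (p ^ (m - k.+1))).
rewrite add0n in E; rewrite -(subnKC km) expnD expnSr !exprM E.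
rewrite -!(pFrobenius_autE pN) rmorphD rmorphM /= !pFrobenius_autE rho0.
by rewrite -!rmorphXn -rmorphM -rmorphD -rmorphXn addKn.
Qed.

Section Limits.
Variables (D : nat -> K) (D_neq0 : forall n, D n != 0).
Variable (ka : nat -> nat -> K * K).
Hypothesis ka_neq0 : forall n m, (ka n m).2 != 0.
Hypothesis kaP : forall n m, (m <= n)%N ->
  rho n n ^+ (p ^ m) = F (ka n m).1 + F (ka n m).2 * rho n (n - m).
Let s n := F (D n) * rho n n.
Hypothesis s_fast : forall n m, (m <= n)%N ->
  vlt (val_of (F (D n ^+ (p ^ m) * (ka n m).2) * rho n (n - m))) (val_of (s n.+1 ^+ (p ^ m))).

Variables (q : nat) (c : nat -> K) (z : nat -> N).
Hypothesis c_pos : forall a, (a < q)%N -> vlt (Some 0) (val_of (c a)) /\ c a != 0.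
Hypothesis c_dis : forall a b, (a < q)%N -> (b < q)%N -> a != b ->
  c a != c b /\ vle (val_of (c a - c b)) (val_of (c a)).
Hypothesis z_lim : forall a P, (a < q)%N -> vle (val_of (F (c a) ^+ P * s P))
  (val_of (z a - \sum_(n < P) F (c a) ^+ n * s n)).

Let X (b : nat) : {mpoly K[q]} := if insub b is Some i then 'X_i else 0.
Let ev (P : {mpoly K[q]}) : N := (map_mpoly F P).@[fun i : 'I_q => z i].

Lemma evX b : (b < q)%N -> ev (X b) = z b.
Proof.
by move=> bq; rewrite /ev /X insubT /= map_mpolyX mevalXU.
Qed.

(** The polynomials [U (m, i)] evaluate to elements with the leading terms of multiples of the tower
    members at [(m + i, i)]; these positions are distinct, so the values are free over [K]. Since
    the [p]-th power of a [U] is linear in the next ones, reduced monomials in the [U] span all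
    polynomials. So [P] is a reduced combination, and its coefficients vanish. *)
Lemma limits_independent (P : {mpoly K[q]}) : ev P = 0 -> P = 0.
Proof.
have evC a : ev a%:MP = F a by rewrite /ev map_mpolyC mevalC.
have evD x y : ev (x + y) = ev x + ev y by rewrite /ev rmorphD /= mevalD.
have evM x y : ev (x * y) = ev x * ev y by rewrite /ev rmorphM /= mevalM.
pose evm : {rmorphism {mpoly K[q]} -> N} := meval (fun i : 'I_q => z i) \o map_mpoly F.
have evE x : ev x = evm x by [].
have /choice[lk lkP] (mi : nat * nat) : exists lk : (nat -> K) * (nat -> K), (mi.2 < q)%N ->
    (forall b, (b <= mi.2)%N -> lk.1 b != 0) /\
    vle (val_of (s (mi.1 + mi.2).+1)) (val_of (\sum_(b < mi.2.+1) F (lk.1 b) * z b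
      - \sum_(n < mi.1) F (lk.2 n) * s n - s (mi.1 + mi.2)%N)).
  have [iq|_] := ltnP mi.2 q; last by exists (fun=> 0, fun=> 0).
  have [lam [k H]] := vandermonde_elim c_pos c_dis z_lim mi.1 iq.
  by exists (lam, k).
(* Terms of index less than [m] have their [p^m]-th powers in [K] by [rho_base], so the uncontrolled
   coefficients left by the elimination only contribute a constant. *)
have /choice[low lowP] (mi : nat * nat) : exists a, F a =
    (\sum_(n < mi.1) F ((lk mi).2 n) * s n) ^+ (p ^ mi.1).
  have /choice[g gP] (n : nat) : exists a, (n < mi.1)%N -> F a = (F ((lk mi).2 n) * s n) ^+ (p ^ mi.1).
    have [nm|_] := ltnP n mi.1; last by exists 0.
    have [a aE] := rho_base n nm.
    exists (((lk mi).2 n * D n) ^+ (p ^ mi.1) * a).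
    by rewrite /s mulrA -rmorphM [in RHS]exprMn aE -rmorphXn -rmorphM.
  exists (\sum_(n < mi.1) g n); rewrite rmorph_sum (pow_expr_sum pN).
  by apply: eq_bigr => n _; rewrite gP.
pose kap mi := low mi + D (mi.1 + mi.2)%N ^+ (p ^ mi.1) * (ka (mi.1 + mi.2) mi.1).1.
(* [U (m, i)] evaluates to the [p^m]-th power of a combination with leading term
   [s (m + i)], up to an element of [K]; so it has the leading term of a multiple
   of [rho (m + i) i]. *)
pose U mi : {mpoly K[q]} :=
  \sum_(b < mi.2.+1) ((lk mi).1 b ^+ (p ^ mi.1))%:MP * X b ^+ (p ^ mi.1) - (kap mi)%:MP.
pose e (mi : nat * nat) := D (mi.1 + mi.2)%N ^+ (p ^ mi.1) * (ka (mi.1 + mi.2) mi.1).2.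
have e0 mi : e mi != 0 by rewrite mulf_neq0 ?expf_neq0.
have Usim mi : (mi.2 < q)%N -> sim (F (e mi) * rho (mi.1 + mi.2) mi.2) (ev (U mi)).
  case: mi => m i /= iq; have [_ /= Vle] := lkP (m, i) iq.
  set V := \sum_(b < i.+1) _ - _ in Vle.
  have evU : ev (U (m, i)) = V ^+ (p ^ m) - s (m + i)%N ^+ (p ^ m) + F (e (m, i)) * rho (m + i) i.
    have -> : ev (U (m, i)) = (\sum_(b < i.+1) F ((lk (m, i)).1 b) * z b) ^+ (p ^ m) - F (kap (m, i)).
      rewrite evE rmorphB rmorph_sum -!evE evC (pow_expr_sum pN); congr (_ - _).
      apply: eq_bigr => b _; rewrite rmorphM (rmorphXn evm) -!evE evC evX ?exprMn ?rmorphXn //.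
      exact: leq_trans (ltn_ord b) iq.
    rewrite -[\sum_(b < _) _](subrK (\sum_(n < m) F ((lk (m, i)).2 n) * s n)) -/V.
    have -> : s (m + i)%N ^+ (p ^ m) =
        F (D (m + i)%N ^+ (p ^ m) * (ka (m + i)%N m).1) + F (e (m, i)) * rho (m + i) i.
      rewrite /s exprMn (kaP (leq_addr i m)) addKn mulrDr /e -!rmorphXn mulrA -!rmorphM.
      by [].
    by rewrite (pow_exprD pN) -(lowP (m, i)) /kap rmorphD /= addrKA opprD addrA subrK.
  rewrite evU addrC; apply: sim_addl.
  (* What remains is the [p^m]-th power of the Vandermonde error, whose value is at least that of
     the next term; [s_fast] puts it beyond the leading term. *)
  rewrite -(pow_exprN pN) -(pow_exprD pN).
  have := s_fast (leq_addr i m); rewrite addKn => lt; apply: (vlt_le_trans lt).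
  by rewrite val_exp_leE // expn_gt0 p_gt0.
pose S0 : set {mpoly K[q]} := range (fun a : K => a%:MP).
have S0r : is_subring S0.
  split; first by exists 1; rewrite // mpolyC1.
    by move=> _ _ [a _ <-] [b _ <-]; exists (a - b); rewrite // mpolyCB.
  by move=> _ _ [a _ <-] [b _ <-]; exists (a * b); rewrite // mpolyCM.
pose Xs : set (nat * nat) := [set mi | (mi.2 < q)%N].
pose Lin (y : {mpoly K[q]}) := exists a (l : seq ({mpoly K[q]} * (nat * nat))),
  [/\ S0 a, forall x, x \in l -> S0 x.1 /\ Xs x.2 & y = a + \sum_(x <- l) x.1 * U x.2].
have LinC a : Lin a%:MP by exists a%:MP, [::]; rewrite big_nil addr0; split=> //; exists a.
have LinU mi : (mi.2 < q)%N -> Lin (U mi).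
  move=> iq; exists 0, [:: (1, mi)]; rewrite big_seq1 mul1r add0r.
  by split=> [|x|//]; [exact: (sr_0 S0r)|rewrite inE => /eqP ->; split=> //; exact: (sr_1 S0r)].
have LinD x y : Lin x -> Lin y -> Lin (x + y).
  move=> [a [l [Sa lX ->]]] [a' [l' [Sa' lX' ->]]]; exists (a + a'), (l ++ l').
  rewrite big_cat /= addrACA; split=> //; first exact: (sr_D S0r).
  by move=> u; rewrite mem_cat => /orP[/lX|/lX'].
have LinZ a x : Lin x -> Lin (a%:MP * x).
  move=> [a' [l [Sa lX ->]]]; exists (a%:MP * a'), [seq (a%:MP * u.1, u.2) | u <- l].
  rewrite big_map mulrDr mulr_sumr; split=> //.
  - by apply: (sr_M S0r) => //; exists a.
  - by move=> _ /mapP[u /lX[Su Xu] ->]; split=> //; apply: (sr_M S0r) => //; exists a.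
  by congr (_ + _); apply: eq_bigr => u _; rewrite mulrA.
have LinN x : Lin x -> Lin (- x) by move=> /(LinZ (-1)); rewrite mpolyCN mulN1r.
have Linsum r (G : 'I_r -> {mpoly K[q]}) : (forall i, Lin (G i)) -> Lin (\sum_i G i).
  by move=> LG; elim/big_ind: _ => //; rewrite -mpolyC0.
have LinX m b : (b < q)%N -> Lin (X b ^+ (p ^ m)).
  elim/ltn_ind: b => b IH bq; have [lam0 _] := lkP (m, b) bq.
  have -> : X b ^+ (p ^ m) = ((lk (m, b)).1 b ^- (p ^ m))%:MP * (U (m, b) + (kap (m, b))%:MP
      - \sum_(b' < b) ((lk (m, b)).1 b' ^+ (p ^ m))%:MP * X b' ^+ (p ^ m)).
    rewrite /U /= subrK big_ord_recr /= addrAC subrr add0r mulrA -mpolyCM mulVf ?mpolyC1 ?mul1r //.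
    by rewrite expf_neq0 // lam0 /=.
  apply/LinZ/LinD; first by apply: LinD; [apply: LinU|].
  apply/LinN/Linsum => b'; apply/LinZ/IH => //; exact: ltn_trans (ltn_ord b') bq.
have pM : p \in [pchar {mpoly K[q]}] by exact: (rmorph_pchar (mpolyC q (R := K))) pK.
(* Frobenius turns [U (m, i)] into a constant plus a combination of the [X b ^+ (p ^ m.+1)], which
   are linear in the [U (m.+1, b)]. *)
have rp mi : Xs mi -> Lin (U mi ^+ p).
  case: mi => m i iq; have -> : U (m, i) ^+ p = \sum_(b < i.+1)
      ((lk (m, i)).1 b ^+ (p ^ m.+1))%:MP * X b ^+ (p ^ m.+1) - (kap (m, i) ^+ p)%:MP.
    rewrite -(expn1 p) /U (pow_exprD pM) (pow_exprN pM) (pow_expr_sum pM) expn1 rmorphXn.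
    by congr (_ - _); apply: eq_bigr => b _; rewrite exprMn -rmorphXn -!exprM -!expnSr.
  apply: LinD; last exact/LinN/LinC.
  apply: Linsum => b; apply/LinZ/LinX; exact: leq_trans (ltn_ord b) iq.
pose V := redspan p S0 U Xs.
have Vr : is_subring V := redspan_subring p_gt1 S0r rp.
have VX (i : 'I_q) : V 'X_i.
  have : Lin (X i ^+ (p ^ 0)) by apply: LinX.
  rewrite expn0 expr1 /X valK => -[a [l [Sa lX ->]]].
  apply: (sr_D Vr); first exact: redspanC.
  rewrite big_seq; apply: (sr_sum Vr) => x /lX[Sx Xx].
  apply: (sr_M Vr); [exact: redspanC|exact: (redspan_gen p_gt1 S0r rp)].
have VP : V P.
  rewrite (mpolyE P); apply: (sr_sum Vr) => m _; rewrite -mul_mpolyC.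
  apply: (sr_M Vr); first by apply: redspanC; exists P@_m.
  rewrite mpolyXE_id; apply: (sr_prod Vr) => i; exact: (sr_X Vr (m i) (VX i)).
have [l [cf [ul lX Scf ->]]] := VP.
have /choice[cd cdP] t : exists a, a%:MP = cf t by have [a _ <-] := Scf t; exists a.
rewrite evE rmorph_lcomb => l0.
have Wfree : rfree p (range F) (ev \o U) Xs.
  apply: (@lead_free K p pK W N F _ (fun mi : nat * nat => beta (mi.1 + mi.2, mi.2)%N) e).
  - by move=> [m i] [m' i'] /beta_inj [+ ii]; rewrite ii => /eqP; rewrite eqn_add2r => /eqP ->.
  - by move=> b _; apply: betaW.
  - by [].
  move=> mi iq; rewrite rmorphM rmorphXn.
  apply: sim_trans (sim_exp p (Usim mi iq)); rewrite exprMn; apply: sim_mul; last exact: rho_sim.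
  by apply: sim_refl; rewrite expf_neq0 // fmorph_eq0.
have evcf u : (evm \o cf) u = F (cd u) by rewrite -evC cdP.
apply: big1_seq => t /= tl; have : (evm \o cf) t = 0.
  by apply: (Wfree l (evm \o cf) ul lX) => // u; rewrite evcf; exists (cd u).
by rewrite evcf -cdP => /eqP; rewrite fmorph_eq0 => /eqP ->; rewrite mpolyC0 mul0r.
Qed.

End Limits.
End Independence.

Section ExtComp.
Variables (K L N : valuedField) (j : valuedExt K L) (m : valuedExt L N).

Definition comp_val : {additive vgroup K -> vgroup N} := ext_val m \o ext_val j.

Lemma comp_val_mono : {mono comp_val : x y / x <= y}.
Proof. by move=> x y; rewrite /= !ext_val_mono. Qed.

Lemma comp_valE x : val_of ((m \o j : {rmorphism K -> N}) x) = omap comp_val (val_of x).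
Proof. by rewrite /= !ext_valE; case: (val_of x). Qed.

Definition comp_ext : valuedExt K N := ValuedExt comp_val_mono comp_valE.

Lemma is_tower_comp p (W : vbasis K p) : is_tower W j -> is_tower W comp_ext.
Proof.
move=> [rho [beta [d [hb h1 h2 h3]]]]; exists (fun n k => m (rho n k)), beta, d.
split=> // [n k|n|n k].
- by rewrite -rmorphXn /= ext_sim.
- by rewrite -rmorphXn h2.
by rewrite -rmorphXn (h3 n k).2 rmorphD rmorphM; split=> //; exact: (h3 n k).1.
Qed.

End ExtComp.

(** The family is injective because ['X_0 - 'X_1] is not a relation, and its image extends to a
    transcendence basis as independence is of finite character. *)
Lemma trdeg_geP (L N : fieldType) (m : {rmorphism L -> N}) T (kappa : set T) (z : T -> N) :
  (forall n (a : 'I_n -> T) (P : {mpoly L[n]}), injective a -> (forall i, kappa (a i)) ->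
     (map_mpoly m P).@[z \o a] = 0 -> P = 0) -> trdeg_ge m kappa.
Proof.
move=> zfree.
have zinj a b : kappa a -> kappa b -> z a = z b -> a = b.
  move=> ka kb zab; apply: contrapT => ab.
  pose s (i : 'I_2) := if nat_of_ord i == 0%N then a else b.
  have sinj : injective s.
    by move=> [[|[|x]] xl] [[|[|y]] yl] //=; rewrite /s /= => E; try (by apply: val_inj); case: ab.
  have sk i : kappa (s i) by rewrite /s; case: ifP.
  have := zfree 2 s ('X_0 - 'X_1) sinj sk.
  rewrite rmorphB /= !map_mpolyX mevalB !mevalXU /s /= zab subrr => /(_ erefl) /mpolyP/(_ U_(ord0)%MM).
  rewrite mcoeffB !mcoeffX mcoeff0 eqxx eq_mnm1 /= => /eqP.
  by rewrite subr0 oner_eq0.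
pose Q (l : seq N) := forall n (b : 'I_n -> N) (P : {mpoly L[n]}), injective b ->
  (forall i, b i \in l) -> (map_mpoly m P).@[b] = 0 -> P = 0.
have QE X : (forall l, (forall x, x \in l -> X x) -> Q l) <-> alg_independent m X.
  split=> [H n b P binj bX|H l lX n b P binj bl].
    apply: (H (codom b)) => //; first by move=> _ /codomP[i ->].
    by move=> i; apply: codom_f.
  by apply: H => // i; apply: lX.
have /QE Z0 : alg_independent m (z @` kappa).
  move=> n b P binj bZ.
  have /choice[a aP] i : exists a, kappa a /\ z a = b i by have [a ? <-] := bZ i; exists a.
  have -> : b = z \o a by apply/funext => i; rewrite /= (aP i).2.
  apply: zfree => [i i' aii|i]; last by case: (aP i).
  by apply: binj; rewrite -(aP i).2 -(aP i').2 aii.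
have [B [ZB /QE Bfree Bmax]] := tukey Z0.
exists B; first by split=> // C BC /QE Cfree; apply: Bmax.
by apply: (card_le_inj (f := z)) => // x kx; apply: ZB; exists x.
Qed.

Section Transcendence.
Variables (K : valuedField) (p : nat) (pK : p \in [pchar K]) (W : vbasis K p).
Hypothesis hK : nontrivial_valuation K.
Let p_prime : prime p := pcharf_prime pK.
Let p_gt0 : (0 < p)%N := prime_gt0 p_prime.
Variables (T : Type) (kappa : set T) (c : T -> K).
Hypothesis c_pos : forall a, kappa a -> vlt (Some 0) (val_of (c a)) /\ c a != 0.
Hypothesis c_dis : forall a b, kappa a -> kappa b -> a <> b ->
  c a != c b /\ vle (val_of (c a - c b)) (val_of (c a)).

Lemma independent_limits (N : valuedField) (F : valuedExt K N) C : is_tower W F ->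
  (forall g, exists a, g <= ext_val F a) -> has_limits F C ->
  exists z : T -> N, forall n (a : 'I_n -> T) (P : {mpoly K[n]}), injective a ->
    (forall i, kappa (a i)) -> (map_mpoly F P).@[z \o a] = 0 -> P = 0.
Proof.
move=> [rho [beta [d [[beta_inj betaW] rho_sim rho0' rhoS]]]] Fcof hlim.
have rho0 := rho_neq0 pK rho_sim.
have /choice[kb kbP] (nm : nat * nat) : exists x : K * K, x.2 != 0 /\ ((nm.2 <= nm.1)%N ->
    rho nm.1 nm.1 ^+ (p ^ nm.2) = F x.1 + F x.2 * rho nm.1 (nm.1 - nm.2)%N).
  have [mn|_] := leqP nm.2 nm.1; last by exists (0, 1); rewrite oner_neq0.
  have [x [x0 xE]] := rho_pow pK rhoS nm.1 (nm.1 - nm.2) nm.2.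
  by exists x; split=> // _; rewrite -xE subnK.
pose ka n m := kb (n, m).
have ka0 n m : (ka n m).2 != 0 by case: (kbP (n, m)).
have kaP n m : (m <= n)%N -> rho n n ^+ (p ^ m) = F (ka n m).1 + F (ka n m).2 * rho n (n - m)%N.
  by case: (kbP (n, m)).
have bound (l : seq N) : exists g, forall x, x \in l -> x != 0 -> vle (val_of x) (Some g).
  have [g gP] := oag_max_ex [seq odflt 0 (val_of x) | x <- l]; exists g => x xl x0.
  have [h vx] := val_neq0 x0; rewrite vx; apply: gP; apply/mapP; exists x => //.
  by rewrite vx.
(* The bound to be exceeded by the next term. As it is nonnegative, the [p^m]-th power of that term
   has at least the value of the term itself, which gives [s_fast]. *)
have /choice[bd bdP] (x : nat * K) : exists g : vgroup N,
    [/\ 0 <= g, ext_val F (C x.1) <= g & x.2 != 0 ->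
      vle (val_of (F x.2 * rho x.1 x.1)) (Some g) /\ forall m, (m <= x.1)%N ->
      vle (val_of (F (x.2 ^+ (p ^ m) * (ka x.1 m).2) * rho x.1 (x.1 - m)%N)) (Some g)].
  have [g1 g1P] := bound ((F x.2 * rho x.1 x.1) ::
    [seq F (x.2 ^+ (p ^ m) * (ka x.1 m).2) * rho x.1 (x.1 - m)%N | m <- iota 0 x.1.+1]).
  have [g gP] := oag_max_ex [:: 0; ext_val F (C x.1); g1].
  have gg1 y : vle y (Some g1) -> vle y (Some g).
    by move=> yg; apply: vle_trans yg _; apply: gP; rewrite !inE eqxx !orbT.
  exists g; split; [by apply: gP; rewrite mem_head|by apply: gP; rewrite !inE eqxx orbT|].
  move=> x0; split=> [|m mx]; apply: gg1; apply: g1P; rewrite ?mem_head ?mulf_neq0 ?fmorph_eq0 //.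
    by rewrite inE; apply/orP; right; apply/mapP; exists m; rewrite // mem_iota add0n ltnS.
  by rewrite mulf_neq0 ?expf_neq0.
have [D [D0 DP]] := fast_seq (fun n x => bd (n, x)) (cofinal_of_values hK Fcof)
  (fun n => rho0 n n).
pose s n := F (D n) * rho n n.
have s0 n : vlt (Some 0) (val_of (s n.+1)).
  by apply: vle_lt_trans (DP n); case: (bdP (n, D n)).
have s_inc n : vlt (val_of (s n)) (val_of (s n.+1)).
  by apply: vle_lt_trans (DP n); case: (bdP (n, D n)) => _ _ /(_ (D0 n))[].
have sC n : vlt (Some (ext_val F (C n))) (val_of (s n.+1)).
  by apply: vle_lt_trans (DP n); case: (bdP (n, D n)).
have s_fast n m : (m <= n)%N ->
    vlt (val_of (F (D n ^+ (p ^ m) * (ka n m).2) * rho n (n - m)%N)) (val_of (s n.+1 ^+ (p ^ m))).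
  move=> mn; case: (bdP (n, D n)) => _ _ /(_ (D0 n))[_ /(_ m mn) /= le].
  apply: vle_lt_trans le _; apply: vlt_le_trans (DP n) _; rewrite -/(s n.+1).
  have pm : (0 < p ^ m)%N by rewrite expn_gt0 p_gt0.
  rewrite -(prednK pm) exprS [val_of (_ * _)]val_mul.
  have := vleD (vle_refl (val_of (s n.+1))) (vge0X (p ^ m).-1 (vltW (s0 n))).
  by case: (val_of (s n.+1)) => //= g; rewrite addr0.
have /choice[z zP] (a : T) : exists z : N, kappa a -> forall P,
    vle (val_of (F (c a) ^+ P * s P)) (val_of (z - \sum_(n < P) F (c a) ^+ n * s n)).
  have [ka'|nka] := EM (kappa a); last by exists 0.
  have [z zP] := power_series_limit hlim (c_pos ka') s_inc sC.
  by exists z.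
exists z => q a P ainj ka' eP.
pose c' (b : nat) := if insub b is Some i then c (a i) else 0.
pose z' (b : nat) := if insub b is Some i then z (a i) else 0.
have c'E b (bq : (b < q)%N) : c' b = c (a (Ordinal bq)) by rewrite /c' insubT.
have z'E b (bq : (b < q)%N) : z' b = z (a (Ordinal bq)) by rewrite /z' insubT.
apply: (@limits_independent K p pK W N F rho beta d beta_inj betaW rho_sim rho0' rhoS D D0 ka
  ka0 kaP s_fast q c' z').
- by move=> b bq; rewrite c'E; apply: c_pos.
- move=> b b' bq bq' bb'; rewrite !c'E; apply: c_dis => //.
  by move=> /ainj [] /eqP; apply/negP.
- by move=> b n bq; rewrite c'E z'E; apply: zP.
by rewrite -[RHS]eP; apply: meval_eq => i /=; rewrite /z' valK.
Qed.

(** For passing from independence over [K] to independence over [L]: a relation over [L] becomes one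
    over [K] when raised to a suitable power of [p]. *)
Lemma insep_mpoly (L : valuedField) (j : valuedExt K L) n (P : {mpoly L[n]}) :
  purely_inseparable_ext p j -> exists N (Q : {mpoly K[n]}), P ^+ (p ^ N) = map_mpoly j Q.
Proof.
move=> jins; have pL : p \in [pchar {mpoly L[n]}].
  exact: (rmorph_pchar (mpolyC n (R := L))) (ext_pchar pK j).
elim/mpolyind: P => [|c' m P _ _ [N [Q E]]].
  by exists 0%N, 0; rewrite expr1 rmorph0.
have [N' [x xE]] := jins c'.
exists (N + N')%N, (((x ^+ (p ^ N)) *: 'X_[m] ^+ (p ^ (N + N'))) + Q ^+ (p ^ N')).
have QE : map_mpoly j (Q ^+ (p ^ N')) = P ^+ (p ^ (N + N')).
  by rewrite rmorphXn /= -E -exprM -expnD.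
have cE : map_mpoly j ((x ^+ (p ^ N)) *: 'X_[m] ^+ (p ^ (N + N'))) = (c' *: 'X_[m]) ^+ (p ^ (N + N')).
  rewrite map_mpolyZ !rmorphXn /= map_mpolyX exprZn; congr (_ *: _).
  by rewrite addnC expnD exprM xE.
by rewrite (pow_exprD pL) -QE -cE -rmorphD.
Qed.

Lemma trdeg_ge_tower (L N : valuedField) (j : valuedExt K L) (m : valuedExt L N) C :
  good_tower W j -> (forall g, exists a, g <= ext_val m a) -> has_limits (comp_ext j m) C ->
  trdeg_ge m kappa.
Proof.
move=> [jins jcof jt] mcof hlim.
have Fcof g : exists a, g <= ext_val (comp_ext j m) a.
  have [b gb] := mcof g; have [a ba] := jcof b; exists a.
  by apply: le_trans gb _; rewrite /= ext_val_mono.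
have [z zfree] := independent_limits (is_tower_comp m jt) Fcof hlim.
apply: (trdeg_geP (z := z)) => n a P ainj ka eP.
have [N' [Q QE]] := insep_mpoly P jins.
have pN' : (0 < p ^ N')%N by rewrite expn_gt0 p_gt0.
have : map_mpoly j Q = 0.
  rewrite (zfree n a Q ainj ka) ?rmorph0 //.
  have -> : map_mpoly (comp_ext j m) Q = map_mpoly m (map_mpoly j Q).
    by apply/mpolyP => u; rewrite !mcoeff_map_mpoly.
  by rewrite -QE !rmorphXn /= eP expr0n eqn0Ngt pN'.
by rewrite -QE => /eqP; rewrite expf_eq0 pN' => /eqP.
Qed.

End Transcendence.

(** * Degrees and the value and residue indices *)

Section FiniteDegree.
Variables (L : fieldType) (S : set L) (hS : is_subfield S).

Lemma span_dependent n m (e : 'I_n -> L) (b : 'I_m -> L) (M : 'I_m -> 'I_n -> L) :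
  (n < m)%N -> (forall i j, S (M i j)) -> (forall i, b i = \sum_j M i j * e j) ->
  exists u : 'I_m -> L, [/\ forall i, S (u i), \sum_i u i * b i = 0 & exists i, u i != 0].
Proof.
move=> nm SM bE; have [v vE] : exists v : {rmorphism sftype hS -> L}, forall x, v x = sf_val x.
  by exists (sf_morph hS).
have /choice[A' A'P] (x : 'I_m * 'I_n) : exists y : sftype hS, v y = M x.1 x.2.
  by have [y yE] := sf_ex hS (SM x.1 x.2); exists y; rewrite vE.
pose A i j := A' (i, j); have AP i j : v (A i j) = M i j by apply: A'P.
pose MA := \matrix_(i, j) A i j.
have : kermx MA != 0.
  rewrite kermx_eq0 /row_free; apply/eqP => rM.
  by have := rank_leq_col MA; rewrite rM leqNgt nm.
move=> /rowV0Pn[u /sub_kermxP uM u0].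
exists (fun i => v (u 0 i)); split=> [i||].
- by rewrite vE; apply: sf_valP.
- under eq_bigr => i _ do rewrite bE mulr_sumr.
  rewrite exchange_big big1 // => j _; under eq_bigr => i _ do rewrite mulrA.
  have -> : \sum_i (v (u 0 i) * M i j * e j) = v ((u *m MA) 0 j) * e j.
    rewrite mxE rmorph_sum mulr_suml; apply: eq_bigr => i _.
    by rewrite rmorphM mxE AP.
  by rewrite uM mxE rmorph0 mul0r.
apply: contrapT => H; case/eqP: u0; apply/rowP => i; rewrite mxE; apply/eqP.
by rewrite -(fmorph_eq0 v); apply/negPn/negP => ui; apply: H; exists i.
Qed.

Lemma finite_degree_bound : finite_degree S -> exists n, forall m (b : 'I_m -> L),
  (forall c : 'I_m -> L, (forall i, S (c i)) -> \sum_i c i * b i = 0 -> forall i, c i = 0) ->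
  (m <= n)%N.
Proof.
move=> [n [B [_ Bspan] Bn]]; exists n => m b bind; rewrite leqNgt; apply/negP => nm.
have /finite_seqP[l lE] : finite_set B by exists n.
pose l' := undup l; have sl : size l' = n.
  apply/card_eq_II; apply: card_eq_trans Bn; rewrite card_eq_sym lE.
  by rewrite (_ : [set` l] = [set` l']); [apply/card_uniq_seq/undup_uniq|
    apply/seteqP; split=> x /=; rewrite mem_undup].
have /choice[M MP] i : exists r : 'I_(size l') -> L, (forall j, S (r j)) /\
    b i = \sum_j r j * l'`_j.
  have [k [x [c [Bx Sc ->]]]] := Bspan (b i).
  exists (fun j : 'I_(size l') => \sum_(h | x h == l'`_j) c h); split=> [j|].
    by rewrite big_mkcond; apply: (sr_sum hS) => h _; case: ifP => // _; exact: (sr_0 hS).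
  under [RHS]eq_bigr => j _ do rewrite mulr_suml.
  rewrite (exchange_big_dep xpredT) //=; apply: eq_bigr => h _.
  have xl : x h \in l' by have := Bx h; rewrite mem_undup lE.
  have il : (index (x h) l' < size l')%N by rewrite index_mem.
  rewrite (big_pred1 (Ordinal il)) /= ?nth_index // => j /=.
  by rewrite -{1}(nth_index 0 xl) nth_uniq ?undup_uniq // eq_sym.
rewrite -sl in nm; have [||u [Su u0 [i /eqP ui]]] := @span_dependent _ _ (fun j => l'`_(j : 'I_(size l'))) b M nm.
- by move=> i; apply: (MP i).1.
- by move=> i; apply: (MP i).2.
by apply: ui; apply: bind u0 i.
Qed.

Lemma infinite_indep_degree B : infinite_set B ->
  (forall n (b c : 'I_n -> L), injective b -> (forall i, B (b i)) ->
     (forall i, S (c i)) -> \sum_i c i * b i = 0 -> forall i, c i = 0) -> ~ finite_degree S.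
Proof.
move=> /infinite_inj_nat[g [gB ginj]] Bfree /finite_degree_bound[n nP].
suff : (n.+1 <= n)%N by rewrite ltnn.
apply: (nP n.+1 (fun i => g i)) => c Sc c0.
by apply: (Bfree _ (fun i => g (i : 'I_n.+1))) => // i j /ginj; apply: val_inj.
Qed.

End FiniteDegree.

Section Indices.
Variables (K : valuedField) (p : nat) (pK : p \in [pchar K]) (W : vbasis K p).
Let p_prime : prime p := pcharf_prime pK.
Let k := residue K.
Let G := vgroup K.
Let pk : p \in [pchar k] := rs_pchar pK.

Lemma pbasis_infinite_degree (R : fieldType) (X : set R) : p \in [pchar R] ->
  infinite_set X -> pfree p (ppowers R p) X -> ~ finite_degree (ppowers R p).
Proof.
move=> pR Xinf Xf; have Fp := ppowers_pclosed pR.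
have [Z [XZ Zf Zall]] := pbasis_ex pR Fp Xf.
apply: (infinite_indep_degree (pclosed_is_subfield pR Fp) (B := pmonomials p Z)); last first.
  exact: (pmonomials_basis pR Fp Zf Zall).1.
move=> mf; apply: Xinf; apply: (sub_finite_set XZ); apply: contrapT => Zinf.
by apply: (Zinf); rewrite -(eq_finite_set (pmonomials_infinite pR Zinf)).
Qed.

Lemma pbasis_finite_degree (R : fieldType) (X : set R) : p \in [pchar R] ->
  finite_set X -> pfree p (ppowers R p) X -> (forall y, pclosure p (ppowers R p) X y) ->
  finite_degree (ppowers R p).
Proof.
move=> pR [n Xn] Xf Xall; have Fp := ppowers_pclosed pR.
exists (p ^ n)%N, (pmonomials p X); first exact: pmonomials_basis.
exact: (pmonomials_finite pR Fp Xf Xn).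
Qed.

Variables (A : set (set G)) (hA : A = cosets (pmultiples G p)).
Variables (B : set k) (hB : is_basis (ppowers k p) B).

Lemma vb2_infinite : infinite_set B <-> infinite_set (vb2 W).
Proof.
have kf := pclosed_is_subfield pk (ppowers_pclosed pk).
split=> [Binf Wfin|Winf [n Bn]].
  apply: (infinite_indep_degree kf Binf hB.1).
  exact: (pbasis_finite_degree pk Wfin (@vb2_free _ _ W) (vb2_span W)).
by apply: (pbasis_infinite_degree pk Winf (@vb2_free _ _ W)); exists n, B.
Qed.

Lemma coset_eq (x y : G) h : x = y + h *+ p ->
  [set u | pmultiples G p (u - x)] = [set u | pmultiples G p (u - y)].
Proof.
move=> ->; apply/seteqP; split=> u /= [v _ vE].
  by exists (v + h); rewrite // mulrnDl vE opprD addrA subrK.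
by exists (v - h); rewrite // mulrnBl vE opprD addrA.
Qed.

Lemma gspan_normal (l : seq G) g : uniq l -> gspan p [set` l] g ->
  exists n h, (forall b, (n b < p)%N) /\ g = \sum_(b <- l) b *+ n b + h *+ p.
Proof.
move=> ul [q [h [ql ->]]].
have [n [h' nE]] : exists (n : G -> nat) h',
    \sum_(b <- q) b + h *+ p = \sum_(b <- l) b *+ n b + h' *+ p.
  elim: q ql => [|b q IH] ql.
    by exists (fun=> 0%N), h; rewrite big_nil big1.
  have [|n [h' E]] := IH; first by move=> x xq; apply: ql; rewrite /= inE xq orbT.
  exists (fun x => (x == b) + n x)%N, h'; rewrite big_cons -addrA E addrA; congr (_ + _).
  have bl : b \in l by apply: ql; rewrite /= mem_head.
  under [RHS]eq_bigr => x _ do rewrite mulrnDr.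
  rewrite big_split; congr (_ + _); rewrite (bigD1_seq b) //= eqxx mulr1n big1 ?addr0 // => x xb.
  by rewrite (negbTE xb).
exists (fun b => n b %% p)%N, (\sum_(b <- l) b *+ (n b %/ p) + h').
split=> [b|]; first by rewrite ltn_mod prime_gt0.
rewrite nE mulrnDl addrA -sumrMnl -big_split; congr (_ + _); apply: eq_bigr => b _ /=.
by rewrite -mulrnA -mulrnDr addnC -divn_eq.
Qed.

(** Reduced combinations of a finite basis represent all cosets, and distinct basis elements always
    lie in distinct cosets. *)
Lemma vb1_infinite : infinite_set A <-> infinite_set (vb1 W).
Proof.
split=> [Ainf /finite_seqP[l0 lE]|Winf Afin].
  pose l := undup l0; have ul : uniq l := undup_uniq _.
  have {}lE : vb1 W = [set` l] by rewrite lE; apply/seteqP; split=> b /=; rewrite mem_undup.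
  pose F (t : seq nat) : set G := [set y | pmultiples G p (y - \sum_(x <- zip l t) x.1 *+ x.2)].
  apply: Ainf; apply: (@sub_finite_set _ _ (F @` [set` exps p (size l)])); last first.
    by apply: finite_image; apply: finite_seq.
  rewrite hA => _ [g _ <-]; have := vb1_span W g; rewrite lE => /(gspan_normal ul).
  move=> [n [h [np gE]]]; exists (map n l); first exact: map_exps.
  rewrite (coset_eq gE) /F (_ : \sum_(b <- l) _ = \sum_(x <- zip l (map n l)) x.1 *+ x.2) //.
  by elim: (l) => [|b q IH] /=; rewrite ?big_nil // !big_cons IH.
have [g [gW ginj]] := infinite_inj_nat Winf.
move: Afin; apply/infiniteP.
apply: (card_le_inj (f := fun n => [set y | pmultiples G p (y - g n)])) => [n _|n m _ _ E].
  by rewrite hA; exists (g n).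
apply: contrapT => nm.
have [h _ hE] : [set y | pmultiples G p (y - g m)] (g n).
  by rewrite -E /= subrr; exists 0; rewrite // mul0rn.
apply: (gfree_notin p_prime (@vb1_free _ _ W) (gW n) (Y := [set g m])) => [x ->//|/ginj//|].
exists [:: g m], h; rewrite big_seq1 addrC hE subrK; split=> // b.
by rewrite inE => /eqP ->.
Qed.

End Indices.

Lemma val_pow_mul_le (K : valuedField) (x y m : K) n :
  vle (val_of x) (val_of y) -> vle (val_of (x ^+ n * m)) (val_of (y ^+ n * m)).
Proof.
move=> xy; rewrite !val_mul; apply: vleD (vle_refl _).
by elim: n => [|n IH]; rewrite ?vle_refl // !exprS !val_mul; apply: vleD.
Qed.

Section Frobenius.
Variables (K : valuedField) (p : nat) (pK : p \in [pchar K]).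
Let p_gt0 : (0 < p)%N := prime_gt0 (pcharf_prime pK).

Lemma frob_mono : {mono @mulrn_map (vgroup K) p : x y / x <= y}.
Proof. by move=> x y; apply: oag_leMnE. Qed.

Lemma frob_valE x : val_of (pFrobenius_aut pK x) = omap (@mulrn_map (vgroup K) p) (val_of x).
Proof.
rewrite pFrobenius_autE; case vx: (val_of x) => [g|]; first exact: val_expn.
by rewrite (val_None vx) expr0n eqn0Ngt p_gt0 val0.
Qed.

(** With [K] as its own extension by Frobenius, the base field becomes [K^p], and the freeness of
    leading terms applies to the basis elements themselves. *)
Definition frob_ext : valuedExt K K :=
  @ValuedExt K K (pFrobenius_aut pK) (@mulrn_map (vgroup K) p) frob_mono frob_valE.

Lemma range_frob : range frob_ext = ppowers K p.
Proof. by []. Qed.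

End Frobenius.

(** * The p-degree of a spherically complete field *)

Section DegreeCriterion.
Variables (K : valuedField) (p : nat) (pK : p \in [pchar K]) (W : vbasis K p).
Let p_prime : prime p := pcharf_prime pK.
Let p_gt1 : (1 < p)%N := prime_gt1 p_prime.
Let p_gt0 : (0 < p)%N := prime_gt0 p_prime.
Let k := residue K.
Let G := vgroup K.

Lemma vlift_free : rfree p (ppowers K p) (vlift W) (vbset W).
Proof.
rewrite -(range_frob pK).
apply: (@lead_free K p pK W K (frob_ext pK) _ id (fun=> 1)) => // [b|b Wb].
  exact: oner_neq0.
rewrite expr1n mul1r [frob_ext pK _]pFrobenius_autE; apply: sim_refl.
by rewrite expf_neq0 // vlift_neq0.
Qed.

Lemma vlift_pfree : pfree p (ppowers K p) (vlift W @` vbset W).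
Proof. exact: (rfree_image vlift_free). Qed.

Lemma vbset_infinite_degree : infinite_set (vbset W) -> ~ finite_degree (ppowers K p).
Proof.
move=> Winf; apply: (pbasis_infinite_degree pK _ vlift_pfree) => If; apply: Winf.
suff WI : vlift W @` vbset W #= vbset W by rewrite -(eq_finite_set WI).
apply: inj_card_eq => a b /set_mem Wa /set_mem Wb.
exact: (rfree_inj pK (ppowers_pclosed pK) vlift_free).
Qed.

(* Given [x], the coefficients of its approximations by combinations of monomials
   form nested balls, because the value of a combination is the minimum of the
   values of its terms; a common point is an optimal approximation of [x]. *)
Lemma finite_vbset_span : sph_complete K -> finite_set (vbset W) ->
  forall x, redspan p (ppowers K p) (vlift W) (vbset W) x.
Proof.
move=> sK /finite_seqP[l0 l0E] x; pose l := undup l0; have ul : uniq l := undup_uniq _.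
have lW b : b \in l -> vbset W b by rewrite mem_undup l0E.
have Wl b : vbset W b -> b \in l by rewrite l0E /= mem_undup.
apply: contrapT => nx.
pose Lc (c : seq nat -> K) := lcomb p (fun t => c t ^+ p) (vlift W) l.
have LcB c c' : Lc c - Lc c' = Lc (fun t => c t - c' t).
  rewrite /Lc /lcomb -sumrB; apply: eq_bigr => t _.
  by rewrite -mulrBl -!(pFrobenius_autE pK) rmorphB.
have RLc c : redspan p (ppowers K p) (vlift W) (vbset W) (Lc c).
  by exists l, (fun t => c t ^+ p); split=> // t; exists (c t).
have [indep _ _] := @val_indep K p pK W l ul lW.
(* This ball contains the coefficient at [t] of every approximation at least as good as [c]; better
   approximations give smaller balls. *)
pose ball t (c : seq nat -> K) : set K := [set d |
  vle (val_of (x - Lc c)) (val_of ((d - c t) ^+ p * mon (vlift W) l t))].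
have powD (a b m : K) g : vle g (val_of (a ^+ p * m)) -> vle g (val_of (b ^+ p * m)) ->
    vle g (val_of ((a + b) ^+ p * m)).
  by rewrite -!(pFrobenius_autE pK) rmorphD mulrDl; apply: val_add_ge.
have /choice[d dP] t : exists d, t \in exps p (size l) -> forall c, ball t c d.
  have [tl|_] := boolP (t \in exps p (size l)); last by exists 0.
  have [||d dP] := sK (range (ball t)).
  - move=> _ [c _ <-]; split; last first.
      by exists (c t); rewrite /ball /= subrr expr0n eqn0Ngt p_gt0 mul0r val0 vle_None.
    move=> u v w Bu Bv uvw; rewrite /ball /= -[w - _](subrKA u); apply: (powD) => //.
    apply: vle_trans (val_pow_mul_le _ _ uvw).
    rewrite -[v - u](subrKA (c t)) -[c t - u]opprB; apply: (powD) => //.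
    by rewrite -!(pFrobenius_autE pK) rmorphN /= mulNr valN pFrobenius_autE.
  - move=> _ _ [c _ <-] [c' _ <-].
    have sub c1 c2 : vle (val_of (x - Lc c1)) (val_of (x - Lc c2)) -> ball t c2 `<=` ball t c1.
      move=> le u Bu; rewrite /ball /= -[u - _](subrKA (c2 t)); apply: (powD).
        exact: vle_trans Bu.
      apply: vle_trans (indep (fun t => c2 t - c1 t) t tl); rewrite -/(Lc _) -LcB.
      rewrite -[Lc c2 - _](subrKA x); apply: val_add_ge; last exact: vle_refl.
      by rewrite [val_of (Lc c2 - x)]valBC.
    have /orP[le|le] := vle_total (val_of (x - Lc c)) (val_of (x - Lc c')); [right|left]; exact: sub.
  by exists d => _ c; apply: dP; exists c.
have best c : vle (val_of (x - Lc c)) (val_of (x - Lc d)).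
  rewrite -[x - Lc d](subrKA (Lc c)); apply: val_add_ge; first exact: vle_refl.
  rewrite [val_of (Lc c - _)]valBC LcB {2}/Lc /lcomb big_seq.
  by apply: val_sum_ge => t tl; apply: (dP t tl c).
have xd : x - Lc d != 0 by rewrite subr_eq0; apply: contra_notN nx => /eqP ->.
(* The error itself has the leading term of a combination, and adding this combination would improve
   the optimal approximation. *)
have [y Ry xy] := approx_base pK W xd.
have [c cE] : exists c, Lc d + y = Lc c.
  have : redspan p (ppowers K p) (vlift W) [set` l] (Lc d + y).
    apply: (redspanD p_gt1 (ppowers_subring pK)); last by apply: redspan_sub Ry => b /Wl.
    by apply: redspan_sub (RLc d) => b /Wl.
  move=> /(redspan_seq p_gt1 (ppowers_subring pK) ul)[c Sc ->].
  have /choice[c' c'P] t : exists c', c' ^+ p = c t by have [c' _ <-] := Sc t; exists c'.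
  by exists c'; apply: eq_bigr => t _; rewrite c'P.
by move: xy (best c); rewrite /sim -cE opprD addrA /vlt => /negbTE ->.
Qed.

Lemma finite_vbset_degree : sph_complete K -> finite_set (vbset W) ->
  finite_degree (ppowers K p).
Proof.
move=> sK Wf; have Fp := ppowers_pclosed pK.
apply: (pbasis_finite_degree pK (finite_image _ Wf) vlift_pfree) => y.
have := finite_vbset_span sK Wf y; apply: (redspan_min (pclosure_subring pK Fp _)).
  exact: pclosure_base.
by move=> b Wb; apply: (pclosure_gen pK Fp); exists b.
Qed.

Variables (A : set (set G)) (hA : A = cosets (pmultiples G p)).
Variables (B : set k) (hB : is_basis (ppowers k p) B).

Lemma infinite_AB : ~ finite_set (A `*` B) <-> infinite_set A \/ infinite_set B.
Proof.
have [a Aa] : A !=set0 by rewrite hA; exists [set y | pmultiples G p (y - 0)]; exists 0.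
have [b Bb] : B !=set0.
  have [[|n] [b [c [Bb _ one]]]] := hB.2 1; last by exists (b ord0).
  by move: one; rewrite big_ord0 => /eqP; rewrite oner_eq0.
split=> [ABinf|[Ainf|Binf] ABfin].
- have [Af|] := EM (finite_set A); [right=> Bf|by left].
  by apply: ABinf; apply: finite_setX.
- apply: Ainf; apply: (sub_finite_set _ (finite_image fst ABfin)) => x Ax.
  by exists (x, b).
apply: Binf; apply: (sub_finite_set _ (finite_image snd ABfin)) => x Bx.
by exists (a, x).
Qed.

Lemma vbset_infinite : ~ finite_set (A `*` B) <-> infinite_set (vbset W).
Proof.
rewrite infinite_AB (vb1_infinite pK W hA) (vb2_infinite pK W hB).
split=> [[inf|inf] Wf|Winf].
- have h : {in inl @^-1` vbset W &, injective (@inl G k)} by move=> ? ? _ _ [].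
  by apply: inf; exact: (finite_preimage h Wf).
- have h : {in inr @^-1` vbset W &, injective (@inr G k)} by move=> ? ? _ _ [].
  by apply: inf; exact: (finite_preimage h Wf).
have [f1|] := EM (finite_set (vb1 W)); [right=> f2|by left].
apply: Winf; apply: (@sub_finite_set _ _ (inl @` vb1 W `|` inr @` vb2 W)).
  by move=> [g|a] W'; [left; exists g|right; exists a].
by rewrite finite_setU; split; apply: finite_image.
Qed.

Lemma degree_criterion : sph_complete K ->
  ~ finite_set (A `*` B) <-> ~ finite_degree (ppowers K p).
Proof.
move=> sK; split=> [/vbset_infinite|]; first exact: vbset_infinite_degree.
move=> nf ABf; apply: nf; apply: (finite_vbset_degree sK).
by apply: contrapT => /vbset_infinite /(_ ABf).
Qed.

End DegreeCriterion.

(** * Maximality of the field of p-th roots *)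

Section MaximalRoots.
Variables (K : valuedField) (p : nat) (pK : p \in [pchar K]).
Variables (E : valuedField) (i : valuedExt K E) (hE : is_pth_roots p i).
Let p_prime : prime p := pcharf_prime pK.
Let p_gt0 : (0 < p)%N := prime_gt0 p_prime.
Let pE : p \in [pchar E] := ext_pchar pK i.
Let k := residue K.
Let G := vgroup K.

(** The map takes [x] to its [p]-th root, inverting Frobenius. It is not the embedding [i], but it
    transports intrinsic properties such as maximality. *)
Lemma pth_root_iso : exists psi : valuedExt K E, onto psi.
Proof.
have /choice[r rP] := hE.1.
have r_inj x y : x ^+ p = y ^+ p -> x = y :> E by apply: (exprp_inj pE).
have rB : zmod_morphism r.
  move=> x y; apply: r_inj; rewrite -[in RHS](pFrobenius_autE pE) rmorphB /=.
  by rewrite !pFrobenius_autE !rP rmorphB.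
have rM : monoid_morphism r.
  by split=> [|x y]; apply: r_inj; rewrite ?exprMn !rP ?rmorph1 ?expr1n ?rmorphM.
pose rr : {rmorphism K -> E} := HB.pack r (GRing.isZmodMorphism.Build K E r rB)
  (GRing.isMonoidMorphism.Build K E r rM).
have /choice[e eP] (g : G) : exists h : vgroup E, h *+ p = ext_val i g.
  have [x vx] := val_onto g; have [|h vh] := @val_neq0 _ (r x).
    apply: contraPneq vx => rx; have /esym/eqP := rP x.
    rewrite rx expr0n eqn0Ngt p_gt0 fmorph_eq0 => /eqP ->.
    by rewrite val0.
  by exists h; apply: val_pth (rP x) vh vx.
have eB : zmod_morphism e.
  by move=> x y; apply: (oag_mulIn p_gt0); rewrite mulrnBl !eP raddfB.
pose ee : {additive G -> vgroup E} := HB.pack e (GRing.isZmodMorphism.Build _ _ e eB).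
have e_mono : {mono ee : x y / x <= y}.
  by move=> x y; rewrite -(oag_leMnE (e x) (e y) p_gt0) !eP ext_val_mono.
have rV x : val_of (rr x) = omap ee (val_of x).
  have [->|x0] := eqVneq x 0; first by rewrite rmorph0 !val0.
  have [g vx] := val_neq0 x0; rewrite vx.
  case vr: (val_of (r x)) => [h|]; last first.
    have := rP x; rewrite (val_None vr) expr0n eqn0Ngt p_gt0 => /esym/eqP.
    by rewrite fmorph_eq0 (negbTE x0).
  congr Some; apply: (oag_mulIn p_gt0); rewrite eP; apply: val_pth (rP x) vr vx.
exists (ValuedExt e_mono rV) => y; have [x yx] := hE.2 y; exists x.
by apply: r_inj; rewrite [LHS]rP yx.
Qed.

(** Composed with the isomorphism [psi], an immediate extension of [E] becomes one of [K]. *)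
Lemma maximal_pth : maximal K -> maximal E.
Proof.
move=> hK L f [fv fr]; have [psi psi_onto] := pth_root_iso.
suff imm : immediate (comp_ext psi f) by move=> y; have [x <-] := hK L _ imm y; exists (psi x).
split=> [g|a].
  have [h <-] := fv g; have [y vy] := val_onto h; have [x xy] := psi_onto y.
  move: vy; rewrite -xy ext_valE; case: (val_of x) => //= b [<-]; by exists b.
have [b <-] := fr a; have [y y0 <-] := rs_onto b; have [x xy] := psi_onto y.
have x0 : vle (Some 0) (val_of x) by rewrite -(ext_ge0 psi) xy.
by exists (rs x); rewrite !ext_res_rs //= xy.
Qed.

Variable W : vbasis K p.

Lemma pth_torsion : torsion_quotient (range (ext_val i)).
Proof. by move=> g; have [a ga] := pth_value hE g; exists p => //; exists a. Qed.

(** Division by [p] carries distinct classes modulo [pvK] to distinct classes modulo [vK] in the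
    larger value group. *)
Lemma pth_infinite_cosets : infinite_set (vb1 W) -> infinite_set (cosets (range (ext_val i))).
Proof.
move=> /infinite_inj_nat[g [gW ginj]]; have [psi _] := pth_root_iso.
have /choice[h hP] n : exists h, h *+ p = ext_val i (g n).
  have [x vx] := val_onto (g n); have [y yx] := hE.1 x.
  have [|b vb] := @val_neq0 _ y; last by exists b; apply: val_pth yx vb vx.
  apply: contraPneq vx => y0; have /esym/eqP := yx.
  by rewrite y0 expr0n eqn0Ngt p_gt0 fmorph_eq0 => /eqP ->; rewrite val0.
apply/infiniteP.
apply: (card_le_inj (f := fun n => [set y | range (ext_val i) (y - h n)])) => [n _|n m _ _ Enm].
  by exists (h n).
apply: contrapT => nm.
have [a _ aE] : [set y | range (ext_val i) (y - h m)] (h n).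
  by rewrite -Enm /= subrr; exists 0; rewrite // raddf0.
have gE : g n = g m + a *+ p.
  by apply: (@ext_val_inj _ _ i); rewrite raddfD raddfMn aE -!hP mulrnBl addrCA subrr addr0.
apply: (gfree_notin p_prime (@vb1_free _ _ W) (gW n) (Y := [set g m])) => [x ->//|/ginj//|].
exists [:: g m], a; rewrite big_seq1 gE; split=> // b.
by rewrite inE => /eqP ->.
Qed.

Lemma pth_res_root (a : k) : exists b, b ^+ p = ext_res i a.
Proof.
have [x x0 <-] := rs_onto a; have [y yx] := hE.1 x.
have ix0 : vle (Some 0) (val_of (y ^+ p)) by rewrite yx ext_ge0.
have y0 : vle (Some 0) (val_of y).
  by have := @val_exp_leE E 1 y p p_gt0; rewrite expr1n val1 ix0 => <-.
by exists (rs y); rewrite -rsX // yx ext_res_rs.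
Qed.

Lemma pth_res_algebraic : algebraic_ext (ext_res i).
Proof.
move=> a; have [y y0 <-] := rs_onto a; have [x yx] := hE.2 y.
have x0 : vle (Some 0) (val_of x) by rewrite -(ext_ge0 i) -yx vge0X.
by apply: (alg_of_pth pK (x := rs x)); rewrite -rsX // yx -ext_res_rs.
Qed.

(** The [p]-th roots of the members of [B] are independent over [Kv]: the [p]-th power of a relation
    is one for [B] over the [p]-th powers. *)
Lemma pth_res_degree B : is_basis (ppowers k p) B -> infinite_set B ->
  ~ finite_degree (range (ext_res i)).
Proof.
move=> [Bfree _] Binf; have /choice[r rP] := pth_res_root.
have pk : p \in [pchar residue E] := rs_pchar pE.
have r_inj a b : r a = r b -> a = b.
  by move=> ab; have := rP a; rewrite ab rP => /fmorph_inj.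
apply: (infinite_indep_degree (range_is_subfield (ext_res i)) (B := r @` B)).
  by move=> rf; apply: Binf; rewrite -(eq_finite_set (inj_card_eq _ : r @` B #= B)) //; apply: in2W.
move=> n b c binj bB cK sum0 j.
have /choice[d dP] l : exists d, B d /\ r d = b l by have [d ? <-] := bB l; exists d.
have /choice[x xP] l : exists x, ext_res i x = c l by have [x _ <-] := cK l; exists x.
have dinj : injective d by move=> l l' dl; apply: binj; rewrite -(dP l).2 -(dP l').2 dl.
have sum0' : \sum_l x l ^+ p * d l = 0.
  apply: (fmorph_inj (ext_res i)); rewrite rmorph0 rmorph_sum.
  transitivity ((\sum_l c l * b l) ^+ p); last by rewrite sum0 expr0n eqn0Ngt p_gt0.
  rewrite -(pFrobenius_autE pk) rmorph_sum; apply: eq_bigr => l _.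
  by rewrite rmorphM rmorphXn /= xP -rP (dP l).2 pFrobenius_autE exprMn.
have : x j ^+ p = 0.
  apply: (Bfree n d (fun l => x l ^+ p) dinj (fun l => (dP l).1) _ sum0') => l.
  by exists (x l).
by move=> /eqP; rewrite expf_eq0 p_gt0 /= => /eqP xj; rewrite -xP xj rmorph0.
Qed.

End MaximalRoots.

(** * Completions *)

(** The small sets of a Cauchy filter, thickened to balls of radius [g], form a nest; a common point
    is a limit. *)
Lemma sph_val_complete (M : valuedField) : sph_complete M -> val_complete M.
Proof.
move=> sM F [F0 Ff] Fc.
have /choice[A AP] g : exists A, F A /\ forall x y, A x -> A y -> val_ball g x y.
  by have [A ? ?] := Fc g; exists A.
have FA g h : F (A g `&` A h) by apply: filterI; [case: (AP g)|case: (AP h)].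
have ne g h : (A g `&` A h) !=set0.
  by apply/set0P; apply: contra_notN F0 => /eqP E0; rewrite -E0.
pose ball g := [set z | exists2 x, A g x & vlt (Some g) (val_of (z - x))].
have ballA g z x : ball g z -> A g x -> vlt (Some g) (val_of (z - x)).
  move=> [y Ay zy] Ax; rewrite -[z - x](subrKA y); apply: val_add_gt => //.
  exact: ((AP g).2 x y Ax Ay).
have [_ [g _ <-]|_ _ [g _ <-] [h _ <-]|z zP] := sM (range ball); last first.
- exists z => g; apply: (filterS _ (AP g).1) => x Ax.
  by rewrite /val_ball /= valBC; apply: ballA Ax; apply: zP; exists g.
- have sub g1 g2 : g1 <= g2 -> ball g2 `<=` ball g1.
    move=> g12 y By; have [x [A1 A2]] := ne g1 g2; exists x => //.
    by apply: vle_lt_trans (ballA _ _ _ By A2).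
  by have /orP[gh|hg] := oag_total g h; [right|left]; apply: sub.
split; last by have [x [Ax _]] := ne g g; exists x; exists x; rewrite // subrr val0 vltNone.
move=> x y w [a Aa xa] By xyw; exists a => //; rewrite -[w - a](subrKA x).
apply: val_add_gt => //; apply: vlt_le_trans xyw; rewrite -[y - x](subrKA a).
by apply: val_add_gt; [apply: ballA By Aa|rewrite valBC].
Qed.

Definition dense_ext (L M : valuedField) (f : valuedExt L M) : Prop :=
  forall y g, exists x, val_ball g y (f x).

Lemma dense_immediate (L M : valuedField) (f : valuedExt L M) : dense_ext f -> immediate f.
Proof.
move=> fd; apply: immediate_of_sim => y /val_neq0[g vy].
by have [x xy] := fd y g; exists x; rewrite /sim vy valBC.
Qed.

Section DenseLimits.
Variables (L X Y : valuedField) (k : valuedExt L X) (c : valuedExt L Y).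

(** The graph of the canonical map between two completions: the same elements of [L] approximate [y]
    and [u]. The relation is symmetric, which gives surjectivity of the map. *)
Definition common_limit (y : X) (u : Y) : Prop := forall g : vgroup L, exists x : L,
  vlt (Some (ext_val k g)) (val_of (y - k x)) /\ vlt (Some (ext_val c g)) (val_of (u - c x)).

Hypotheses (kd : dense_ext k) (cd : dense_ext c).

Let cval g : exists a, ext_val c a = g := (dense_immediate cd).1 g.

Lemma ext_ball x x' g : vlt (Some (ext_val k g)) (val_of (k x - k x')) ->
  vlt (Some (ext_val c g)) (val_of (c x - c x')).
Proof.
rewrite -!rmorphB !ext_valE.
by rewrite (ext_val_lt k (Some g)) (ext_val_lt c (Some g)).
Qed.

Lemma common_limit_ex : val_complete Y -> forall y, exists u, common_limit y u.
Proof.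
move=> Yc y; pose F : set_system Y := [set A | exists g : vgroup L, forall x,
  vlt (Some (ext_val k g)) (val_of (y - k x)) -> A (c x)].
have near g : exists x, vlt (Some (ext_val k g)) (val_of (y - k x)).
  by have [x xy] := kd y (ext_val k g); exists x; rewrite valBC.
have Fp : ProperFilter F.
  split; first by move=> [g gP]; have [x /gP] := near g.
  split; first by exists 0.
    move=> P Q [g gP] [h hQ]; have [b bP] := oag_max_ex [:: g; h]; exists b => x xb.
    by split; [apply: gP|apply: hQ]; apply: vle_lt_trans xb; rewrite /= ext_val_mono bP // !inE eqxx ?orbT.
  by move=> P Q PQ [g gP]; exists g => x /gP/PQ.
have [h|u uP] := Yc F Fp.
  have [g <-] := cval h; exists [set c x | x in [set x | vlt (Some (ext_val k g)) (val_of (y - k x))]].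
    by exists g => x xg; exists x.
  move=> _ _ [x xg <-] [x' xg' <-]; rewrite /val_ball /=; apply: ext_ball.
  by rewrite -[k x' - k x](subrKA y); apply: val_add_gt; rewrite // valBC.
exists u => g; have [g' gP] := uP (ext_val c g).
have [b bP] := oag_max_ex [:: g; g']; have [x xb] := near b; exists x.
split; first by apply: vle_lt_trans xb; rewrite /= ext_val_mono bP // mem_head.
rewrite valBC; apply: gP; apply: vle_lt_trans xb.
by rewrite /= ext_val_mono bP // !inE eqxx orbT.
Qed.

Lemma common_limit_uniq y u u' : common_limit y u -> common_limit y u' -> u = u'.
Proof.
move=> yu yu'; apply/eqP; rewrite -subr_eq0; apply/negPn/negP => /val_neq0[h vh].
have [g gh] := cval h; have [x [xy xu]] := yu g; have [x' [xy' xu']] := yu' g.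
have : vlt (Some h) (val_of (u - u')); last by rewrite vh vlt_irr.
rewrite -gh -[u - u'](subrKA (c x)); apply: val_add_gt => //.
rewrite -[c x - u'](subrKA (c x')); apply: val_add_gt; last by rewrite valBC.
by apply: ext_ball; rewrite -[k x - k x'](subrKA y); apply: val_add_gt; rewrite // valBC.
Qed.

Lemma common_limit_base x : common_limit (k x) (c x).
Proof. by move=> g; exists x; rewrite !subrr !val0. Qed.

Lemma common_limitB y u y' u' : common_limit y u -> common_limit y' u' ->
  common_limit (y - y') (u - u').
Proof.
move=> yu yu' g; have [x [xy xu]] := yu g; have [x' [xy' xu']] := yu' g.
have swap (M : zmodType) (a b e d : M) : a - b - (e - d) = (a - e) - (b - d).
  by rewrite !opprB [d - e]addrC addrACA [- b + d]addrC.
by exists (x - x'); rewrite !rmorphB; split; rewrite swap; apply: val_add_gt; rewrite // valN.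
Qed.

Lemma dense_lower (M : valuedField) (f : valuedExt L M) (y : M) : dense_ext f ->
  exists b, vle (Some (ext_val f b)) (val_of y).
Proof.
move=> fd; case vy: (val_of y) => [h|]; last by exists 0; apply: vle_None.
by have [a ah] := (dense_immediate fd).1 h; exists a; rewrite ah vle_refl.
Qed.

(** Continuity of multiplication, with [b] and [h] taken in [vL] so that one choice works in both
    completions. *)
Lemma mul_near (M : valuedField) (f : valuedExt L M) (y y' w w' : M) b g h :
  b <= h -> g <= b + h ->
  vle (Some (ext_val f b)) (val_of y) -> vle (Some (ext_val f b)) (val_of y') ->
  vlt (Some (ext_val f h)) (val_of (y - w)) -> vlt (Some (ext_val f h)) (val_of (y' - w')) ->
  vlt (Some (ext_val f g)) (val_of (y * y' - w * w')).
Proof.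
move=> bh gbh yb yb' yw yw'.
have wb : vle (Some (ext_val f b)) (val_of w).
  rewrite -[w](subKr y); apply: val_add_ge => //; rewrite valN; apply: vltW.
  by apply: vle_lt_trans yw; rewrite /= ext_val_mono.
have mul (u v : M) : vle (Some (ext_val f b)) (val_of u) -> vlt (Some (ext_val f h)) (val_of v) ->
    vlt (Some (ext_val f g)) (val_of (u * v)).
  move=> ub vh; apply: (@vle_lt_trans _ (vadd (Some (ext_val f b)) (Some (ext_val f h)))).
    by rewrite /= -raddfD ext_val_mono.
  rewrite val_mul vaddC; apply: (@vlt_le_trans _ (vadd (val_of v) (Some (ext_val f b)))).
    by rewrite vlt_add2r.
  by rewrite vaddC; apply: vleD; rewrite // vle_refl.
rewrite (_ : y * y' - w * w' = y' * (y - w) + w * (y' - w')).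
  by apply: val_add_gt; apply: mul.
by rewrite mulrBr mulrBr [y' * y]mulrC [y' * w]mulrC addrA subrK.
Qed.

Lemma common_limitM y u y' u' : common_limit y u -> common_limit y' u' ->
  common_limit (y * y') (u * u').
Proof.
move=> yu yu' g; have [b1 b1P] := dense_lower y kd; have [b2 b2P] := dense_lower y' kd.
have [b3 b3P] := dense_lower u cd; have [b4 b4P] := dense_lower u' cd.
have [nb nbP] := oag_max_ex [:: - b1; - b2; - b3; - b4]; pose b := - nb.
have low (M : valuedField) (f : valuedExt L M) (v : M) b' : - b' \in [:: - b1; - b2; - b3; - b4] ->
    vle (Some (ext_val f b')) (val_of v) -> vle (Some (ext_val f b)) (val_of v).
  move=> /nbP le; apply: vle_trans; rewrite /= ext_val_mono /b.
  by have := oag_leD2l (b' - nb) _ _ le; rewrite addrAC subrr add0r subrK.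
have [h hP] := oag_max_ex [:: b; g - b].
have bh : b <= h by apply: hP; rewrite mem_head.
have gbh : g <= b + h.
  have := oag_leD2l b _ _ (hP (g - b) _); rewrite !inE eqxx orbT => /(_ isT).
  by rewrite addrC subrK.
have [x [xy xu]] := yu h; have [x' [xy' xu']] := yu' h.
exists (x * x'); rewrite !rmorphM; split; apply: (mul_near bh gbh) => //.
- by apply: low b1P; rewrite !inE eqxx ?orbT.
- by apply: low b2P; rewrite !inE eqxx ?orbT.
- by apply: low b3P; rewrite !inE eqxx ?orbT.
- by apply: low b4P; rewrite !inE eqxx ?orbT.
Qed.

End DenseLimits.

Lemma common_limit_sym (L X Y : valuedField) (k : valuedExt L X) (c : valuedExt L Y) y u :
  common_limit k c y u -> common_limit c k u y.
Proof. by move=> yu g; have [x []] := yu g; exists x. Qed.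

(** Limits exist because the target is complete and are unique because [L] is dense in it;
    approximating by the same elements of [L] respects differences and products. *)
Lemma completion_iso (L X Y : valuedField) (k : valuedExt L X) (c : valuedExt L Y) :
  is_completion k -> is_completion c ->
  exists phi : {rmorphism X -> Y}, onto phi /\ forall x, phi (k x) = c x.
Proof.
move=> [kd Xc] [cd Yc]; have /choice[phi phiP] := common_limit_ex kd cd Yc.
have phiE y u : common_limit k c y u -> phi y = u.
  by move=> yu; apply: (common_limit_uniq cd (phiP y) yu).
have phiB : zmod_morphism phi.
  by move=> x y; apply: phiE; apply: common_limitB; apply: phiP.
have phiM : monoid_morphism phi.
  split=> [|x y].
    by rewrite -(rmorph1 k) -(rmorph1 c); apply: phiE; apply: common_limit_base.
  by apply: phiE; apply: (common_limitM kd cd); apply: phiP.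
pose phi' : {rmorphism X -> Y} := HB.pack phi (GRing.isZmodMorphism.Build X Y phi phiB)
  (GRing.isMonoidMorphism.Build X Y phi phiM).
exists phi'; split=> [u|x].
  have [y uy] := common_limit_ex cd kd Xc u; exists y.
  exact/phiE/common_limit_sym.
exact/phiE/common_limit_base.
Qed.

Lemma has_degree_iso (L X Y : fieldType) (k : L -> X) (c : L -> Y) (phi : {rmorphism X -> Y})
    T (A : set T) : onto phi -> (forall x, phi (k x) = c x) ->
  has_degree (range k) A -> has_degree (range c) A.
Proof.
move=> phi_onto phik [B [Bfree Bspan] BA]; exists (phi @` B); last first.
  apply: card_eq_trans BA; apply: inj_card_eq => x y _ _; exact: fmorph_inj.
split=> [n b d binj bB dS sum0 i|u].
  have /choice[b' b'P] j : exists x, B x /\ phi x = b j by have [x ? <-] := bB j; exists x.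
  have /choice[d' d'P] j : exists x, c x = d j by have [x _ <-] := dS j; exists x.
  have : k (d' i) = 0.
    apply: (Bfree n b' (k \o d')) => [j j' bj|j|j|].
    - by apply: binj; rewrite -(b'P j).2 -(b'P j').2 bj.
    - by case: (b'P j).
    - by exists (d' j).
    apply: (fmorph_inj phi); rewrite rmorph0 rmorph_sum -[RHS]sum0; apply: eq_bigr => j _.
    by rewrite rmorphM /= phik (b'P j).2 d'P.
  by move=> ki; rewrite -d'P -phik ki rmorph0.
have [y yu] := phi_onto u; have [n [b [d [bB dS yE]]]] := Bspan y.
exists n, (phi \o b), (phi \o d); split=> [j|j|].
- by exists (b j).
- by have [x _ xd] := dS j; exists x => //; rewrite /= -xd phik.
by rewrite -yu yE rmorph_sum; apply: eq_bigr => j _; rewrite rmorphM.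
Qed.

Lemma countable_cofinal_seq (G : oagType) : has_countable_cofinality G ->
  exists C : nat -> G, forall g, exists n, g <= C n.
Proof.
move=> [S [Sc Scof]]; have [f [_ finj]] := card_le_ex 0%N Sc.
(* The value is [0] at indices that code no element of the cofinal set. *)
exists (fun n => xget 0 [set c | S c /\ f c = n]) => g.
have [c Sc' gc] := Scof g; exists (f c); case: xgetP => [x _ [Sx fx]|/(_ c)[]//].
by rewrite (finj x c Sx Sc' fx).
Qed.

(** * Elements with distinct leading terms *)

Section Separated.
Variables (K : valuedField) (p : nat) (pK : p \in [pchar K]).
Let p_prime : prime p := pcharf_prime pK.
Let p_gt1 : (1 < p)%N := prime_gt1 p_prime.
Let k := residue K.
Let G := vgroup K.

Lemma coset_positive (g : G) : nontrivial_valuation K -> exists h,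
  vlt (Some 0) (Some h) /\ pmultiples G p (h - g).
Proof.
move=> /positive_ex[b b0].
have mulpos (x : G) n : (0 < n)%N -> vlt (Some 0) (Some x) -> vlt (Some 0) (Some (x *+ n)).
  case: n => // n _ x0; elim: n => // n IH; rewrite mulrS.
  have := vltD (isT : Some (0 : G) != None) x0 (vltW IH); rewrite /= addr0; exact.
have [->|g0] := eqVneq g 0.
  exists (b *+ p); split; last by exists b; rewrite // subr0.
  by apply: mulpos; rewrite // ltnW.
have [le|lt] := boolP (g <= 0); last first.
  by exists g; split; [exact: lt|exists 0; rewrite // mul0rn subrr].
(* For negative [g], this positive element differs from [g] by [- p] times [g]. *)
exists ((- g) *+ p.-1); split; last first.
  exists (- g) => //; rewrite -{1}(prednK (prime_gt0 p_prime)) mulrSr.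
  by [].
apply: mulpos; first by rewrite -ltnS prednK // ltnW.
rewrite /vlt /=; apply: contra g0 => le'; rewrite eq_le le /=.
by have := oag_leD2r g le'; rewrite addNr add0r.
Qed.

Variables (A : set (set G)) (hA : A = cosets (pmultiples G p)).
Variables (B : set k) (hB : is_basis (ppowers k p) B).
Variables (T : Type) (kappa : set T) (hkappa : is_card_max kappa A B).

Lemma separated_ex : nontrivial_valuation K -> exists c : T -> K,
  (forall a, kappa a -> vlt (Some 0) (val_of (c a)) /\ c a != 0) /\
  (forall a b, kappa a -> kappa b -> a <> b ->
     c a != c b /\ vle (val_of (c a - c b)) (val_of (c a))).
Proof.
move=> hK; have [_ _ [kA|kB]] := hkappa.
  have [|f [fA finj]] := @card_le_ex _ _ kappa A set0; first by have /card_eqPle[] := kA.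
  have /choice[c cP] a : exists x : K, kappa a -> exists g, [/\ vlt (Some 0) (Some g),
      val_of x = Some g & f a = [set y | pmultiples G p (y - g)]].
    have [ka|nk] := EM (kappa a); last by exists 0.
    have := fA a ka; rewrite hA => -[g _ fE]; have [h [h0 [m _ hm]]] := coset_positive g hK.
    have [x vx] := val_onto h; exists x => _; exists h; split=> //.
    by rewrite -fE -(@coset_eq K p h g m) // hm addrC subrK.
  exists c; split=> [a ka|a b ka kb ab].
    by have [g [g0 vg _]] := cP a ka; rewrite -val_eqNone vg.
  have [g [_ vg fa]] := cP a ka; have [h [_ vh fb]] := cP b kb.
  have gh : val_of (c b) <> val_of (c a).
    by rewrite vg vh => -[E]; apply: ab; apply: finj; rewrite // fa fb E.
  split; first by apply/eqP => E; rewrite E in gh.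
  by apply/negPn/negP => /sim_val.
have [|f [fB finj]] := @card_le_ex _ _ kappa B 0; first by have /card_eqPle[] := kB.
have [g g0] := positive_ex hK; have [t vt] := val_onto g.
have /choice[l lP] b : exists x : K, vle (Some 0) (val_of x) /\ rs x = b.
  by have [x ? ?] := rs_onto b; exists x.
have B0 b : B b -> b != 0.
  move=> Bb; apply/eqP => b0; have := hB.1 1 (fun=> b) (fun=> 1).
  move=> /(_ _ (fun=> Bb)); have inj1 : injective (fun _ : 'I_1 => b) by move=> x y; rewrite !ord1.
  move=> /(_ inj1) H; have /eqP : (1 : k) = 0; last by rewrite oner_eq0.
  by apply: (H _ _ ord0) => [_|]; [exists 1; rewrite ?expr1n|rewrite big_ord1 b0 mulr0].
have val0E x : vle (Some 0) (val_of x) -> rs x != 0 -> val_of x = Some 0.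
  move=> x0; rewrite rs_eq0 // => nlt; have [<-//|lt] := vle_eqVlt x0.
  by rewrite lt in nlt.
have vl b : B b -> val_of (l b) = Some 0.
  by move=> /B0 b0; have [l0 lb] := lP b; apply: val0E; rewrite ?lb.
exists (fun a => t * l (f a)); split=> [a ka|a b ka kb ab].
  have vta : val_of (t * l (f a)) = Some g by rewrite val_mul vl ?vt /= ?addr0 //; apply: fB.
  by rewrite -val_eqNone vta.
have vab : val_of (l (f a) - l (f b)) = Some 0.
  have [[l0 la] [m0 lb]] := (lP (f a), lP (f b)).
  apply: val0E; first by apply: val_add_ge; rewrite ?valN.
  by rewrite rsD ?valN // rsN la lb subr_eq0; apply/eqP => /finj-/(_ ka kb).
rewrite -subr_eq0 -mulrBr -val_eqNone !val_mul vab vl ?vt ?vle_refl //; exact: fB.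
Qed.

End Separated.

(** * The theorem *)

Section Assembly.
Variables (K : valuedField) (p : nat) (pK : p \in [pchar K]) (hK : maximal K).
Variables (A : set (set (vgroup K))) (hA : A = cosets (pmultiples (vgroup K) p)).
Variables (B : set (residue K)) (hB : is_basis (ppowers (residue K) p) B).
Variables (Tkappa : Type) (kappa : set Tkappa) (hkappa : is_card_max kappa A B).
Hypothesis hAB : ~ finite_set (A `*` B).
Variable W : vbasis K p.

Lemma kappa_infinite : infinite_set kappa.
Proof.
move=> kf; have [Ak Bk _] := hkappa; have [] := (infinite_AB hA hB).1 hAB; apply.
  exact: card_le_finite Ak kf.
exact: card_le_finite Bk kf.
Qed.

Hypothesis hN : nontrivial_valuation K.

Section Roots.
Variables (E : valuedField) (i : valuedExt K E) (hE : is_pth_roots p i).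
Variable C : nat -> vgroup K.

(** The clause on [C] lets one construction serve both versions of b): it takes effect when [C] is
    cofinal. *)
Definition good_subext T (lam : set T) (L : valuedField) (j : valuedExt K L)
    (k : valuedExt L E) : Prop :=
  [/\ forall x, k (j x) = i x, immediate k, algebraic_ext k, has_degree (range k) lam &
    (forall g, exists n, g <= C n) -> is_completion k].

Lemma sph_roots : sph_complete E.
Proof. exact/maximal_sph_complete/(maximal_pth pK hE). Qed.

Lemma roots_subext (J0 : set Tkappa) : J0 `<=` kappa ->
  exists (L : valuedField) (j : valuedExt K L) (k : valuedExt L E),
  (forall n, J0 #= `I_n -> good_subext `I_(p ^ n) j k) /\
  (infinite_set J0 -> good_subext J0 j k).
Proof.
move=> Jk; have [c [c_pos c_dis]] := separated_ex pK hA hB hkappa hN.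
have /choice[xi xiP] b : exists y, y ^+ p = i (vlift W b) by apply: hE.1.
have Winf := (vbset_infinite pK W hA hB).1 hAB.
have [L [j [k [jk ik ak [dn dinf] dk]]]] :=
  immediate_pth_subext pK hE xiP hN sph_roots c_pos c_dis Winf C Jk.
exists L, j, k; split=> [n Jn|Jinf]; split=> //; try by [apply: dn|apply: dinf];
  by move=> /dk kd; split; [exact: kd|exact: sph_val_complete sph_roots].
Qed.

Lemma roots_subext_fin n : exists (L : valuedField) (j : valuedExt K L) (k : valuedExt L E),
  good_subext `I_(p ^ n) j k.
Proof.
have [g [gk ginj]] := infinite_inj_nat kappa_infinite.
have [|L [j [k [H _]]]] := @roots_subext (g @` `I_n); first by move=> _ [m _ <-].
exists L, j, k; apply: H; apply: inj_card_eq => x y _ _; exact: ginj.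
Qed.

Lemma roots_subext_inf T (lam : set T) : infinite_set lam -> lam #<= kappa ->
  exists (L : valuedField) (j : valuedExt K L) (k : valuedExt L E), good_subext lam j k.
Proof.
move=> linf lk; have [a ka] := infinite_setN0 kappa_infinite.
have [f [fk finj]] := card_le_ex a lk.
have Jl : f @` lam #= lam.
  by apply: inj_card_eq => x y /set_mem lx /set_mem ly; apply: finj.
have [|L [j [k [_ H]]]] := @roots_subext (f @` lam); first by move=> _ [x lx <-]; apply: fk.
exists L, j, k; have [|jk ik ak [B' B'b B'J] ck] := H; first by move=> Jf; apply: linf; rewrite -(eq_finite_set Jl).
by split=> //; exists B' => //; apply: card_eq_trans Jl.
Qed.

(** [E] is itself a completion of [L], and any other one is isomorphic to it over [L]. *)
Lemma completion_subext T (lam : set T) (L : valuedField) (j : valuedExt K L)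
    (k : valuedExt L E) : (forall g, exists n, g <= C n) -> good_subext lam j k ->
  forall (M : valuedField) (c : valuedExt L M), is_completion c ->
  [/\ immediate c, algebraic_ext c & has_degree (range c) lam].
Proof.
move=> Ccof [jk ik ak dk /(_ Ccof) kc] M c cc.
have [phi [phi_onto phiE]] := completion_iso kc cc.
split; [exact: dense_immediate cc.1| |exact: has_degree_iso phi_onto phiE dk].
move=> u; have [y <-] := phi_onto u; have [x yx] := hE.2 y.
by apply: (alg_of_pth pK (x := j x)); rewrite -rmorphXn yx -jk phiE.
Qed.

End Roots.

Lemma tower_trdeg (L : valuedField) (j : valuedExt K L) : good_tower W j ->
  forall (M : valuedField) (m : valuedExt L M), max_immediate_ext m -> trdeg_ge m kappa.
Proof.
move=> jt M m [mi mM]; have [c [c_pos c_dis]] := separated_ex pK hA hB hkappa hN.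
apply: (trdeg_ge_tower pK hN c_pos c_dis (C := fun=> 0) jt).
  by move=> g; have [a <-] := mi.1 g; exists a.
exact: sph_has_limits (maximal_sph_complete mM).
Qed.

Lemma tower_trdeg_completion (L : valuedField) (j : valuedExt K L) :
  has_countable_cofinality (vgroup K) -> good_tower W j ->
  forall (M : valuedField) (m : valuedExt L M), is_completion m -> trdeg_ge m kappa.
Proof.
move=> /countable_cofinal_seq[C Ccof] jt M m [md Mc].
have [c [c_pos c_dis]] := separated_ex pK hA hB hkappa hN.
have mcof g : exists a, g <= ext_val m a.
  by have [a <-] := (dense_immediate md).1 g; exists a.
apply: (trdeg_ge_tower pK hN c_pos c_dis (C := C) jt mcof).
apply: complete_has_limits Mc _ => g; have [a ga] := mcof g; have [_ jcof _] := jt.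
have [b ab] := jcof a; have [n bn] := Ccof b; exists n; apply: le_trans ga _.
by rewrite /= ext_val_mono; apply: le_trans ab _; rewrite ext_val_mono.
Qed.

Lemma tower_value : infinite_set A -> exists (L : valuedField) (j : valuedExt K L),
  [/\ good_tower W j, is_pth_parts p (ext_val j) & onto (ext_res j)].
Proof.
move=> /(vb1_infinite pK W hA) W1.
have Yinf : infinite_set (inl @` vb1 W : set (vgroup K + residue K)).
  move=> Yf; apply: W1.
  suff e : (inl @` vb1 W : set (vgroup K + residue K)) #= vb1 W by rewrite -(eq_finite_set e).
  by apply: inj_card_eq => ? ? _ _ [].
have [|g Wg|L [j [jt jp _ jo]]] := @tower_parts_ex K p pK W hN _ Yinf.
- by move=> _ [g Wg <-].
- by exists g.
by exists L, j; split=> //; apply: jo => a [].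
Qed.

Lemma tower_residue : infinite_set B -> exists (L : valuedField) (j : valuedExt K L),
  [/\ good_tower W j, onto (ext_val j) & is_pth_roots p (ext_res j)].
Proof.
move=> /(vb2_infinite pK W hB) W2.
have Yinf : infinite_set (inr @` vb2 W : set (vgroup K + residue K)).
  move=> Yf; apply: W2.
  suff e : (inr @` vb2 W : set (vgroup K + residue K)) #= vb2 W by rewrite -(eq_finite_set e).
  by apply: inj_card_eq => ? ? _ _ [].
have [|g []//|L [j [jt jp jr]]] := @tower_onto_ex K p pK W hN _ Yinf.
  by move=> _ [g Wg <-].
by exists L, j; split=> //; apply: jr => a Wa; exists a.
Qed.

Lemma tower_both : exists (L : valuedField) (j : valuedExt K L),
  [/\ good_tower W j, is_pth_parts p (ext_val j) & is_pth_roots p (ext_res j)].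
Proof.
have Winf := (vbset_infinite pK W hA hB).1 hAB.
have [//|g Wg|L [j [jt jp jr _]]] := @tower_parts_ex K p pK W hN _ Winf; first by [].
by exists L, j; split=> //; apply: jr.
Qed.

End Assembly.

Theorem theorem1p4
  (K : valuedField) (p : nat) (hp : p \in [pchar K]) (hK : maximal K)
  (* [A] represents the index of [pvK] in [vK], [B] the degree of [Kv] over
     the field of its [p]-th powers *)
  (A : set (set (vgroup K))) (hA : A = cosets (pmultiples (vgroup K) p))
  (B : set (residue K)) (hB : is_basis (ppowers (residue K) p) B)
  (Tkappa : Type) (kappa : set Tkappa) (hkappa : is_card_max kappa A B)
  (* [E], with the embedding [i], is [K^(1/p)] *)
  (E : valuedField) (i : valuedExt K E) (hE : is_pth_roots p i) :
  (~ finite_set (A `*` B) <-> ~ finite_degree (ppowers K p)) /\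
  (~ finite_set (A `*` B) ->
   (* a) *)
   [/\ maximal E &
       (torsion_quotient (range (ext_val i)) /\
        infinite_set (cosets (range (ext_val i)))) \/
       (algebraic_ext (ext_res i) /\ ~ finite_degree (range (ext_res i)))] /\
   (nontrivial_valuation K ->
   (* b) *)
   [/\ forall n : nat,
         exists (L : valuedField) (j : valuedExt K L) (k : valuedExt L E),
           [/\ forall x, k (j x) = i x, immediate k, algebraic_ext k
             & has_degree (range k) `I_(p ^ n)]
     & forall (T : Type) (lambda : set T),
         infinite_set lambda -> lambda #<= kappa ->
         exists (L : valuedField) (j : valuedExt K L) (k : valuedExt L E),
           [/\ forall x, k (j x) = i x, immediate k, algebraic_ext k
             & has_degree (range k) lambda]] /\
   (* c) *)
   [/\ infinite_set A ->
         exists (L : valuedField) (j : valuedExt K L),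
           [/\ purely_inseparable_ext p j,
               is_pth_parts p (ext_val j), onto (ext_res j)
             & forall (M : valuedField) (m : valuedExt L M),
                 max_immediate_ext m -> trdeg_ge m kappa],
       infinite_set B ->
         exists (L : valuedField) (j : valuedExt K L),
           [/\ purely_inseparable_ext p j,
               onto (ext_val j), is_pth_roots p (ext_res j)
             & forall (M : valuedField) (m : valuedExt L M),
                 max_immediate_ext m -> trdeg_ge m kappa]
     & exists (L : valuedField) (j : valuedExt K L),
         [/\ purely_inseparable_ext p j,
             is_pth_parts p (ext_val j), is_pth_roots p (ext_res j)
           & forall (M : valuedField) (m : valuedExt L M),
               max_immediate_ext m -> trdeg_ge m kappa]] /\
   (has_countable_cofinality (vgroup K) ->
    (* b) with completions *)
    [/\ forall n : nat,
          exists (L : valuedField) (j : valuedExt K L) (k : valuedExt L E),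
            (forall x, k (j x) = i x) /\
            forall (C : valuedField) (c : valuedExt L C), is_completion c ->
              [/\ immediate c, algebraic_ext c
                & has_degree (range c) `I_(p ^ n)]
      & forall (T : Type) (lambda : set T),
          infinite_set lambda -> lambda #<= kappa ->
          exists (L : valuedField) (j : valuedExt K L) (k : valuedExt L E),
            (forall x, k (j x) = i x) /\
            forall (C : valuedField) (c : valuedExt L C), is_completion c ->
              [/\ immediate c, algebraic_ext c
                & has_degree (range c) lambda]] /\
    (* c) with completions *)
    [/\ infinite_set A ->
          exists (L : valuedField) (j : valuedExt K L),
            [/\ purely_inseparable_ext p j,
                is_pth_parts p (ext_val j), onto (ext_res j)
              & forall (C : valuedField) (c : valuedExt L C),
                  is_completion c -> trdeg_ge c kappa],
        infinite_set B ->
          exists (L : valuedField) (j : valuedExt K L),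
            [/\ purely_inseparable_ext p j,
                onto (ext_val j), is_pth_roots p (ext_res j)
              & forall (C : valuedField) (c : valuedExt L C),
                  is_completion c -> trdeg_ge c kappa]
      & exists (L : valuedField) (j : valuedExt K L),
          [/\ purely_inseparable_ext p j,
              is_pth_parts p (ext_val j), is_pth_roots p (ext_res j)
            & forall (C : valuedField) (c : valuedExt L C),
                is_completion c -> trdeg_ge c kappa]]))).
Proof.
have sK := maximal_sph_complete hK; have [W _] := vbasis_ex hp.
split; first exact: (degree_criterion hp W hA hB sK).
move=> hAB; split.
  split; first exact: (maximal_pth hp hE hK).
  have [Ainf|Binf] := (infinite_AB hA hB).1 hAB; [left|right].
    split; first exact: (pth_torsion hp hE).
    exact: (pth_infinite_cosets hp hE ((vb1_infinite hp W hA).1 Ainf)).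
  split; first exact: (pth_res_algebraic hp hE).
  exact: (pth_res_degree hp hE hB Binf).
move=> hN; split; [|split; [|move=> hcof; split]].
- split=> [n|T lambda linf lk].
    have [L [j [k [jk ik ak dk _]]]] := roots_subext_fin hp hK hA hB hkappa hAB W hN hE (fun=> 0) n.
    by exists L, j, k.
  have [L [j [k [jk ik ak dk _]]]] :=
    roots_subext_inf hp hK hA hB hkappa hAB W hN hE (fun=> 0) linf lk.
  by exists L, j, k.
- have trdeg := tower_trdeg hp hA hB hkappa hN.
  split=> [Ainf|Binf|].
  + have [L [j [jt jp jo]]] := tower_value hp hA W hN Ainf.
    by exists L, j; split=> //; [case: jt|exact: trdeg jt].
  + have [L [j [jt jp jo]]] := tower_residue hp hB W hN Binf.
    by exists L, j; split=> //; [case: jt|exact: trdeg jt].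
  have [L [j [jt jp jo]]] := tower_both hp hA hB hAB W hN.
  by exists L, j; split=> //; [case: jt|exact: trdeg jt].
- have [C Ccof] := countable_cofinal_seq hcof.
  split=> [n|T lambda linf lk].
    have [L [j [k good]]] := roots_subext_fin hp hK hA hB hkappa hAB W hN hE C n.
    exists L, j, k; split; first by case: good.
    exact: (completion_subext hp hE Ccof good).
  have [L [j [k good]]] := roots_subext_inf hp hK hA hB hkappa hAB W hN hE C linf lk.
  exists L, j, k; split; first by case: good.
  exact: (completion_subext hp hE Ccof good).
have trdeg L j := @tower_trdeg_completion K p hp A hA B hB Tkappa kappa hkappa W hN L j hcof.
split=> [Ainf|Binf|].
- have [L [j [jt jp jo]]] := tower_value hp hA W hN Ainf.
  by exists L, j; split=> //; [case: jt|exact: trdeg jt].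
- have [L [j [jt jp jo]]] := tower_residue hp hB W hN Binf.
  by exists L, j; split=> //; [case: jt|exact: trdeg jt].
have [L [j [jt jp jo]]] := tower_both hp hA hB hAB W hN.
by exists L, j; split=> //; [case: jt|exact: trdeg jt].
Qed.
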